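(* Let $1\le p\le q\le\infty$. Then there is no essentially isolated point in $\mathbf{V}(\mathcal{F}_p,\mathcal{F}_q)$: for every bounded $V_g\in\mathbf{V}(\mathcal{F}_p,\mathcal{F}_q)$ and every $r>0$ there exists $V_{g_1}\in\mathbf{V}(\mathcal{F}_p,\mathcal{F}_q)$ with $V_{g_1}\neq V_g$ and $\|V_g-V_{g_1}\|_e<r$.
   Context: For $0<p<\infty$, the Fock space $\mathcal{F}_p$ consists of entire functions $f$ on $\mathbb{C}$ with $\|f\|_p^p=\frac{p}{2\pi}\int_{\mathbb{C}}|f(z)|^pe^{-\frac p2|z|^2}\,dA(z)<\infty$, where $dA$ is Lebesgue area measure; $\mathcal{F}_\infty$ consists of entire $f$ with $\|f\|_\infty=\sup_{z\in\mathbb{C}}|f(z)|e^{-\frac12|z|^2}<\infty$. For an entire function $g$, the Volterra-type integral operator is $V_gf(z)=\int_0^z f(w)g'(w)\,dw$. $\mathbf{V}(\mathcal{F}_p,\mathcal{F}_q)$ denotes the set of all bounded operators $V_g:\mathcal{F}_p\to\mathcal{F}_q$ ($g$ entire). The essential norm of a bounded operator $T:\mathcal{F}_p\to\mathcal{F}_q$ is $\|T\|_e=\inf\{\|T-K\|: K \text{ compact}\}$; an operator is essentially isolated in $\mathbf{V}(\mathcal{F}_p,\mathcal{F}_q)$ if it is isolated with respect to the topology induced by $(S,T)\mapsto\|S-T\|_e$. *)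

(* Defs.v *)
From Stdlib Require Import Reals ClassicalEpsilon.
From Coquelicot Require Import Coquelicot.
From mathcomp Require Import all_boot all_algebra.
From mathcomp Require Import all_classical all_reals all_analysis Rstruct Rstruct_topology.

Set Implicit Arguments.
Unset Strict Implicit.
Unset Printing Implicit Defensive.

Definition entire (f : C -> C) : Prop :=
  forall z : C, exists l : C, @Derive.is_derive C_AbsRing C_NormedModule f z l.

(* the complex derivative g'(z) (uniquely determined when it exists) *)
Definition cderiv (g : C -> C) (z : C) : C :=
  epsilon (inhabits (RtoC 0%R))
    (fun l : C => @Derive.is_derive C_AbsRing C_NormedModule g z l).

(* V_g f (z) = \int_0^z f(w) g'(w) dw, the path integral along the segment
   [0,z] (path independent, since the integrand is entire):
   \int_0^1 f(t z) g'(t z) z dt. *)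
Definition Volterra (g : C -> C) (f : C -> C) : C -> C :=
  fun z => RInt (V := C_R_CompleteNormedModule)
             (fun t : R => Cmult (Cmult (f (Cmult (RtoC t) z)) (cderiv g (Cmult (RtoC t) z))) z)
             0%R 1%R.

Definition areaA := ((@lebesgue_measure R) \x (@lebesgue_measure R))%E.

Definition fock_norm (p : Rbar) (f : C -> C) : \bar R :=
  match p with
  | Rbar.Finite p =>
      (((p / (2 * PI))%R)%:E *
        \int[areaA]_(z in [set: C])
           ((@powR R (Cmod (f z)) p) * exp (- (p / 2) * (Cmod z) ^ 2))%R%:E)
        `^ (p^-1)%R
  | p_infty =>
      ereal_sup [set ((Cmod (f z)) * exp (- (Cmod z) ^ 2 / 2))%R%:E | z in [set: C]]
  | m_infty => +oo%E
  end.

Definition fock (p : Rbar) (f : C -> C) : Prop :=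
  entire f /\ (fock_norm p f < +oo)%E.

Definition op := (C -> C) -> (C -> C).

Definition op_sub (T S : op) : op := fun f z => Cminus (T f z) (S f z).

Definition linear_on (p : Rbar) (T : op) : Prop :=
  forall (f h : C -> C) (a b : C), fock p f -> fock p h ->
    T (fun z => Cplus (Cmult a (f z)) (Cmult b (h z)))
    = (fun z => Cplus (Cmult a (T f z)) (Cmult b (T h z))).

Definition bounded_op (p q : Rbar) (T : op) : Prop :=
  linear_on p T /\ (forall f, fock p f -> fock q (T f)) /\
  exists M : R, forall f, fock p f ->
    (fock_norm q (T f) <= M%:E * fock_norm p f)%E.

Definition compact_op (p q : Rbar) (K : op) : Prop :=
  bounded_op p q K /\
  forall u : nat -> (C -> C),
    (forall n, fock p (u n) /\ (fock_norm p (u n) <= 1)%E) ->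
    exists (phi : nat -> nat) (h : C -> C),
      (forall n, (phi n < phi n.+1)%N) /\ fock q h /\
      ((fun n => fock_norm q (fun z => Cminus (K (u (phi n)) z) (h z)))
        @ \oo --> (0%E : \bar R))%classic.

Definition op_norm (p q : Rbar) (T : op) : \bar R :=
  ereal_sup [set fock_norm q (T f) | f in [set f | fock p f /\ (fock_norm p f <= 1)%E]].

Definition ess_norm (p q : Rbar) (T : op) : \bar R :=
  ereal_inf [set op_norm p q (op_sub T K) | K in [set K | compact_op p q K]].

Definition in_V (p q : Rbar) (g : C -> C) : Prop :=
  entire g /\ bounded_op p q (Volterra g).

(* Main.v *)
(** If [Volterra g] does not vanish on the Fock space, [g1 = (1 + e) g] with [e] small
    works: [Volterra g1] is [(1 + e)] times [Volterra g], and the zero operator already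
    witnesses the smallness of the essential norm of the difference. Otherwise take
    [g1 = c z^2 / 2] with [c] small; everything then rests on the boundedness from [F_p]
    to [F_q] of [U f (z) = int_0^1 f (t z) (t z) z dt].

    Put [phi = |f| exp (- |.|^2 / 2)]. Jensen's inequality for the kernel
    [t |z|^2 exp (- (1 - t^2) |z|^2 / 2)], of mass at most [1] on [[0, 1]], bounds the
    [p]-th power of [|U f (z)| exp (- |z|^2 / 2)] by the average of [phi (t z) ^ p]. After
    Tonelli and the dilation [w = t z] the integral in [t] of the dilated kernel is again
    at most [1], so [U] is a contraction of [F_p]. Cauchy's inequality on squares, applied
    to [f] times an exponential that recentres the Gaussian weight and averaged over the
    size of the square, bounds [phi] pointwise by the [F_p] norm of [f], whence [F_p]
    embeds in [F_q] for [p <= q]. Goursat's theorem provides the primitives showing that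
    [U f] is entire. *)
Require Import Defs.
From Stdlib Require Import Reals Lra Classical ClassicalEpsilon.
From Coquelicot Require Import Coquelicot.
From mathcomp Require Import all_boot all_algebra.
From mathcomp Require Import all_classical all_reals all_analysis Rstruct Rstruct_topology.

(** The two cases stem from one obstacle: the continuity of the derivative of an entire function is
    never established. Perturbing every [g] by a multiple of [z^2] would require the integral to be
    additive in the symbol, hence [f g'] to be integrable along rays. Scaling [g] requires only
    homogeneity, and when [V_g] vanishes there is nothing to be added to. The symbol [z^2 / 2] suits
    the estimate because its derivative [w] makes the kernel an exact derivative in [t] both before
    and after the dilation: of [exp (- (1 - t^2) |z|^2 / 2)] and of [exp (- (t^-2 - 1) |w|^2 / 2)].
    Both masses are therefore explicit. Cauchy's inequality is taken on squares rather than circles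
    because their sides are parallel to the axes: averaging over the size yields an area integral by
    Tonelli alone, without polar coordinates. *)

Section ComplexAnalysis.
Set Implicit Arguments.
Unset Strict Implicit.
Unset Printing Implicit Defensive.
Import Stdlib.Reals.Rtrigo_def Stdlib.Reals.Rpower Coquelicot.Coquelicot.
Local Delimit Scope R_scope with coqR.
Local Open Scope R_scope.
Local Open Scope C_scope.
Notation CInt := (RInt (V := C_R_CompleteNormedModule)).
Notation is_CInt := (@is_RInt C_R_NormedModule).
Notation rcont := (@continuous R_UniformSpace C_UniformSpace).
Notation ccontR := (@continuous C_UniformSpace R_UniformSpace).
Notation Rcont := (@continuous R_UniformSpace R_UniformSpace).

(* [ring] does not see through the module structures carried by [C]. *)
Ltac Cring := match goal with |- @eq _ ?x ?y => change (@eq C x y) end; ring.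

(** * Complex derivatives and integrals *)

Definition cdiff (f : C -> C) (z l : C) : Prop :=
  forall eps : R, 0 < eps -> exists d : R, 0 < d /\
    forall w : C, Cmod (w - z) < d ->
      Cmod (f w - f z - l * (w - z)) <= (eps * Cmod (w - z))%coqR.

Lemma locally_Cmod (z : C) (P : C -> Prop) :
  @locally C_UniformSpace z P <->
  exists d : R, 0 < d /\ forall w, Cmod (w - z) < d -> P w.
Proof.
split.
- move=> /locally_C[d Hd]; exists d; split; first exact: cond_pos.
  by move=> w Hw; apply: Hd.
- by move=> [d [d0 Hd]]; apply/locally_C; exists (mkposreal d d0) => w Hw; apply: Hd.
Qed.

Lemma is_derive_cdiff (f : C -> C) (z l : C) :
  @is_derive C_AbsRing C_NormedModule f z l <-> cdiff f z l.
Proof.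
split.
- move=> [_ H] e e0.
  have /locally_C/locally_Cmod[d [d0 Hd]] := H z (fun P H => H) (mkposreal e e0).
  by exists d; split=> // w /Hd; rewrite Cmult_comm.
- move=> H; split; first exact: is_linear_scal_l.
  move=> x /is_filter_lim_locally_unique <- e.
  apply/locally_C/locally_Cmod.
  have [d [d0 Hd]] := H e (cond_pos e).
  by exists d; split=> // w /Hd; rewrite Cmult_comm.
Qed.

(** The product rule and the inner function of the chain rule live in the module structure that the
    ring [C] carries on itself, whereas [entire] uses another one; [cdiff] is the common form
    through which they are exchanged. *)
Lemma is_derive_ring_cdiff (f : C -> C) (z l : C) :
  @is_derive C_AbsRing (AbsRing_NormedModule C_AbsRing) f z l <-> cdiff f z l.
Proof.
rewrite -is_derive_cdiff; split.
- move=> [L H]; split; first exact: is_linear_scal_l.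
  by move=> x Hx e; apply: H.
- move=> [L H]; split; first exact: is_linear_scal_l.
  by move=> x Hx e; apply: H.
Qed.

Definition ccont (f : C -> C) : Prop :=
  forall z, @continuous C_UniformSpace C_UniformSpace f z.

Lemma continuous_Cmod_eps (f : C -> C) (z : C) :
  @continuous C_UniformSpace C_UniformSpace f z <->
  forall eps : R, 0 < eps -> exists d : R, 0 < d /\
    forall w : C, Cmod (w - z) < d -> Cmod (f w - f z) < eps.
Proof.
split.
- move=> H e e0; apply/locally_Cmod.
  apply: (H (fun y => Cmod (y - f z) < e)).
  by apply/locally_Cmod; exists e.
- move=> H P /locally_Cmod[e [e0 He]].
  have [d [d0 Hd]] := H e e0.
  by apply/locally_Cmod; exists d; split=> // w /Hd/He.
Qed.

Lemma cdiff_continuous f z l : cdiff f z l ->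
  @continuous C_UniformSpace C_UniformSpace f z.
Proof.
move=> H; apply/continuous_Cmod_eps => e e0.
have [d [d0 Hd]] := H 1 Rlt_0_1.
have l1 : 0 < (Cmod l + 1)%coqR by have := Cmod_ge_0 l; lra.
exists (Rmin d (e / (Cmod l + 1))); split.
  by apply: Rmin_pos => //; apply: Rdiv_lt_0_compat.
move=> w Hw.
have Hwd := Rlt_le_trans _ _ _ Hw (Rmin_l _ _).
have Hwe := Rlt_le_trans _ _ _ Hw (Rmin_r _ _).
have -> : f w - f z = (f w - f z - l * (w - z)) + l * (w - z) by ring.
apply: (Rle_lt_trans _ _ _ (Cmod_triangle _ _)).
rewrite Cmod_mult.
apply: (Rle_lt_trans _ ((Cmod l + 1) * Cmod (w - z))%coqR).
  have := Hd w Hwd; lra.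
have := Rmult_lt_compat_l _ _ _ l1 Hwe.
by have -> : ((Cmod l + 1) * (e / (Cmod l + 1)) = e)%coqR by field; lra.
Qed.

Lemma entire_cdiff f : entire f -> forall z, exists l, cdiff f z l.
Proof. by move=> H z; have [l /is_derive_cdiff ?] := H z; exists l. Qed.

Lemma entire_ccont f : entire f -> ccont f.
Proof. by move=> H z; have [l] := entire_cdiff H z; apply: cdiff_continuous. Qed.

Lemma cdiff_unique f z l1 l2 : cdiff f z l1 -> cdiff f z l2 -> l1 = l2.
Proof.
move=> /is_derive_cdiff H1 /is_derive_cdiff H2.
by rewrite -(is_C_derive_unique _ _ _ H1) -(is_C_derive_unique _ _ _ H2).
Qed.

Lemma cderivE g z l : cdiff g z l -> cderiv g z = l.
Proof.
move=> H; rewrite /cderiv.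
apply: (@cdiff_unique g z) => //; apply/is_derive_cdiff.
apply: epsilon_spec; exists l; exact/is_derive_cdiff.
Qed.

Lemma cdiff_ext f g z l : (forall w, f w = g w) -> cdiff f z l -> cdiff g z l.
Proof.
move=> E H e e0; have [d [d0 Hd]] := H e e0.
by exists d; split=> // w /Hd; rewrite !E.
Qed.

Lemma cdiff_id z : cdiff (fun w => w) z 1.
Proof. by apply/is_derive_ring_cdiff; apply: (@is_derive_id C_AbsRing). Qed.

Lemma cdiff_const c z : cdiff (fun _ => c) z 0.
Proof. by apply/is_derive_cdiff; apply: (@is_derive_const C_AbsRing). Qed.

Lemma cdiff_plus f g z a b : cdiff f z a -> cdiff g z b ->
  cdiff (fun w => f w + g w) z (a + b).
Proof.
move=> /is_derive_cdiff H1 /is_derive_cdiff H2; apply/is_derive_cdiff.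
exact: (@is_derive_plus C_AbsRing).
Qed.

Lemma cdiff_mult f g z a b : cdiff f z a -> cdiff g z b ->
  cdiff (fun w => f w * g w) z (a * g z + f z * b).
Proof.
move=> /is_derive_ring_cdiff H1 /is_derive_ring_cdiff H2.
apply/is_derive_ring_cdiff.
exact: (@is_derive_mult C_AbsRing f g z a b H1 H2 Cmult_comm).
Qed.

Lemma cdiff_comp f g z a b : cdiff f (g z) a -> cdiff g z b ->
  cdiff (fun w => f (g w)) z (a * b).
Proof.
move=> /is_derive_cdiff H1 /is_derive_ring_cdiff H2; apply/is_derive_cdiff.
rewrite Cmult_comm.
exact: (@is_derive_comp C_AbsRing C_NormedModule f g z a b H1 H2).
Qed.

Lemma entire_mult f g : entire f -> entire g -> entire (fun w => f w * g w).
Proof.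
move=> Hf Hg z; have [a Ha] := entire_cdiff Hf z; have [b Hb] := entire_cdiff Hg z.
by eexists; apply/is_derive_cdiff; apply: cdiff_mult; eauto.
Qed.

Lemma rcont_ex_CInt (u : R -> C) a b : (forall t, rcont u t) ->
  @ex_RInt C_R_NormedModule u a b.
Proof.
by move=> H; apply: (@ex_RInt_continuous C_R_CompleteNormedModule) => t _; apply: H.
Qed.

Lemma rcont_is_CInt (u : R -> C) a b : (forall t, rcont u t) ->
  is_CInt u a b (CInt u a b).
Proof.
by move=> H; apply: (@RInt_correct C_R_CompleteNormedModule); apply: rcont_ex_CInt.
Qed.

Lemma continuous_pair (T : UniformSpace) (u v : T -> R) t :
  @continuous T R_UniformSpace u t -> @continuous T R_UniformSpace v t ->
  @continuous T C_UniformSpace (fun s => (u s, v s)) t.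
Proof.
move=> Hu Hv.
apply: (@continuous_comp_2 T R_UniformSpace R_UniformSpace C_UniformSpace u v pair t Hu Hv).
apply: (continuous_ext (fun x => x)); first by case.
exact: continuous_id.
Qed.

Lemma rcont_comp f (u v : R -> R) t : ccont f ->
  @continuous R_UniformSpace R_UniformSpace u t ->
  @continuous R_UniformSpace R_UniformSpace v t ->
  rcont (fun s => f (u s, v s)) t.
Proof.
move=> Hf Hu Hv.
apply: (@continuous_comp R_UniformSpace C_UniformSpace C_UniformSpace (fun s => (u s, v s)) f).
  exact: continuous_pair.
exact: Hf.
Qed.

(** The integral is that of a real module, for which a complex factor is not a scalar; hence the
    passage to coordinates. *)
Lemma is_CInt_Cmult (u : R -> C) a b (c l : C) :
  is_CInt u a b l -> is_CInt (fun t => c * u t) a b (c * l).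
Proof.
move=> H.
have H1 := @is_RInt_fct_extend_fst R_NormedModule R_NormedModule _ _ _ _ H.
have H2 := @is_RInt_fct_extend_snd R_NormedModule R_NormedModule _ _ _ _ H.
have E (k : R) (v : R -> R) m : is_RInt v a b m ->
    is_RInt (fun t => k * v t)%coqR a b (k * m)%coqR.
  by move=> Hv; apply: (@is_RInt_scal R_NormedModule).
apply: (@is_RInt_fct_extend_pair R_NormedModule R_NormedModule) => /=.
- exact: (@is_RInt_minus R_NormedModule _ _ _ _ _ _ (E _ _ _ H1) (E _ _ _ H2)).
- exact: (@is_RInt_plus R_NormedModule _ _ _ _ _ _ (E _ _ _ H2) (E _ _ _ H1)).
Qed.

Lemma CInt_unique (u : R -> C) a b l : is_CInt u a b l -> CInt u a b = l.
Proof. exact: (@is_RInt_unique C_R_CompleteNormedModule). Qed.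

Lemma CInt_ext (u v : R -> C) a b :
  (forall x, (Rmin a b <= x <= Rmax a b)%coqR -> u x = v x) -> CInt u a b = CInt v a b.
Proof.
by move=> H; apply: (@RInt_ext C_R_CompleteNormedModule) => x Hx; apply: H; lra.
Qed.

Lemma CInt_minus (u v : R -> C) a b :
  (forall t, rcont u t) -> (forall t, rcont v t) ->
  CInt (fun t => u t - v t) a b = CInt u a b - CInt v a b.
Proof.
move=> Hu Hv; apply: CInt_unique.
exact: (@is_RInt_minus C_R_NormedModule _ _ _ _ _ _ (rcont_is_CInt Hu) (rcont_is_CInt Hv)).
Qed.

Lemma CInt_Chasles (u : R -> C) a b c : (forall t, rcont u t) ->
  CInt u a c = CInt u a b + CInt u b c.
Proof.
move=> H; apply/esym.
by apply: (@RInt_Chasles C_R_CompleteNormedModule); apply: rcont_ex_CInt.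
Qed.

Lemma CInt_le_const (u : R -> C) a b M : (forall t, rcont u t) ->
  (forall x, (Rmin a b <= x <= Rmax a b)%coqR -> Cmod (u x) <= M) ->
  Cmod (CInt u a b) <= (Rabs (b - a) * M)%coqR.
Proof.
move=> Hu H; rewrite Cmod_norm.
apply: (@norm_RInt_le_const_abs C_R_NormedModule u); last exact: rcont_is_CInt.
by move=> x /H; rewrite Cmod_norm.
Qed.

Lemma CInt_le (u : R -> C) (v : R -> R) a b : (forall t, rcont u t) ->
  (a <= b)%coqR -> ex_RInt v a b ->
  (forall x, (a <= x <= b)%coqR -> Cmod (u x) <= v x) ->
  Cmod (CInt u a b) <= RInt v a b.
Proof.
move=> Hu ab Hv H; rewrite Cmod_norm.
apply: (@norm_RInt_le C_R_NormedModule u v a b) => //; last first.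
- exact: (@RInt_correct R_CompleteNormedModule).
- exact: rcont_is_CInt.
by move=> x /H; rewrite Cmod_norm.
Qed.

Lemma C_scalE (r : R) (v : C) : @scal R_AbsRing C_R_NormedModule r v = RtoC r * v.
Proof.
case: v => v1 v2; apply: injective_projections.
- by change ((r * v1)%coqR = (r * v1 - 0 * v2)%coqR); ring.
- by change ((r * v2)%coqR = (r * v2 + 0 * v1)%coqR); ring.
Qed.

Lemma CInt_const a b (c : C) : CInt (fun _ => c) a b = RtoC (b - a) * c.
Proof.
by rewrite RInt_const C_scalE.
Qed.

Lemma cdiff_line F l (z k : C) (t : R) : cdiff F (z + t * k) l ->
  @is_derive R_AbsRing C_R_NormedModule (fun s : R => F (z + s * k)) t (k * l).
Proof.
move=> H; split; first exact: is_linear_scal_l.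
move=> x /is_filter_lim_locally_unique <- e.
have k1 : 0 < (Cmod k + 1)%coqR by have := Cmod_ge_0 k; lra.
have [d [d0 Hd]] := H (e / (Cmod k + 1))%coqR (Rdiv_lt_0_compat _ _ (cond_pos e) k1).
have dk : 0 < (d / (Cmod k + 1))%coqR by apply: Rdiv_lt_0_compat.
exists (mkposreal _ dk) => s Hs.
have Hs' : (Rabs (s - t) < d / (Cmod k + 1))%coqR by exact: Hs.
have E : Cmod (z + s * k - (z + t * k)) = (Rabs (s - t) * Cmod k)%coqR.
  have -> : z + s * k - (z + t * k) = (RtoC (s - t)) * k by rewrite RtoC_minus; ring.
  by rewrite Cmod_mult Cmod_R.
have k0 := Cmod_ge_0 k; have st0 := Rabs_pos (s - t).
have := Hd (z + s * k); rewrite E => /(_ _) HH.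
have : (Rabs (s - t) * Cmod k < d)%coqR.
  apply: (Rle_lt_trans _ (Rabs (s - t) * (Cmod k + 1))%coqR); first nra.
  have := Rmult_lt_compat_r _ _ _ k1 Hs'.
  by have -> : (d / (Cmod k + 1) * (Cmod k + 1) = d)%coqR by field; lra.
move/HH => {}HH.
rewrite -Cmod_norm.
set X := (X in Cmod X).
have EX : X = F (z + s * k) - F (z + t * k) - RtoC (s - t) * (k * l).
  by rewrite -(C_scalE (s - t)).
have {}EX : X = F (z + s * k) - F (z + t * k) - l * (z + s * k - (z + t * k)).
  rewrite EX RtoC_minus; Cring.
rewrite EX.
apply: (Rle_trans _ _ _ HH).
change (norm (minus s t)) with (Rabs (s - t)).
have e0 := cond_pos e.
have -> : (e / (Cmod k + 1) * (Rabs (s - t) * Cmod k) = e * Rabs (s - t) * (Cmod k / (Cmod k + 1)))%coqR by field; lra.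
rewrite -[X in (_ <= X)%coqR]Rmult_1_r; apply: Rmult_le_compat_l; first nra.
apply/Rle_div_l; lra.
Qed.

Lemma CInt_cdiff F f (z k : C) (a b : R) : ccont f ->
  (forall w, cdiff F w (f w)) ->
  CInt (fun s : R => k * f (z + s * k)) a b = F (z + b * k) - F (z + a * k).
Proof.
move=> Hf HF; apply: CInt_unique.
apply: (@is_RInt_derive C_R_CompleteNormedModule (fun s : R => F (z + s * k))).
  by move=> x _; apply: cdiff_line.
move=> x _.
have E : ccont (fun w => k * f w).
  move=> w; apply/continuous_Cmod_eps => e e0.
  have k1 : 0 < (Cmod k + 1)%coqR by have := Cmod_ge_0 k; lra.
  have [d [d0 Hd]] := (proj1 (continuous_Cmod_eps f w) (Hf w)) (e / (Cmod k + 1))%coqR (Rdiv_lt_0_compat _ _ e0 k1).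
  exists d; split=> // v /Hd.
  have -> : k * f v - k * f w = k * (f v - f w) by ring.
  rewrite Cmod_mult => Hv; have k0 := Cmod_ge_0 k; have v0 := Cmod_ge_0 (f v - f w).
  apply: (Rle_lt_trans _ ((Cmod k + 1) * Cmod (f v - f w))%coqR); first nra.
  have := Rmult_lt_compat_l _ _ _ k1 Hv.
  by have -> : ((Cmod k + 1) * (e / (Cmod k + 1)) = e)%coqR by field; lra.
have lin (c d : R) : @continuous R_UniformSpace R_UniformSpace (fun s => c + s * d)%coqR x.
  by apply: (@ex_derive_continuous R_AbsRing R_NormedModule); auto_derive.
apply: (continuous_ext (fun s : R => k * f (z.1 + s * k.1, z.2 + s * k.2)%coqR)).
  move=> s; congr (k * f _); apply: injective_projections; rewrite /=; ring.
exact: (@rcont_comp (fun w => k * f w)).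
Qed.

(** * Goursat's theorem *)

Definition hseg (f : C -> C) (a b y : R) : C := CInt (fun x => f (x, y)) a b.
Definition vseg (f : C -> C) (x c d : R) : C := CInt (fun y => f (x, y)) c d.

(** The counterclockwise integral of [f(w) dw] around the rectangle: bottom, right, top, left, with
    [dw = i dy] on the vertical sides. The bounds may come in any order. *)
Definition rect_int (f : C -> C) (a b c d : R) : C :=
  hseg f a b c + Ci * vseg f b c d - hseg f a b d - Ci * vseg f a c d.

Lemma rcont_h f y : ccont f -> forall t, rcont (fun x : R => f (x, y)) t.
Proof.
move=> Hf t; apply: (@rcont_comp f (fun x => x) (fun _ => y) t Hf).
  exact: (@continuous_id R_UniformSpace).
exact: (@continuous_const R_UniformSpace R_UniformSpace).
Qed.

Lemma rcont_v f x : ccont f -> forall t, rcont (fun y : R => f (x, y)) t.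
Proof.
move=> Hf t; apply: (@rcont_comp f (fun _ => x) (fun y => y) t Hf).
  exact: (@continuous_const R_UniformSpace R_UniformSpace).
exact: (@continuous_id R_UniformSpace).
Qed.

Lemma rect_int_splitx f a m b c d : ccont f ->
  rect_int f a b c d = rect_int f a m c d + rect_int f m b c d.
Proof.
move=> Hf; rewrite /rect_int /hseg.
rewrite (@CInt_Chasles _ a m b); last exact: rcont_h.
rewrite (@CInt_Chasles _ a m b (@rcont_h f d Hf)).
by rewrite /vseg; ring.
Qed.

Lemma rect_int_splity f a b c m d : ccont f ->
  rect_int f a b c d = rect_int f a b c m + rect_int f a b m d.
Proof.
move=> Hf; rewrite /rect_int /vseg.
rewrite (@CInt_Chasles _ c m d); last exact: rcont_v.
rewrite (@CInt_Chasles _ c m d (@rcont_v f a Hf)).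
by rewrite /hseg; ring.
Qed.

Lemma rect_int_minus f g a b c d : ccont f -> ccont g ->
  rect_int (fun w => f w - g w) a b c d = rect_int f a b c d - rect_int g a b c d.
Proof.
move=> Hf Hg; rewrite /rect_int /hseg /vseg.
have rh := fun y => @rcont_h f y Hf; have rv := fun x => @rcont_v f x Hf.
have sh := fun y => @rcont_h g y Hg; have sv := fun x => @rcont_v g x Hg.
rewrite (CInt_minus _ _ (rh c) (sh c)) (CInt_minus _ _ (rh d) (sh d)).
rewrite (CInt_minus _ _ (rv a) (sv a)) (CInt_minus _ _ (rv b) (sv b)).
by ring.
Qed.

Lemma rect_int_primitive F f a b c d : ccont f -> (forall w, cdiff F w (f w)) ->
  rect_int f a b c d = 0.
Proof.
move=> Hf HF; rewrite /rect_int.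
have h y : hseg f a b y = F (b, y) - F (a, y).
  have := @CInt_cdiff F f (0, y)%coqR 1 a b Hf HF.
  have E (t : R) : (0, y)%coqR + t * 1 = (t, y).
    by apply: injective_projections => /=; ring.
  rewrite !E => <-; rewrite /hseg; apply: CInt_ext => x _.
  by rewrite E Cmult_1_l.
have v x : Ci * vseg f x c d = F (x, d) - F (x, c).
  have := @CInt_cdiff F f (x, 0)%coqR Ci c d Hf HF.
  have E (t : R) : (x, 0)%coqR + t * Ci = (x, t).
    by apply: injective_projections => /=; ring.
  rewrite !E => <-; rewrite /vseg; apply/esym/CInt_unique.
  apply: (@is_RInt_ext C_R_NormedModule (fun t => Ci * f (x, t))) => [t _|].
    by rewrite E.
  exact: is_CInt_Cmult (rcont_is_CInt (@rcont_v f x Hf)).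
by rewrite !h !v; ring.
Qed.

Lemma rect_int_le f a b c d M : ccont f -> (a <= b)%coqR -> (c <= d)%coqR ->
  (forall x y, (a <= x <= b)%coqR -> (c <= y <= d)%coqR -> Cmod (f (x, y)) <= M) ->
  Cmod (rect_int f a b c d) <= (2 * ((b - a) + (d - c)) * M)%coqR.
Proof.
move=> Hf ab cd H; rewrite /rect_int.
have h y : (c <= y <= d)%coqR -> Cmod (hseg f a b y) <= ((b - a) * M)%coqR.
  move=> Hy; rewrite -[X in (X * _)%coqR]Rabs_pos_eq; last lra.
  apply: CInt_le_const; first exact: rcont_h.
  by rewrite Rmin_left // Rmax_right // => x Hx; apply: H.
have v x : (a <= x <= b)%coqR -> Cmod (Ci * vseg f x c d) <= ((d - c) * M)%coqR.
  move=> Hy; rewrite -[X in (X * _)%coqR]Rabs_pos_eq; last lra.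
  rewrite Cmod_mult; have -> : Cmod Ci = 1%coqR.
    rewrite /Cmod /= -[RHS]sqrt_1; congr sqrt; ring.
  rewrite Rmult_1_l; apply: CInt_le_const; first exact: rcont_v.
  by rewrite Rmin_left // Rmax_right // => y Hx; apply: H.
have T (x y z t : C) : Cmod (x + y - z - t) <= (Cmod x + Cmod y + Cmod z + Cmod t)%coqR.
  rewrite -(Cmod_opp z) -(Cmod_opp t).
  have := Cmod_triangle (x + y - z) (- t); have := Cmod_triangle (x + y) (- z).
  have := Cmod_triangle x y; rewrite /Cminus; lra.
have := T (hseg f a b c) (Ci * vseg f b c d) (hseg f a b d) (Ci * vseg f a c d).
have := h c; have := h d; have := v a; have := v b => h1 h2 h3 h4 h5.
have := h1 _; have := h2 _; have := h3 _; have := h4 _; lra.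
Qed.

Record rectangle := Rectangle { rl : R; rr : R; rb : R; rt : R }.

Definition rint f (r : rectangle) := rect_int f (rl r) (rr r) (rb r) (rt r).

Definition quarter (i j : bool) (r : rectangle) : rectangle :=
  let mx := ((rl r + rr r) / 2)%coqR in let my := ((rb r + rt r) / 2)%coqR in
  Rectangle (if i then mx else rl r) (if i then rr r else mx)
            (if j then my else rb r) (if j then rt r else my).

Lemma rint_quarters f r : ccont f ->
  rint f r = rint f (quarter false false r) + rint f (quarter false true r)
    + rint f (quarter true false r) + rint f (quarter true true r).
Proof.
move=> Hf; rewrite /rint /=.
rewrite (@rect_int_splitx f _ ((rl r + rr r) / 2)%coqR) //.
rewrite (@rect_int_splity f _ ((rl r + rr r) / 2)%coqR _ ((rb r + rt r) / 2)%coqR) //.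
rewrite (@rect_int_splity f _ (rr r) _ ((rb r + rt r) / 2)%coqR) //.
by ring.
Qed.

Lemma rint_quarter_large f r : ccont f ->
  exists i j, Cmod (rint f r) <= (4 * Cmod (rint f (quarter i j r)))%coqR.
Proof.
move=> Hf; apply: NNPP => H.
have L i j : (4 * Cmod (rint f (quarter i j r)) < Cmod (rint f r))%coqR.
  by apply: Rnot_le_lt => Hl; apply: H; exists i; exists j.
have := L false false; have := L false true; have := L true false; have := L true true.
have := rint_quarters r Hf.
set A := rint f (quarter false false r); set B := rint f (quarter false true r).
set A' := rint f (quarter true false r); set B' := rint f (quarter true true r).
move=> E; have := Cmod_triangle (A + B + A') B'; rewrite -E; have := Cmod_triangle (A + B) A'.
have := Cmod_triangle A B; lra.
Qed.

Lemma rectangle_descent f r : ccont f -> exists s : nat -> rectangle,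
  s 0%N = r /\ forall n, (exists i j, s n.+1 = quarter i j (s n)) /\
     Cmod (rint f (s n)) <= (4 * Cmod (rint f (s n.+1)))%coqR.
Proof.
move=> Hf.
pose P r q := (exists i j, q = quarter i j r) /\
     Cmod (rint f r) <= (4 * Cmod (rint f q))%coqR.
have H r' : exists q, P r' q.
  have [i [j H]] := @rint_quarter_large f r' Hf.
  by exists (quarter i j r'); split=> //; exists i; exists j.
exists (fun n => iter n (fun r => epsilon (inhabits r) (P r)) r); split=> // n /=.
set r' := iter n _ r.
exact: (epsilon_spec (inhabits r') (P r') (H r')).
Qed.

Lemma nested_intervals (a b : nat -> R) :
  (forall n, a n <= a n.+1 /\ b n.+1 <= b n /\ a n <= b n)%coqR ->
  exists x, forall n, (a n <= x <= b n)%coqR.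
Proof.
move=> H.
have Hb n m : (b (n + m)%N <= b n)%coqR.
  elim: m => [|m IH]; first by rewrite addn0; apply: Rle_refl.
  by rewrite addnS; have [_ [? _]] := H (n + m)%N; lra.
have Ha n m : (a n <= a (n + m)%N)%coqR.
  elim: m => [|m IH]; first by rewrite addn0; apply: Rle_refl.
  by rewrite addnS; have [? _] := H (n + m)%N; lra.
have ab n m : (a n <= b m)%coqR.
  have := Ha n m; have := Hb m n; rewrite addnC; have [_ [_ ?]] := H (n + m)%N; lra.
have [l Hl] := ex_finite_lim_seq_incr a (b 0%N) (fun n => proj1 (H n)) (fun n => ab n 0%N).
exists l => n; split.
- exact: (is_lim_seq_incr_compare _ _ Hl (fun n => proj1 (H n))).
- exact: (is_lim_seq_le _ _ _ _ (fun m => ab m n) Hl (is_lim_seq_const (b n))).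
Qed.

Lemma half_pow_small (M e : R) : (0 < e)%coqR -> exists n, (M * (/ 2) ^ n < e)%coqR.
Proof.
move=> e0; have M1 : (0 < Rabs M + 1)%coqR by have := Rabs_pos M; lra.
have [|N HN] := pow_lt_1_zero (/ 2) _ (e / (Rabs M + 1)) (Rdiv_lt_0_compat _ _ e0 M1).
  by rewrite Rabs_pos_eq; lra.
exists N; have := HN N (Nat.le_refl N).
have p0 : (0 < (/ 2) ^ N)%coqR by apply: pow_lt; lra.
rewrite Rabs_pos_eq; last lra.
move=> /(Rmult_lt_compat_l _ _ _ M1).
have -> : ((Rabs M + 1) * (e / (Rabs M + 1)) = e)%coqR by field; lra.
have := Rle_abs M; nra.
Qed.

(** The classical bisection. Differentiability is asked on the rectangle only, so that the lemma
    applies to a difference quotient on rectangles avoiding its centre, where it is only known to be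
    continuous. *)
Lemma goursat f a b c d : ccont f -> (a <= b)%coqR -> (c <= d)%coqR ->
  (forall x y, (a <= x <= b)%coqR -> (c <= y <= d)%coqR -> exists l, cdiff f (x, y) l) ->
  rect_int f a b c d = 0.
Proof.
move=> Hf ab cd Hd.
have [s [s0 Hs]] := rectangle_descent (Rectangle a b c d) Hf.
have size n : (rr (s n) - rl (s n) = (b - a) * (/ 2) ^ n /\
               rt (s n) - rb (s n) = (d - c) * (/ 2) ^ n)%coqR.
  elim: n => [|n [IH1 IH2]]; first by rewrite s0 /=; lra.
  have [[i [j ->]] _] := Hs n; rewrite -!tech_pow_Rmult.
  by case: i; case: j => /=; lra.
have p0 n : (0 < (/ 2) ^ n)%coqR by apply: pow_lt; lra.
have ordx n : (rl (s n) <= rr (s n))%coqR by have := size n; have := p0 n; nra.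
have ordy n : (rb (s n) <= rt (s n))%coqR by have := size n; have := p0 n; nra.
have [x Hx] : exists x, forall n, (rl (s n) <= x <= rr (s n))%coqR.
  apply: nested_intervals => n; have [[i [j ->]] _] := Hs n; have := ordx n.
  by case: i => /=; lra.
have [y Hy] : exists x, forall n, (rb (s n) <= x <= rt (s n))%coqR.
  apply: nested_intervals => n; have [[i [j ->]] _] := Hs n; have := ordy n.
  by case: j => /=; lra.
(* Each bisection keeps at least a quarter of the integral. The quarter is written as a product of
   halves to match the perimeter times the diameter, both of order [K 2^-n]. *)
have large n : (Cmod (rect_int f a b c d) * ((/ 2) ^ n * (/ 2) ^ n) <= Cmod (rint f (s n)))%coqR.
  elim: n => [|n IH]; first by rewrite s0 /rint /=; lra.
  have [_] := Hs n; rewrite -!tech_pow_Rmult; lra.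
apply: Cmod_eq_0; apply: Rle_antisym; last exact: Cmod_ge_0.
apply: Rnot_lt_le => T0.
set T := Cmod _ in T0 large.
set K := ((b - a) + (d - c))%coqR.
have [l Hl] : exists l, cdiff f (x, y) l.
  by apply: Hd; have := Hx 0%N; have := Hy 0%N; rewrite s0.
have K0 : (0 <= K)%coqR by rewrite /K; lra.
have Q0 : (0 < 2 * K * K + 1)%coqR by nra.
(* The estimate will give [T <= 2 eps K^2]; the [+ 1] makes this strictly smaller than [T], also
   when [K = 0]. *)
set eps := (T / (2 * K * K + 1))%coqR.
have e0 : (0 < eps)%coqR by apply: Rdiv_lt_0_compat.
have [del [del0 Hdel]] := Hl eps e0.
have [n Hn] := half_pow_small K del0.
pose g w := f w - (f (x, y) - l * (x, y) + l * w).
(* The first-order expansion of [f] at the limit point. It has a polynomial primitive, so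
   subtracting it does not change the integral. *)
pose A w := (f (x, y) - l * (x, y)) + l * w.
have HA : ccont A.
  move=> w; apply: cdiff_continuous; apply: cdiff_plus; first exact: cdiff_const.
  apply: cdiff_mult; [exact: cdiff_const|exact: cdiff_id].
have A0 : rint A (s n) = 0.
  apply: (@rect_int_primitive (fun w => (f (x, y) - l * (x, y)) * w + l * RtoC (/ 2) * (w * w))) => // w.
  rewrite /A; set k := _ - _.
  have -> : k + l * w = (0 * w + k * 1) + (0 * (w * w) + (l * RtoC (/ 2)) * (1 * w + w * 1)).
    transitivity (k + l * w * (RtoC (/ 2) + RtoC (/ 2))); last by ring.
    by rewrite -RtoC_plus (_ : (/ 2 + / 2 = 1)%coqR); [ring|field].
  apply: cdiff_plus; apply: cdiff_mult.
  - exact: cdiff_const.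
  - exact: cdiff_id.
  - exact: cdiff_const.
  - apply: cdiff_mult; exact: cdiff_id.
have Eg : rint f (s n) = rint (fun w => f w - A w) (s n).
  by rewrite /rint (rect_int_minus _ _ _ _ Hf HA) -/(rint A (s n)) A0; ring.
have Hg : ccont (fun w => f w - A w).
  move=> w; apply: (@continuous_minus _ R_AbsRing C_R_NormedModule); [exact: Hf|exact: HA].
have [sx sy] := size n.
have B : (Cmod (rint f (s n)) <= 2 * (K * (/ 2) ^ n) * (eps * (K * (/ 2) ^ n)))%coqR.
  rewrite Eg.
  have -> : (2 * (K * (/ 2) ^ n) = 2 * ((rr (s n) - rl (s n)) + (rt (s n) - rb (s n))))%coqR.
    by rewrite sx sy /K; ring.
  apply: rect_int_le => // u v Hu Hv.
  have Hw : (Cmod ((u, v) - (x, y)) <= K * (/ 2) ^ n)%coqR.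
    have := Cmod_triangle (RtoC (u - x)) (Ci * RtoC (v - y)).
    have -> : RtoC (u - x) + Ci * RtoC (v - y) = (u, v) - (x, y).
      by apply: injective_projections => /=; ring.
    rewrite Cmod_mult !Cmod_R.
    have -> : Cmod Ci = 1%coqR by rewrite /Cmod /= -[RHS]sqrt_1; congr sqrt; ring.
    have := Hx n; have := Hy n.
    have : (Rabs (u - x) <= rr (s n) - rl (s n))%coqR.
      by apply: Rabs_le; have := Hx n; lra.
    have : (Rabs (v - y) <= rt (s n) - rb (s n))%coqR.
      by apply: Rabs_le; have := Hy n; lra.
    by rewrite sx sy /K; lra.
  have := Hdel (u, v) (Rle_lt_trans _ _ _ Hw Hn).
  have -> : f (u, v) - f (x, y) - l * ((u, v) - (x, y)) = f (u, v) - A (u, v).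
    by rewrite /A; ring.
  have := Rmult_le_compat_l _ _ _ (Rlt_le _ _ e0) Hw; lra.
have := large n; have := p0 n.
set h := ((/ 2) ^ n)%coqR in B * => h0 LL.
have : (T * (h * h) <= (2 * eps * K * K) * (h * h))%coqR by lra.
move/Rmult_le_reg_r => /(_ _) HH.
have {HH} : (T <= 2 * eps * K * K)%coqR by apply: HH; nra.
have -> : (2 * eps * K * K = T - T / (2 * K * K + 1))%coqR by rewrite /eps; field; lra.
rewrite -/eps; lra.
Qed.

(** * Primitives of entire functions *)

Lemma Cmod_le_coord (u v : C) : (Rabs u.1 <= Rabs v.1)%coqR -> (Rabs u.2 <= Rabs v.2)%coqR ->
  Cmod u <= Cmod v.
Proof.
move=> H1 H2; apply: sqrt_le_1_alt.
by have := Rsqr_le_abs_1 _ _ H1; have := Rsqr_le_abs_1 _ _ H2; rewrite /Rsqr /=; lra.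
Qed.

Lemma Cmod_le_sum (u : C) : Cmod u <= (Rabs u.1 + Rabs u.2)%coqR.
Proof.
have := Cmod_triangle (RtoC u.1) (Ci * RtoC u.2).
have -> : RtoC u.1 + Ci * RtoC u.2 = u by apply: injective_projections => /=; ring.
have -> : Ci * RtoC u.2 = (0, u.2)%coqR by apply: injective_projections => /=; ring.
rewrite Cmod_R => H; apply: (Rle_trans _ _ _ H); apply: Rplus_le_compat_l.
rewrite /Cmod /= -(sqrt_Rsqr_abs u.2) /Rsqr; apply: Req_le; congr sqrt; ring.
Qed.

(** A rectangle with a degenerate side has integral zero, so splitting at the opposite bound shows
    that exchanging two bounds changes the sign; this reduces to ordered bounds. Arbitrary order
    matters because the primitive compares arbitrary points. *)
Lemma entire_rect_int f a b c d : entire f -> rect_int f a b c d = 0.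
Proof.
move=> Hf; have cf := entire_ccont Hf.
have pt (u : R -> C) x : CInt u x x = RtoC 0 by apply: (@RInt_point C_R_CompleteNormedModule).
have HG x y x' y' : (x <= x')%coqR -> (y <= y')%coqR -> rect_int f x x' y y' = 0.
  by move=> *; apply: goursat => // ? ? _ _; apply: entire_cdiff.
have Hx x x' y y' : (y <= y')%coqR -> rect_int f x x' y y' = 0.
  move=> yy; case: (Rle_lt_dec x x') => xx; first exact: HG.
  have := @rect_int_splitx f x x' x y y' cf; rewrite (HG x' y x y') //; last lra.
  rewrite {1}/rect_int /hseg !pt => E.
  rewrite -[LHS](_ : rect_int f x x' y y' + 0 = _); last by ring.
  by rewrite -E; ring.
case: (Rle_lt_dec c d) => cd; first exact: Hx.
have := @rect_int_splity f a b c d c cf; rewrite (Hx a b d c); last lra.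
rewrite {1}/rect_int /vseg !pt => E.
rewrite -[LHS](_ : rect_int f a b c d + 0 = _); last by ring.
by rewrite -E; ring.
Qed.

Lemma entire_primitive f : entire f -> exists F, forall z, cdiff F z (f z).
Proof.
move=> Hf; have cf := entire_ccont Hf.
pose F (z : C) := hseg f 0%coqR z.1 0%coqR + Ci * vseg f z.1 0%coqR z.2.
(* Goursat's theorem lifts the horizontal part of the path from height [0] to height [z.2], so the
   increment involves only values of [f] near [z]. *)
have HF w z : F w - F z = hseg f z.1 w.1 z.2 + Ci * vseg f w.1 z.2 w.2.
  have Ex : hseg f 0%coqR w.1 0%coqR = hseg f 0%coqR z.1 0%coqR + hseg f z.1 w.1 0%coqR.
    exact: (@CInt_Chasles _ _ _ _ (@rcont_h f 0%coqR cf)).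
  have Ey : vseg f w.1 0%coqR w.2 = vseg f w.1 0%coqR z.2 + vseg f w.1 z.2 w.2.
    exact: (@CInt_Chasles _ _ _ _ (@rcont_v f w.1 cf)).
  have := @entire_rect_int f z.1 w.1 0%coqR z.2 Hf; rewrite /rect_int /F Ex Ey.
  by move=> E; rewrite -[RHS]Cplus_0_r -E; ring.
exists F => z e e0.
have e2 : (0 < e / 2)%coqR by lra.
have [d [d0 Hd]] := proj1 (continuous_Cmod_eps f z) (cf z) (e / 2)%coqR e2.
exists d; split=> [|w Hw]; first exact: d0.
rewrite HF.
have fh : forall t, rcont (fun x : R => f (x, z.2)) t := @rcont_h f z.2 cf.
have fv : forall t, rcont (fun y : R => f (w.1, y)) t := @rcont_v f w.1 cf.
have cc : forall t, rcont (fun _ : R => f z) t.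
  by move=> t; exact: (@continuous_const R_UniformSpace C_UniformSpace).
have hx : Cmod (hseg f z.1 w.1 z.2 - RtoC (w.1 - z.1) * f z) <= (Rabs (w.1 - z.1) * (e / 2))%coqR.
  rewrite /hseg -CInt_const -(CInt_minus _ _ fh cc).
  apply: CInt_le_const => [t|x Hx].
    by apply: (@continuous_minus _ R_AbsRing C_R_NormedModule).
  apply: Rlt_le; apply: Hd; apply: Rle_lt_trans Hw; apply: Cmod_le_coord => /=.
    by move: Hx; rewrite /Rmin /Rmax /Rabs; do !case: Rle_dec; do !case: Rcase_abs; lra.
  rewrite Rplus_opp_r Rabs_R0; exact: Rabs_pos.
have hy : Cmod (vseg f w.1 z.2 w.2 - RtoC (w.2 - z.2) * f z) <= (Rabs (w.2 - z.2) * (e / 2))%coqR.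
  rewrite /vseg -CInt_const -(CInt_minus _ _ fv cc).
  apply: CInt_le_const => [t|x Hx].
    by apply: (@continuous_minus _ R_AbsRing C_R_NormedModule).
  apply: Rlt_le; apply: Hd; apply: Rle_lt_trans Hw; apply: Cmod_le_coord => /=.
    exact: Rle_refl.
  by move: Hx; rewrite /Rmin /Rmax /Rabs; do !case: Rle_dec; do !case: Rcase_abs; lra.
have -> : hseg f z.1 w.1 z.2 + Ci * vseg f w.1 z.2 w.2 - f z * (w - z) =
  (hseg f z.1 w.1 z.2 - RtoC (w.1 - z.1) * f z) + Ci * (vseg f w.1 z.2 w.2 - RtoC (w.2 - z.2) * f z).
  have -> : w - z = RtoC (w.1 - z.1) + Ci * RtoC (w.2 - z.2).
    by apply: injective_projections => /=; ring.
  by ring.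
apply: (Rle_trans _ _ _ (Cmod_triangle _ _)); rewrite Cmod_mult.
have -> : Cmod Ci = 1%coqR by rewrite /Cmod /= -[RHS]sqrt_1; congr sqrt; ring.
have := Rle_trans _ _ _ (Rmax_l _ _) (Rmax_Cmod (w - z)).
have := Rle_trans _ _ _ (Rmax_r _ _) (Rmax_Cmod (w - z)).
rewrite /= => h2 h1.
have : (Rabs (w.1 - z.1) * (e / 2) <= Cmod (w - z) * (e / 2))%coqR by apply: Rmult_le_compat_r => //; lra.
have : (Rabs (w.2 - z.2) * (e / 2) <= Cmod (w - z) * (e / 2))%coqR by apply: Rmult_le_compat_r => //; lra.
lra.
Qed.

Lemma cdiff_ext_loc f g z l d : (0 < d)%coqR ->
  (forall w, Cmod (w - z) < d -> f w = g w) -> cdiff f z l -> cdiff g z l.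
Proof.
move=> d0 E H e e0; have [d' [d'0 Hd]] := H e e0.
exists (Rmin d d'); split; first exact: Rmin_pos.
move=> w Hw; rewrite -!E.
- by apply: Hd; apply: Rlt_le_trans Hw (Rmin_r _ _).
- by have -> : z - z = 0 by [ring]; rewrite Cmod_0.
- by apply: Rlt_le_trans Hw (Rmin_l _ _).
Qed.

(** * Difference quotients and their integrals around a square *)

Lemma cdiff_inv (z : C) : z <> 0 -> cdiff Cinv z (- / (z * z)).
Proof.
move=> z0; have mz := proj1 (Cmod_gt_0 z) z0; move=> e e0.
set m := Cmod z in mz.
have m3 : (0 < m * m * m)%coqR by do 2!apply: Rmult_lt_0_compat => //.
(* The error is [(w - z)^2 / (w z^2)]. The first radius keeps [|w| > m / 2], and the second then
   makes [|w - z|] at most [e |w| m^2]. *)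
exists (Rmin (m / 2) (e * (m * m * m) / 2))%coqR; split; first by apply: Rmin_pos; nra.
move=> w Hw.
have H1 := Rlt_le_trans _ _ _ Hw (Rmin_l _ _).
have H2 := Rlt_le_trans _ _ _ Hw (Rmin_r _ _).
have mw : (m / 2 < Cmod w)%coqR.
  have := Cmod_triangle w (- (w - z)); have -> : w + - (w - z) = z by ring.
  by rewrite Cmod_opp -/m; lra.
have w0 : w <> 0 by apply/Cmod_gt_0; lra.
have -> : / w - / z - - / (z * z) * (w - z) = (w - z) * (w - z) / (w * (z * z)).
  by field; split.
rewrite Cmod_div; last by do 2!apply: Cmult_neq_0 => //.
rewrite !Cmod_mult -/m.
apply/Rle_div_l; first by nra.
have h0 := Cmod_ge_0 (w - z).
set h := Cmod (w - z) in h0 H1 H2 *.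
have : (e * (m * m * m) / 2 <= e * (Cmod w * (m * m)))%coqR.
  by have : (m * (m * m) / 2 <= Cmod w * (m * m))%coqR; nra.
move=> H3; rewrite -[X in (_ <= X)%coqR](_ : h * (e * (Cmod w * (m * m))) = _)%coqR; last by ring.
by apply: Rmult_le_compat_l => //; lra.
Qed.

Definition diff_quot (f : C -> C) (z l : C) (w : C) : C :=
  if excluded_middle_informative (w = z) then l else (f w - f z) / (w - z).

Lemma Csub_neq0 (w z : C) : w <> z -> w - z <> 0.
Proof. by move=> wz H; apply: wz; rewrite -[RHS]Cplus_0_r -H; ring. Qed.

Lemma diff_quot_cdiff f z l w : entire f -> w <> z -> exists k, cdiff (diff_quot f z l) w k.
Proof.
move=> Hf wz; have wz0 := Csub_neq0 wz.
have [a Ha] := entire_cdiff Hf w.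
have H : cdiff (fun v => (f v + - f z) * / (v + - z)) w
   ((a + 0) * / (w + - z) + (f w + - f z) * (- / ((w + - z) * (w + - z)) * (1 + 0))).
  apply: cdiff_mult; first by apply: cdiff_plus => //; exact: cdiff_const.
  apply: (@cdiff_comp Cinv (fun v => v + - z)); first exact: cdiff_inv.
  by apply: cdiff_plus; [exact: cdiff_id|exact: cdiff_const].
eexists; apply: cdiff_ext_loc H; first exact: (proj1 (Cmod_gt_0 _) wz0).
move=> v Hv; rewrite /diff_quot; case: excluded_middle_informative => // vz; exfalso.
move: Hv; rewrite vz -Cmod_opp; have -> : - (z - w) = w - z by ring.
exact: Rlt_irrefl.
Qed.

Lemma diff_quot_ccont f z l : entire f -> cdiff f z l -> ccont (diff_quot f z l).
Proof.
move=> Hf Hl w; case: (excluded_middle_informative (w = z)) => [->|wz]; last first.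
  by have [k Hk] := diff_quot_cdiff l Hf wz; apply: cdiff_continuous Hk.
apply/continuous_Cmod_eps => e e0.
have [|d [d0 Hd]] := Hl (e / 2)%coqR; first lra.
have Qz : diff_quot f z l z = l by rewrite /diff_quot; case: excluded_middle_informative.
exists d; split=> // v Hv; rewrite Qz /diff_quot.
case: excluded_middle_informative => [?|vz].
  by have -> : l - l = 0 by [ring]; rewrite Cmod_0.
have vz0 := Csub_neq0 vz; have m0 := proj1 (Cmod_gt_0 _) vz0.
have -> : (f v - f z) / (v - z) - l = (f v - f z - l * (v - z)) / (v - z) by field.
rewrite Cmod_div //; apply/Rlt_div_l => //.
by have := Hd v Hv; nra.
Qed.

(** Cutting off four rectangles that avoid [z], where Goursat's theorem applies, leaves a square of
    half-side [e]; its perimeter [8 e] tends to [0] while the quotient stays bounded near [z]. *)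
Lemma diff_quot_rect_int f z l s : entire f -> cdiff f z l -> (0 < s)%coqR ->
  rect_int (diff_quot f z l) (z.1 - s) (z.1 + s) (z.2 - s) (z.2 + s) = 0.
Proof.
move=> Hf Hl s0; have cQ := diff_quot_ccont Hf Hl.
set Q := diff_quot f z l in cQ *.
have [d [d0 Hd]] := proj1 (continuous_Cmod_eps Q z) (cQ z) 1%coqR Rlt_0_1.
have away a b c c' : (a <= b)%coqR -> (c <= c')%coqR ->
    (b < z.1 \/ z.1 < a \/ c' < z.2 \/ z.2 < c)%coqR -> rect_int Q a b c c' = 0.
  move=> ab cc H; apply: goursat => // x y Hx Hy; apply: diff_quot_cdiff => // E.
  by move: H; rewrite -E /=; lra.
have small e : (0 < e)%coqR -> (e < s)%coqR -> (2 * e < d)%coqR ->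
    Cmod (rect_int Q (z.1 - s) (z.1 + s) (z.2 - s) (z.2 + s)) <= (8 * (Cmod (Q z) + 1) * e)%coqR.
  move=> e0 es ed.
  rewrite (@rect_int_splitx Q _ (z.1 - e)%coqR) // away; try lra.
  rewrite (@rect_int_splitx Q _ (z.1 + e)%coqR) // (away (z.1 + e)%coqR); try lra.
  rewrite (@rect_int_splity Q _ _ _ (z.2 - e)%coqR) // (away _ _ (z.2 - s)%coqR); try lra.
  rewrite (@rect_int_splity Q _ _ _ (z.2 + e)%coqR) // (away _ _ (z.2 + e)%coqR); try lra.
  rewrite !Cplus_0_l !Cplus_0_r.
  apply: (Rle_trans _ _ _ (@rect_int_le Q _ _ _ _ (Cmod (Q z) + 1)%coqR cQ _ _ _)); try lra.
  move=> x y Hx Hy.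
  have : Cmod (Q (x, y) - Q z) < 1%coqR.
    apply: Hd; apply: Rle_lt_trans (Cmod_le_sum _) _ => /=.
    have : (Rabs (x + - z.1) <= e)%coqR by apply: Rabs_le; lra.
    have : (Rabs (y + - z.2) <= e)%coqR by apply: Rabs_le; lra.
    by lra.
  have := Cmod_triangle (Q (x, y) - Q z) (Q z).
  have -> : Q (x, y) - Q z + Q z = Q (x, y) by ring.
  by lra.
apply: Cmod_eq_0; apply: Rle_antisym; last exact: Cmod_ge_0.
apply: Rnot_lt_le; set T := Cmod _ in small * => T0.
have M0 : (0 < 8 * (Cmod (Q z) + 1))%coqR by have := Cmod_ge_0 (Q z); lra.
set M := (8 * (Cmod (Q z) + 1))%coqR in M0 small.
have r0 : (0 < T / (2 * M))%coqR by apply: Rdiv_lt_0_compat; lra.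
(* [s / 2] keeps the small square inside the large one, [d / 4] makes the sum [2 e] of the
   coordinate deviations smaller than [d], and [T / (2 * M)] turns [T <= M e] into [T <= T / 2]. *)
set e := Rmin (Rmin (s / 2) (d / 4)) (T / (2 * M))%coqR.
have h1 : (e <= Rmin (s / 2) (d / 4))%coqR by apply: Rmin_l.
have h2 : (e <= T / (2 * M))%coqR by apply: Rmin_r.
have h3 := Rle_trans _ _ _ h1 (Rmin_l _ _).
have h4 := Rle_trans _ _ _ h1 (Rmin_r _ _).
have e0 : (0 < e)%coqR by do !apply: Rmin_pos => //; lra.
have [] := (small e e0 _ _); try lra.
- have := Rmult_le_compat_l _ _ _ (Rlt_le _ _ M0) h2.
  have -> : (M * (T / (2 * M)) = T / 2)%coqR by field; lra.
  by lra.
- have := Rmult_le_compat_l _ _ _ (Rlt_le _ _ M0) h2.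
  have -> : (M * (T / (2 * M)) = T / 2)%coqR by field; lra.
  by lra.
Qed.

(** * Cauchy's inequality on squares *)

Lemma ccontR_fst w : ccontR fst w.
Proof. by case: w => x y; exact: continuous_fst. Qed.

Lemma ccontR_snd w : ccontR snd w.
Proof. by case: w => x y; exact: continuous_snd. Qed.

Lemma ccontR_mult (u v : C -> R) w : ccontR u w -> ccontR v w ->
  ccontR (fun t => u t * v t)%coqR w.
Proof. exact: (@continuous_mult C_UniformSpace R_AbsRing). Qed.

Lemma ccontR_plus (u v : C -> R) w : ccontR u w -> ccontR v w ->
  ccontR (fun t => u t + v t)%coqR w.
Proof. exact: (@continuous_plus C_UniformSpace R_AbsRing R_NormedModule). Qed.

Lemma ccontR_minus (u v : C -> R) w : ccontR u w -> ccontR v w ->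
  ccontR (fun t => u t - v t)%coqR w.
Proof. exact: (@continuous_minus C_UniformSpace R_AbsRing R_NormedModule). Qed.

Lemma ccontR_const (c : R) w : ccontR (fun _ => c) w.
Proof. exact: (@continuous_const C_UniformSpace R_UniformSpace). Qed.

Lemma ccontR_comp (h : R -> R) (u : C -> R) w : ccontR u w ->
  @continuous R_UniformSpace R_UniformSpace h (u w) -> ccontR (fun t => h (u t)) w.
Proof. exact: (@continuous_comp C_UniformSpace R_UniformSpace R_UniformSpace). Qed.

Definition cmod2 (z w : C) : R := ((w.1 - z.1) * (w.1 - z.1) + (w.2 - z.2) * (w.2 - z.2))%coqR.

(* [(s^2 + n + |n - s^2|) / 2] is [max (s^2) n]. *)
Definition kernel_den (s : R) (z w : C) : R :=
  ((s * s + cmod2 z w + Rabs (cmod2 z w - s * s)) / 2)%coqR.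

(* [1 / (w - z)] outside the disc of radius [s] around [z], but continuous everywhere. *)
Definition ckernel (s : R) (z w : C) : C :=
  ((w.1 - z.1) * / kernel_den s z w, (z.2 - w.2) * / kernel_den s z w)%coqR.

Lemma kernel_den_gt0 s z w : (0 < s)%coqR -> (0 < kernel_den s z w)%coqR.
Proof.
move=> s0; have n0 : (0 <= cmod2 z w)%coqR by apply: Rplus_le_le_0_compat; exact: Rle_0_sqr.
by rewrite /kernel_den; have := Rabs_pos (cmod2 z w - s * s); nra.
Qed.

Lemma kernel_den_out s z w : (s * s <= cmod2 z w)%coqR -> kernel_den s z w = cmod2 z w.
Proof. by move=> H; rewrite /kernel_den Rabs_pos_eq; lra. Qed.

Lemma ckernel_ccont s z : (0 < s)%coqR -> ccont (ckernel s z).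
Proof.
move=> s0 w.
have H1 : ccontR (fun w => w.1 - z.1)%coqR w.
  by apply: ccontR_minus; [exact: ccontR_fst|exact: ccontR_const].
have H2 : ccontR (fun w => w.2 - z.2)%coqR w.
  by apply: ccontR_minus; [exact: ccontR_snd|exact: ccontR_const].
have H3 : ccontR (fun w => z.2 - w.2)%coqR w.
  by apply: ccontR_minus; [exact: ccontR_const|exact: ccontR_snd].
have Hn : ccontR (cmod2 z) w.
  by apply: ccontR_plus; apply: ccontR_mult.
have Hm : ccontR (kernel_den s z) w.
  apply: ccontR_mult; last exact: ccontR_const.
  apply: ccontR_plus; first by apply: ccontR_plus => //; exact: ccontR_const.
  apply: ccontR_comp; last exact: continuous_Rabs.
  by apply: ccontR_minus => //; exact: ccontR_const.
have Hi : ccontR (fun w => / kernel_den s z w)%coqR w.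
  apply: ccontR_comp => //; apply: continuous_Rinv.
  by have := kernel_den_gt0 z w s0; lra.
by apply: continuous_pair; apply: ccontR_mult.
Qed.

Lemma ckernel_out s z w : (0 < s)%coqR -> (s * s <= cmod2 z w)%coqR ->
  ckernel s z w * (w - z) = 1.
Proof.
move=> s0 H; have n0 : (cmod2 z w <> 0)%coqR by nra.
apply: injective_projections => /=; rewrite (kernel_den_out H) /cmod2 in n0 *; by field.
Qed.

Lemma Cmod_ckernel_out s z w : (0 < s)%coqR -> (s * s <= cmod2 z w)%coqR ->
  Cmod (ckernel s z w) <= / s.
Proof.
move=> s0 H; have := f_equal Cmod (ckernel_out s0 H); rewrite Cmod_mult Cmod_1 => E.
have : (s <= Cmod (w - z))%coqR.
  rewrite -(sqrt_square s); last lra.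
  by apply: sqrt_le_1_alt; rewrite /cmod2 in H *; rewrite /=; lra.
move=> H1; apply: (Rmult_le_reg_r s) => //; rewrite Rinv_l; last lra.
by have := Cmod_ge_0 (ckernel s z w); nra.
Qed.

Lemma RInt_ge_const (v : R -> R) a b m : (a <= b)%coqR -> ex_RInt v a b ->
  (forall x, (a <= x <= b)%coqR -> (m <= v x)%coqR) -> ((b - a) * m <= RInt v a b)%coqR.
Proof.
move=> ab Hv H; rewrite -(@RInt_const R_CompleteNormedModule a b m : _ = ((b - a) * m)%coqR).
apply: RInt_le => //; first exact: ex_RInt_const.
by move=> x Hx; apply: H; lra.
Qed.

Lemma CInt_proj (u : R -> C) a b : (forall t, rcont u t) ->
  [/\ ex_RInt (fun t => (u t).1) a b, (CInt u a b).1 = RInt (fun t => (u t).1) a b,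
      ex_RInt (fun t => (u t).2) a b & (CInt u a b).2 = RInt (fun t => (u t).2) a b].
Proof.
move=> Hu; have H : is_CInt u a b (CInt u a b) := rcont_is_CInt Hu.
have H1 := @is_RInt_fct_extend_fst R_NormedModule R_NormedModule _ _ _ _ H.
have H2 := @is_RInt_fct_extend_snd R_NormedModule R_NormedModule _ _ _ _ H.
split.
- by eexists; exact: H1.
- by apply/esym; apply: (@is_RInt_unique R_CompleteNormedModule); exact: H1.
- by eexists; exact: H2.
- by apply/esym; apply: (@is_RInt_unique R_CompleteNormedModule); exact: H2.
Qed.

(** The exact value is [2 pi i], but a lower bound suffices: on each side the imaginary part of
    [dw / (w - z)] has density [s / |w - z|^2 >= 1 / (2 s)], and the side has length [2 s], so each
    of the four contributes at least [1]. *)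
Lemma rect_int_ckernel s z : (0 < s)%coqR ->
  4 <= Cmod (rect_int (ckernel s z) (z.1 - s) (z.1 + s) (z.2 - s) (z.2 + s)).
Proof.
move=> s0; set k := ckernel s z; have Hk : ccont k := ckernel_ccont s0.
set I := rect_int _ _ _ _ _.
apply: (Rle_trans _ (Rabs I.2)); last by apply: Rle_trans (Rmax_r _ _) (Rmax_Cmod _).
apply: Rle_trans (Rle_abs _).
have -> : I.2 = ((hseg k (z.1 - s) (z.1 + s) (z.2 - s)).2 + (vseg k (z.1 + s) (z.2 - s) (z.2 + s)).1
   - (hseg k (z.1 - s) (z.1 + s) (z.2 + s)).2 - (vseg k (z.1 - s) (z.2 - s) (z.2 + s)).1)%coqR.
  by rewrite /I /rect_int /=; ring.
have den w : (Rabs (w.1 - z.1) <= s)%coqR -> (Rabs (w.2 - z.2) <= s)%coqR ->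
    (/ (2 * (s * s)) <= / kernel_den s z w)%coqR.
  move=> h1 h2; apply: Rinv_le_contravar; first exact: kernel_den_gt0.
  have := Rsqr_le_abs_1 (w.1 - z.1) s; have := Rsqr_le_abs_1 (w.2 - z.2) s.
  rewrite (Rabs_pos_eq s); last lra.
  have := Rle_0_sqr s; move=> + /(_ h2) + /(_ h1); rewrite /kernel_den /cmod2 /Rsqr => g0 g1 g2.
  rewrite /Rabs; case: Rcase_abs => ?; lra.
have inv : (s * / (2 * (s * s)) = / (2 * s))%coqR by field; lra.
have area : ((z.1 + s - (z.1 - s)) * / (2 * s) = 1)%coqR by field; lra.
have area' : ((z.2 + s - (z.2 - s)) * / (2 * s) = 1)%coqR by field; lra.
have hb : (1 <= (hseg k (z.1 - s) (z.1 + s) (z.2 - s)).2)%coqR.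
  have [_ _ e ->] := @CInt_proj _ (z.1 - s)%coqR (z.1 + s)%coqR (@rcont_h k (z.2 - s)%coqR Hk).
  rewrite -area; apply: RInt_ge_const => //; first lra.
  move=> x Hx; rewrite /k /ckernel /= -inv.
  rewrite (_ : z.2 - (z.2 - s) = s)%coqR; last ring.
  apply: Rmult_le_compat_l; first lra.
  by apply: den => /=; apply: Rabs_le; lra.
have vr : (1 <= (vseg k (z.1 + s) (z.2 - s) (z.2 + s)).1)%coqR.
  have [e -> _ _] := @CInt_proj _ (z.2 - s)%coqR (z.2 + s)%coqR (@rcont_v k (z.1 + s)%coqR Hk).
  rewrite -area'; apply: RInt_ge_const => //; first lra.
  move=> x Hx; rewrite /k /ckernel /= -inv.
  rewrite (_ : z.1 + s - z.1 = s)%coqR; last ring.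
  apply: Rmult_le_compat_l; first lra.
  by apply: den => /=; apply: Rabs_le; lra.
have ht : (1 <= - (hseg k (z.1 - s) (z.1 + s) (z.2 + s)).2)%coqR.
  have [_ _ e ->] := @CInt_proj _ (z.1 - s)%coqR (z.1 + s)%coqR (@rcont_h k (z.2 + s)%coqR Hk).
  rewrite -(RInt_opp _ _ _ e : _ = (- _)%coqR) -area; apply: RInt_ge_const; first lra.
    exact: (@ex_RInt_opp R_NormedModule).
  move=> x Hx; rewrite /k /ckernel /= -inv /opp /=.
  rewrite (_ : z.2 - (z.2 + s) = - s)%coqR; last ring.
  rewrite -Ropp_mult_distr_l Ropp_involutive.
  apply: Rmult_le_compat_l; first lra.
  by apply: den => /=; apply: Rabs_le; lra.
have vl : (1 <= - (vseg k (z.1 - s) (z.2 - s) (z.2 + s)).1)%coqR.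
  have [e -> _ _] := @CInt_proj _ (z.2 - s)%coqR (z.2 + s)%coqR (@rcont_v k (z.1 - s)%coqR Hk).
  rewrite -(RInt_opp _ _ _ e : _ = (- _)%coqR) -area'; apply: RInt_ge_const; first lra.
    exact: (@ex_RInt_opp R_NormedModule).
  move=> x Hx; rewrite /k /ckernel /= -inv /opp /=.
  rewrite (_ : z.1 - s - z.1 = - s)%coqR; last ring.
  rewrite -Ropp_mult_distr_l Ropp_involutive.
  apply: Rmult_le_compat_l; first lra.
  by apply: den => /=; apply: Rabs_le; lra.
lra.
Qed.

Lemma ccont_mult f g : ccont f -> ccont g -> ccont (fun w => f w * g w).
Proof.
move=> Hf Hg w.
have F1 : ccontR (fun w => (f w).1) w.
  exact: (@continuous_comp C_UniformSpace C_UniformSpace R_UniformSpace f fst w (Hf w) (@ccontR_fst _)).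
have F2 : ccontR (fun w => (f w).2) w.
  exact: (@continuous_comp C_UniformSpace C_UniformSpace R_UniformSpace f snd w (Hf w) (@ccontR_snd _)).
have G1 : ccontR (fun w => (g w).1) w.
  exact: (@continuous_comp C_UniformSpace C_UniformSpace R_UniformSpace g fst w (Hg w) (@ccontR_fst _)).
have G2 : ccontR (fun w => (g w).2) w.
  exact: (@continuous_comp C_UniformSpace C_UniformSpace R_UniformSpace g snd w (Hg w) (@ccontR_snd _)).
apply: continuous_pair.
- by apply: ccontR_minus; apply: ccontR_mult.
- by apply: ccontR_plus; apply: ccontR_mult.
Qed.

Lemma ccont_const (c : C) : ccont (fun _ => c).
Proof. by move=> w; exact: (@continuous_const C_UniformSpace C_UniformSpace). Qed.

Lemma ccontR_Cmod f w : ccont f -> ccontR (fun w => Cmod (f w)) w.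
Proof.
move=> Hf; apply: (@continuous_comp C_UniformSpace C_UniformSpace R_UniformSpace f Cmod); first exact: Hf.
apply: (continuous_ext (fun x : C_R_NormedModule => norm x)) => [x|].
  by rewrite -Cmod_norm.
exact: (@filterlim_norm R_AbsRing C_R_NormedModule).
Qed.

(** Every point of the boundary of the square lies at distance at least [s] from its centre. *)
Lemma rect_int_ext f g z s : (0 < s)%coqR ->
  (forall w, (s * s <= cmod2 z w)%coqR -> f w = g w) ->
  rect_int f (z.1 - s) (z.1 + s) (z.2 - s) (z.2 + s)
  = rect_int g (z.1 - s) (z.1 + s) (z.2 - s) (z.2 + s).
Proof.
move=> s0 H; rewrite /rect_int /hseg /vseg.
congr (_ + Ci * _ - _ - Ci * _); apply: CInt_ext => t _; apply: H; rewrite /cmod2 /=;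
  have := Rle_0_sqr (t - z.1); have := Rle_0_sqr (t - z.2); rewrite /Rsqr; nra.
Qed.

(** Since the difference quotient integrates to zero, [f(w) / (w - z)] integrates to [f z] times the
    integral of the kernel, which has modulus at least [4]. The condition [1 <= s] bounds the kernel
    by [1] on the boundary; [s <= 2] lets all sides be widened to length [4], whatever [s], which
    prepares the average over [s]. *)
Lemma cauchy_square f z s : entire f -> (1 <= s <= 2)%coqR ->
  (4 * Cmod (f z) <=
     RInt (fun x => Cmod (f (x, z.2 - s)%coqR)) (z.1 - 2) (z.1 + 2)
   + RInt (fun x => Cmod (f (x, z.2 + s)%coqR)) (z.1 - 2) (z.1 + 2)
   + RInt (fun y => Cmod (f (z.1 - s, y)%coqR)) (z.2 - 2) (z.2 + 2)
   + RInt (fun y => Cmod (f (z.1 + s, y)%coqR)) (z.2 - 2) (z.2 + 2))%coqR.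
Proof.
move=> Hf Hs; have s0 : (0 < s)%coqR by lra.
have cf := entire_ccont Hf; have [l Hl] := entire_cdiff Hf z.
set k := ckernel s z; have Hk : ccont k := ckernel_ccont s0.
have Hkf := ccont_mult Hk cf; have Hkc := ccont_mult Hk (@ccont_const (f z)).
have := diff_quot_rect_int Hf Hl s0.
rewrite (@rect_int_ext _ (fun w => k w * f w - k w * f z)) //; last first.
  move=> w Hw; have E := ckernel_out s0 Hw; rewrite /diff_quot -/k in E *.
  case: excluded_middle_informative => [wz|wz].
    by exfalso; move: Hw; rewrite wz /cmod2; nra.
  have wz0 := Csub_neq0 wz.
  rewrite -[LHS]Cmult_1_l -E; field; exact: wz0.
rewrite rect_int_minus // => E0.
have Ekc : rect_int (fun w => k w * f z) (z.1 - s) (z.1 + s) (z.2 - s) (z.2 + s)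
   = f z * rect_int k (z.1 - s) (z.1 + s) (z.2 - s) (z.2 + s).
  have M (u : R -> C) a b : (forall t, rcont u t) -> CInt (fun t => u t * f z) a b = f z * CInt u a b.
    move=> Hu; apply: CInt_unique.
    apply: (@is_RInt_ext C_R_NormedModule (fun t => f z * u t)) => [t _|].
      exact: Cmult_comm.
    by apply: is_CInt_Cmult; apply: rcont_is_CInt.
  rewrite /rect_int /hseg /vseg.
  rewrite (M _ _ _ (@rcont_h k (z.2 - s)%coqR Hk)) (M _ _ _ (@rcont_h k (z.2 + s)%coqR Hk)).
  rewrite (M _ _ _ (@rcont_v k (z.1 - s)%coqR Hk)) (M _ _ _ (@rcont_v k (z.1 + s)%coqR Hk)).
  by ring.
rewrite Ekc in E0.
have L := rect_int_ckernel z s0; rewrite -/k in L.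
set J := rect_int k _ _ _ _ in L E0.
set K := rect_int (fun w => k w * f w) _ _ _ _ in E0.
have EK : K = f z * J by rewrite -[RHS]Cplus_0_l -E0; ring.
have : (4 * Cmod (f z) <= Cmod K)%coqR.
  by rewrite EK Cmod_mult; have := Cmod_ge_0 (f z); nra.
move=> LK; apply: (Rle_trans _ _ _ LK).
have T (x y u t : C) : Cmod (x + y - u - t) <= (Cmod x + Cmod u + Cmod t + Cmod y)%coqR.
  rewrite -(Cmod_opp u) -(Cmod_opp t).
  have := Cmod_triangle (x + y - u) (- t); have := Cmod_triangle (x + y) (- u).
  have := Cmod_triangle x y; rewrite /Cminus; lra.
apply: (Rle_trans _ _ _ (T _ _ _ _)).
have Ci1 : Cmod Ci = 1%coqR by rewrite /Cmod /= -[RHS]sqrt_1; congr sqrt; ring.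
have rex (u : R -> R) a b : (forall t, @continuous R_UniformSpace R_UniformSpace u t) -> ex_RInt u a b.
  by move=> H; apply: (@ex_RInt_continuous R_CompleteNormedModule) => t _; exact: H.
have rc (u : R -> C) t : rcont u t -> @continuous R_UniformSpace R_UniformSpace (fun s => Cmod (u s)) t.
  move=> H; apply: (@continuous_comp R_UniformSpace C_UniformSpace R_UniformSpace u Cmod) => //.
  exact: (@ccontR_Cmod (fun w => w) _ (fun w => @continuous_id C_UniformSpace w)).
have widen (u : R -> R) c : (forall t, @continuous R_UniformSpace R_UniformSpace u t) ->
    (forall t, 0 <= u t)%coqR -> (RInt u (c - s) (c + s) <= RInt u (c - 2) (c + 2))%coqR.
  move=> Hu u0.
  rewrite -(@RInt_Chasles R_CompleteNormedModule u (c - 2) (c - s) (c + 2)); try exact: rex.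
  rewrite -(@RInt_Chasles R_CompleteNormedModule u (c - s) (c + s) (c + 2)); try exact: rex.
  rewrite /plus /=.
  have := @RInt_ge_0 u (c - 2) (c - s); have := @RInt_ge_0 u (c + s) (c + 2) => h1 h2.
  have {h1} := h1 _ (rex _ _ _ Hu) (fun x _ => u0 x); have {h2} := h2 _ (rex _ _ _ Hu) (fun x _ => u0 x).
  lra.
have k1 w : (s * s <= cmod2 z w)%coqR -> Cmod (k w * f w) <= Cmod (f w).
  move=> Hw; have := Cmod_ckernel_out s0 Hw; rewrite -/k Cmod_mult => H.
  have : (/ s <= 1)%coqR by rewrite -Rinv_1; apply: Rinv_le_contravar; lra.
  by have := Cmod_ge_0 (f w); nra.
have side_h y : (s * s <= (y - z.2) * (y - z.2))%coqR ->
    Cmod (hseg (fun w => k w * f w) (z.1 - s) (z.1 + s) y)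
    <= RInt (fun x => Cmod (f (x, y))) (z.1 - 2) (z.1 + 2).
  move=> Hy.
  have cc t := @rc _ t (@rcont_h f y cf t).
  apply: Rle_trans (@widen _ z.1 cc (fun t => Cmod_ge_0 _)).
  apply: CInt_le; first exact: (@rcont_h (fun w => k w * f w) y Hkf).
  - lra.
  - exact: rex.
  - by move=> x Hx; apply: k1; have := Rle_0_sqr (x - z.1); rewrite /Rsqr /cmod2 /=; lra.
have side_v x : (s * s <= (x - z.1) * (x - z.1))%coqR ->
    Cmod (vseg (fun w => k w * f w) x (z.2 - s) (z.2 + s))
    <= RInt (fun y => Cmod (f (x, y))) (z.2 - 2) (z.2 + 2).
  move=> Hx.
  have cc t := @rc _ t (@rcont_v f x cf t).
  apply: Rle_trans (@widen _ z.2 cc (fun t => Cmod_ge_0 _)).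
  apply: CInt_le; first exact: (@rcont_v (fun w => k w * f w) x Hkf).
  - lra.
  - exact: rex.
  - by move=> y Hy; apply: k1; have := Rle_0_sqr (y - z.2); rewrite /Rsqr /cmod2 /=; lra.
rewrite !Cmod_mult Ci1 !Rmult_1_l.
have := side_h (z.2 - s)%coqR; have := side_h (z.2 + s)%coqR.
have := side_v (z.1 - s)%coqR; have := side_v (z.1 + s)%coqR => h1 h2 h3 h4.
have := h1 _; have := h2 _; have := h3 _; have := h4 _ => {}h1 {}h2 {}h3 {}h4.
by apply: Rplus_le_compat; [apply: Rplus_le_compat; [apply: Rplus_le_compat|]|]; [apply: h1|apply: h2|apply: h3|apply: h4]; nra.
Qed.

(** * The complex exponential and the Gaussian weight *)

Definition cexp (z : C) : C := (exp z.1 * cos z.2, exp z.1 * sin z.2)%coqR.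

Lemma cexp_plus z w : cexp (z + w) = cexp z * cexp w.
Proof.
case: z w => [x y] [x' y']; apply: injective_projections; rewrite /= exp_plus ?cos_plus ?sin_plus; ring.
Qed.

Lemma Cmod_cexp z : Cmod (cexp z) = exp z.1.
Proof.
rewrite /Cmod /cexp /= -[RHS](sqrt_Rsqr (exp z.1)); last exact/Rlt_le/exp_pos.
congr sqrt; have := sin2_cos2 z.2; rewrite /Rsqr => H.
transitivity (exp z.1 * exp z.1 * (sin z.2 * sin z.2 + cos z.2 * cos z.2))%coqR; first by ring.
by rewrite H; ring.
Qed.

Lemma is_derive_eps (u : R -> R) x l : Derive.is_derive u x l ->
  forall e, (0 < e)%coqR -> exists d : R, (0 < d)%coqR /\
    forall h, (Rabs h < d)%coqR -> (Rabs (u (x + h) - u x - l * h) <= e * Rabs h)%coqR.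
Proof.
move=> [_ H] e e0; have [d Hd] := H x (fun P H => H) (mkposreal e e0).
exists d; split=> [|h Hh]; first exact: cond_pos.
have := Hd (x + h)%coqR; rewrite /minus /plus /opp /norm /abs /scal /= /mult /= /ball /= /AbsRing_ball /abs /minus /plus /opp /=.
rewrite (_ : x + h + - x = h)%coqR; last ring.
rewrite (_ : u (x + h) + - u x + - (h * l) = u (x + h) - u x - l * h)%coqR; last ring.
by apply.
Qed.

Lemma cexp_cdiff z : cdiff cexp z (cexp z).
Proof.
suff H0 : cdiff cexp 0 1.
  have H1 : cdiff (fun w => w + - z) z (1 + 0).
    by apply: cdiff_plus; [exact: cdiff_id|exact: cdiff_const].
  have H2 : cdiff (fun w => cexp (w + - z)) z (1 * (1 + 0)).
    by apply: (@cdiff_comp cexp (fun w => w + - z)) => //; rewrite Cplus_opp_r.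
  have H3 := cdiff_mult (@cdiff_const (cexp z) z) H2.
  rewrite (_ : cexp z = 0 * cexp (z + - z) + cexp z * (1 * (1 + 0))); last by ring.
  apply: cdiff_ext H3 => w /=; rewrite -cexp_plus; congr cexp; ring.
move=> e e0.
(* For [|w| <= 1] one has [exp w.1 <= 3]. The real part of the error is then at most
   [(3 + 1) e / 16] times [|w|], and the imaginary part at most [(3 + 1) e / 16 + e / 12] times
   [|w|], the last term coming from [w.1 w.2]; both are below [e / 2]. *)
have e8 : (0 < e / 16)%coqR by lra.
have DE : Derive.is_derive exp 0 1 by auto_derive => //; rewrite exp_0; ring.
have DC : Derive.is_derive cos 0 0 by auto_derive => //; rewrite sin_0; ring.
have DS : Derive.is_derive sin 0 1 by auto_derive => //; rewrite cos_0; ring.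
have [d1 [d10 H1]] := is_derive_eps DE e8.
have [d2 [d20 H2]] := is_derive_eps DC e8.
have [d3 [d30 H3]] := is_derive_eps DS e8.
exists (Rmin (Rmin d1 d2) (Rmin d3 (Rmin 1 (e / 12)))); split.
  by do !apply: Rmin_pos => //; lra.
move=> w; have -> : w - 0 = w by ring.
move=> Hw.
have g1 := Rlt_le_trans _ _ _ Hw (Rmin_l _ _); have g2 := Rlt_le_trans _ _ _ Hw (Rmin_r _ _).
have k1 := Rlt_le_trans _ _ _ g1 (Rmin_l _ _); have k2 := Rlt_le_trans _ _ _ g1 (Rmin_r _ _).
have k3 := Rlt_le_trans _ _ _ g2 (Rmin_l _ _); have g3 := Rlt_le_trans _ _ _ g2 (Rmin_r _ _).
have k4 := Rlt_le_trans _ _ _ g3 (Rmin_l _ _); have k5 := Rlt_le_trans _ _ _ g3 (Rmin_r _ _).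
have m1 := Rle_trans _ _ _ (Rmax_l _ _) (Rmax_Cmod w).
have m2 := Rle_trans _ _ _ (Rmax_r _ _) (Rmax_Cmod w).
have {}H1 := H1 w.1 (Rle_lt_trans _ _ _ m1 k1).
have {}H2 := H2 w.2 (Rle_lt_trans _ _ _ m2 k2).
have {}H3 := H3 w.2 (Rle_lt_trans _ _ _ m2 k3).
move: H1 H2 H3; rewrite !Rplus_0_l exp_0 cos_0 sin_0 !Rmult_1_l Rmult_0_l !Rminus_0_r => H1 H2 H3.
have E3 : (exp w.1 <= 3)%coqR.
  apply: Rle_trans exp_le_3; have : (w.1 <= 1)%coqR by have := Rle_abs w.1; lra.
  by case=> [/exp_increasing/Rlt_le //|->]; exact: Rle_refl.
have Ep := exp_pos w.1.
have x0 := Rabs_pos w.1; have y0 := Rabs_pos w.2; have m0 := Cmod_ge_0 w.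
have B1 : (Rabs (exp w.1 * cos w.2 - 1 - w.1) <= e / 2 * Cmod w)%coqR.
  have -> : (exp w.1 * cos w.2 - 1 - w.1 = exp w.1 * (cos w.2 - 1) + (exp w.1 - 1 - w.1))%coqR by ring.
  apply: (Rle_trans _ _ _ (Rabs_triang _ _)); rewrite Rabs_mult (Rabs_pos_eq (exp _)); last lra.
  have : (exp w.1 * Rabs (cos w.2 - 1) <= 3 * (e / 16 * Cmod w))%coqR.
    by apply: Rmult_le_compat => //; [lra|exact: Rabs_pos|nra].
  by nra.
have B2 : (Rabs (exp w.1 * sin w.2 - w.2) <= e / 2 * Cmod w)%coqR.
  have -> : (exp w.1 * sin w.2 - w.2 = exp w.1 * (sin w.2 - w.2) + (exp w.1 - 1 - w.1) * w.2 + w.1 * w.2)%coqR by ring.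
  apply: (Rle_trans _ _ _ (Rabs_triang _ _)).
  apply: (Rle_trans _ (Rabs (exp w.1 * (sin w.2 - w.2)) + Rabs ((exp w.1 - 1 - w.1) * w.2) + Rabs (w.1 * w.2)))%coqR.
    by apply: Rplus_le_compat_r; exact: Rabs_triang.
  rewrite !Rabs_mult (Rabs_pos_eq (exp _)); last lra.
  have : (exp w.1 * Rabs (sin w.2 - w.2) <= 3 * (e / 16 * Cmod w))%coqR.
    by apply: Rmult_le_compat => //; [lra|exact: Rabs_pos|nra].
  have : (Rabs (exp w.1 - 1 - w.1) * Rabs w.2 <= (e / 16 * Cmod w) * 1)%coqR.
    by apply: Rmult_le_compat => //; [exact: Rabs_pos|nra|lra].
  have : (Rabs w.1 * Rabs w.2 <= Cmod w * (e / 12))%coqR.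
    by apply: Rmult_le_compat => //; lra.
  nra.
apply: (Rle_trans _ _ _ (Cmod_le_sum _)).
have -> : (cexp w - cexp 0 - 1 * w).1 = (exp w.1 * cos w.2 - 1 - w.1)%coqR.
  by rewrite /= exp_0 cos_0; ring.
have -> : (cexp w - cexp 0 - 1 * w).2 = (exp w.1 * sin w.2 - w.2)%coqR.
  by rewrite /= exp_0 sin_0; ring.
lra.
Qed.

(** The function [phi] of the overview: its supremum is the norm of [F_oo], and its [p]-th power is
    the integrand in the norm of [F_p]. *)
Definition gmod (f : C -> C) (w : C) : R := (Cmod (f w) * exp (- (Cmod w) ^ 2 / 2))%coqR.

Lemma Cmod_sqr (w : C) : ((Cmod w) ^ 2 = w.1 * w.1 + w.2 * w.2)%coqR.
Proof.
rewrite /Cmod pow2_sqrt; first by ring.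
by have := pow2_ge_0 w.1; have := pow2_ge_0 w.2; lra.
Qed.

Lemma gmod_ge0 f w : (0 <= gmod f w)%coqR.
Proof. by apply: Rmult_le_pos; [exact: Cmod_ge_0|exact/Rlt_le/exp_pos]. Qed.

Lemma exp_ccontR (u : C -> R) w : ccontR u w -> ccontR (fun w => exp (u w)) w.
Proof.
move=> Hu; apply: ccontR_comp => //.
apply: (@ex_derive_continuous R_AbsRing R_NormedModule); auto_derive => //.
Qed.

Lemma gmod_ccontR f w : ccont f -> ccontR (gmod f) w.
Proof.
move=> Hf; apply: ccontR_mult; first exact: ccontR_Cmod.
apply: exp_ccontR.
apply: (continuous_ext (fun w : C_UniformSpace => - (w.1 * w.1 + w.2 * w.2) * / 2)%coqR) => [x|].
  by rewrite Cmod_sqr.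
apply: ccontR_mult; last exact: ccontR_const.
apply: (@continuous_opp C_UniformSpace R_AbsRing R_NormedModule).
by apply: ccontR_plus; apply: ccontR_mult; (exact: ccontR_fst || exact: ccontR_snd).
Qed.

(** The factor [exp 4] bounds [exp (|w - z|^2 / 2)], as [|w - z|^2 <= 2^2 + 2^2] on the widened
    sides. *)
Lemma gmod_cauchy f z s : entire f -> (1 <= s <= 2)%coqR ->
  (4 * gmod f z <= exp 4 *
   ( RInt (fun x => gmod f (x, z.2 - s)%coqR) (z.1 - 2) (z.1 + 2)
   + RInt (fun x => gmod f (x, z.2 + s)%coqR) (z.1 - 2) (z.1 + 2)
   + RInt (fun y => gmod f (z.1 - s, y)%coqR) (z.2 - 2) (z.2 + 2)
   + RInt (fun y => gmod f (z.1 + s, y)%coqR) (z.2 - 2) (z.2 + 2)))%coqR.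
Proof.
move=> Hf Hs.
(* [|w|^2 = |z|^2 + 2 Re (conj z (w - z)) + |w - z|^2]: this factor turns [|f|] into [gmod f]. *)
pose E (w : C) := cexp ((- z.1, z.2)%coqR * (w + - z)).
have HE : entire E.
  move=> w; eexists; apply/is_derive_cdiff.
  apply: (@cdiff_comp cexp (fun w => (- z.1, z.2)%coqR * (w + - z))); first exact: cexp_cdiff.
  apply: cdiff_mult; first exact: cdiff_const.
  by apply: cdiff_plus; [exact: cdiff_id|exact: cdiff_const].
have Ez : E z = 1.
  by rewrite /E Cplus_opp_r; apply: injective_projections; rewrite /= !Rmult_0_r Rminus_0_r ?Rplus_0_r exp_0 ?cos_0 ?sin_0; ring.
have HG := entire_mult Hf HE.
have cf := entire_ccont Hf; have cG := entire_ccont HG.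
have := cauchy_square z HG Hs; rewrite Ez Cmult_1_r.
set M := exp ((Cmod z) ^ 2 / 2).
have M0 : (0 < M)%coqR by exact: exp_pos.
have K w : (cmod2 z w <= 8)%coqR -> (Cmod (f w * E w) <= (M * exp 4) * gmod f w)%coqR.
  move=> Hw; rewrite Cmod_mult Cmod_cexp /gmod.
  rewrite [X in (_ <= X)%coqR](_ : _ = Cmod (f w) * (M * exp 4 * exp (- (Cmod w) ^ 2 / 2)))%coqR; last by ring.
  apply: Rmult_le_compat_l; first exact: Cmod_ge_0.
  rewrite /M -!exp_plus !Cmod_sqr.
  set a := (X in exp X <= _); set b := (X in _ <= exp X).
  have : (a <= b)%coqR by rewrite /a /b /=; rewrite /cmod2 in Hw; nra.
  by case=> [/exp_increasing/Rlt_le //|->]; exact: Rle_refl.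
have rex (u : R -> R) a b : (forall t, @continuous R_UniformSpace R_UniformSpace u t) -> ex_RInt u a b.
  by move=> H; apply: (@ex_RInt_continuous R_CompleteNormedModule) => t _; exact: H.
have ch (g : C -> R) y t : (forall w, ccontR g w) -> @continuous R_UniformSpace R_UniformSpace (fun x => g (x, y)) t.
  move=> Hg; apply: (@continuous_comp R_UniformSpace C_UniformSpace R_UniformSpace (fun x => (x, y)) g) => //.
  apply: continuous_pair; first exact: (@continuous_id R_UniformSpace).
  exact: (@continuous_const R_UniformSpace R_UniformSpace).
have cv (g : C -> R) x t : (forall w, ccontR g w) -> @continuous R_UniformSpace R_UniformSpace (fun y => g (x, y)) t.
  move=> Hg; apply: (@continuous_comp R_UniformSpace C_UniformSpace R_UniformSpace (fun y => (x, y)) g) => //.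
  apply: continuous_pair; last exact: (@continuous_id R_UniformSpace).
  exact: (@continuous_const R_UniformSpace R_UniformSpace).
have cg w : ccontR (gmod f) w by exact: gmod_ccontR.
have cm w : ccontR (fun w => Cmod (f w * E w)) w by exact: (@ccontR_Cmod (fun w => f w * E w)).
have le_scal (u v : R -> R) a b : (a <= b)%coqR ->
    (forall t, @continuous R_UniformSpace R_UniformSpace u t) ->
    (forall t, @continuous R_UniformSpace R_UniformSpace v t) ->
    (forall x, (a <= x <= b)%coqR -> (u x <= (M * exp 4) * v x)%coqR) ->
    (RInt u a b <= (M * exp 4) * RInt v a b)%coqR.
  move=> ab Hu Hv uv.
  rewrite -(RInt_scal _ _ _ (M * exp 4)%coqR (rex v a b Hv) : _ = (_ * _)%coqR).
  apply: RInt_le => //; first exact: rex.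
  - by apply: (@ex_RInt_scal R_NormedModule); exact: rex.
  - by move=> x Hx; apply: uv; lra.
have hh y : (Rabs (y - z.2) <= 2)%coqR ->
    (RInt (fun x => Cmod (f (x, y) * E (x, y))) (z.1 - 2) (z.1 + 2)
     <= (M * exp 4) * RInt (fun x => gmod f (x, y)) (z.1 - 2) (z.1 + 2))%coqR.
  move=> /Rabs_le_between Hy; apply: le_scal; first lra.
  - by move=> t; exact: (ch (fun w => Cmod (f w * E w))).
  - by move=> t; exact: ch.
  - by move=> x Hx; apply: K; rewrite /cmod2 /=; nra.
have vv x : (Rabs (x - z.1) <= 2)%coqR ->
    (RInt (fun y => Cmod (f (x, y) * E (x, y))) (z.2 - 2) (z.2 + 2)
     <= (M * exp 4) * RInt (fun y => gmod f (x, y)) (z.2 - 2) (z.2 + 2))%coqR.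
  move=> /Rabs_le_between Hx; apply: le_scal; first lra.
  - by move=> t; exact: (cv (fun w => Cmod (f w * E w))).
  - by move=> t; exact: cv.
  - by move=> y Hy; apply: K; rewrite /cmod2 /=; nra.
have h1 := hh (z.2 - s)%coqR; have h2 := hh (z.2 + s)%coqR.
have h3 := vv (z.1 - s)%coqR; have h4 := vv (z.1 + s)%coqR => H.
have {}h1 := h1 ltac:(apply: Rabs_le; lra); have {}h2 := h2 ltac:(apply: Rabs_le; lra).
have {}h3 := h3 ltac:(apply: Rabs_le; lra); have {}h4 := h4 ltac:(apply: Rabs_le; lra).
have EM : (M * exp (- (Cmod z) ^ 2 / 2) = 1)%coqR.
  by rewrite /M -exp_plus -exp_0; congr exp; field.
apply: (Rmult_le_reg_l M) => //.
rewrite /gmod -/(gmod f).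
rewrite [X in (X <= _)%coqR](_ : _ = 4 * Cmod (f z) * (M * exp (- (Cmod z) ^ 2 / 2)))%coqR; last by ring.
rewrite EM Rmult_1_r; apply: (Rle_trans _ _ _ H).
rewrite -Rmult_assoc !Rmult_plus_distr_l.
by do 3!apply: Rplus_le_compat => //.
Qed.

(** * The operator induced by [z^2 / 2] *)

(** The operator [U] of the overview, with the derivative of [z^2 / 2] already inserted. *)
Definition sq_int (f : C -> C) (z : C) : C :=
  CInt (fun t : R => f (t * z) * (t * z) * z) 0%coqR 1%coqR.

Lemma rcont_ray f z t : ccont f -> rcont (fun t : R => f (t * z)) t.
Proof.
move=> Hf.
have lin (k : R) : @continuous R_UniformSpace R_UniformSpace (fun s => s * k)%coqR t.
  by apply: (@ex_derive_continuous R_AbsRing R_NormedModule); auto_derive.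
apply: (continuous_ext (fun s : R_UniformSpace => f (s * z.1, s * z.2)%coqR)).
  by move=> s; congr f; apply: injective_projections => /=; ring.
exact: (@rcont_comp f _ _ t Hf (lin _) (lin _)).
Qed.

Lemma ccont_id : ccont (fun w => w).
Proof. by move=> w; exact: (@continuous_id C_UniformSpace). Qed.

Lemma sq_int_rcont f z t : ccont f -> rcont (fun t : R => f (t * z) * (t * z) * z) t.
Proof.
move=> Hf; apply: (@rcont_ray (fun w => f w * w * z)).
exact: (ccont_mult (ccont_mult Hf ccont_id) (@ccont_const z)).
Qed.

Lemma entire_sq_poly c : entire (fun w => c * RtoC (/ 2) * (w * w)).
Proof.
have I : entire (fun w => w) by move=> z; eexists; apply/is_derive_cdiff; exact: cdiff_id.
apply: entire_mult; last exact: entire_mult.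
by move=> z; eexists; apply/is_derive_cdiff; exact: cdiff_const.
Qed.

Lemma cderiv_sq_poly c z : cderiv (fun w => c * RtoC (/ 2) * (w * w)) z = c * z.
Proof.
apply: cderivE.
have H := cdiff_mult (@cdiff_const (c * RtoC (/ 2)) z) (cdiff_mult (@cdiff_id z) (@cdiff_id z)).
rewrite (_ : c * z = 0 * (z * z) + c * RtoC (/ 2) * (1 * z + z * 1)) //.
transitivity (c * z * (RtoC (/ 2) + RtoC (/ 2))); last by ring.
by rewrite -RtoC_plus (_ : (/ 2 + / 2 = 1)%coqR); [ring|field].
Qed.

Lemma Volterra_sq_poly c f : ccont f ->
  Volterra (fun w => c * RtoC (/ 2) * (w * w)) f = fun z => c * sq_int f z.
Proof.
move=> Hf; apply/boolp.funext => z; apply: CInt_unique.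
apply: (@is_RInt_ext C_R_NormedModule (fun t : R => c * (f (t * z) * (t * z) * z))).
  by move=> t _; rewrite cderiv_sq_poly; Cring.
have H t : rcont (fun t : R => f (t * z) * (t * z) * z) t by exact: sq_int_rcont.
exact: is_CInt_Cmult (rcont_is_CInt H).
Qed.

Lemma sq_int_entire f : entire f -> entire (sq_int f).
Proof.
move=> Hf; have cf := entire_ccont Hf.
have I : entire (fun w => w) by move=> z; eexists; apply/is_derive_cdiff; exact: cdiff_id.
have HI := entire_mult Hf I.
have [F HF] := entire_primitive HI.
move=> z; exists (f z * z + 0); apply/is_derive_cdiff.
have : cdiff (fun w => F w + - F 0) z (f z * z + 0).
  by apply: cdiff_plus; [exact: HF|exact: cdiff_const].
apply: cdiff_ext => w.
have := @CInt_cdiff F (fun w => f w * w) 0 w 0%coqR 1%coqR (entire_ccont HI) HF.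
rewrite !Cplus_0_l Cmult_1_l Cmult_0_l -/(Cminus (F w) (F 0)) => <-.
by apply: CInt_ext => t _; rewrite !Cplus_0_l; Cring.
Qed.

Lemma sq_int_linear f h a b : ccont f -> ccont h ->
  sq_int (fun z => a * f z + b * h z) = fun z => a * sq_int f z + b * sq_int h z.
Proof.
move=> Hf Hh; apply/boolp.funext => z; apply: CInt_unique.
have H1 t : rcont (fun t : R => f (t * z) * (t * z) * z) t by exact: sq_int_rcont.
have H2 t : rcont (fun t : R => h (t * z) * (t * z) * z) t by exact: sq_int_rcont.
have := @is_RInt_plus C_R_NormedModule _ _ _ _ _ _ (@is_CInt_Cmult _ _ _ a _ (@rcont_is_CInt _ 0%coqR 1%coqR H1))
  (@is_CInt_Cmult _ _ _ b _ (@rcont_is_CInt _ 0%coqR 1%coqR H2)).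
move=> H; apply: (@is_RInt_ext C_R_NormedModule _ _ _ _ _ _ H) => t _.
rewrite [LHS](_ : _ = a * (f (t * z) * (t * z) * z) + b * (h (t * z) * (t * z) * z)) //.
Cring.
Qed.

(** Shows that the operator does not vanish on constants, which separates the new operator from a
    vanishing [V_g]. *)
Lemma sq_int_const c z : sq_int (fun _ => c) z = c * RtoC (/ 2) * (z * z).
Proof.
have c1 : ccont (fun _ => c) := @ccont_const c.
have := @CInt_cdiff (fun w => c * RtoC (/ 2) * (w * w)) (fun w => c * w) 0 z 0%coqR 1%coqR.
rewrite !Cplus_0_l Cmult_1_l Cmult_0_l => E.
rewrite -[RHS](_ : c * RtoC (/ 2) * (z * z) - c * RtoC (/ 2) * (0 * 0) = _); last by ring.
rewrite -E.
- by apply: CInt_ext => t _; rewrite !Cplus_0_l; Cring.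
- exact: ccont_mult c1 ccont_id.
- move=> w.
  have H := cdiff_mult (@cdiff_const (c * RtoC (/ 2)) w) (cdiff_mult (@cdiff_id w) (@cdiff_id w)).
  rewrite (_ : c * w = 0 * (w * w) + c * RtoC (/ 2) * (1 * w + w * 1)) //.
  transitivity (c * w * (RtoC (/ 2) + RtoC (/ 2))); last by ring.
  by rewrite -RtoC_plus (_ : (/ 2 + / 2 = 1)%coqR); [ring|field].
Qed.

(** * The kernel on rays, Jensen's inequality and the pointwise bound on [sq_int] *)

Definition ray_kernel (n t : R) : R := (t * n * exp (- (1 - t * t) * n / 2))%coqR.

Lemma ray_kernel_cont n t : Rcont (ray_kernel n) t.
Proof. by apply: (@ex_derive_continuous R_AbsRing R_NormedModule); rewrite /ray_kernel; auto_derive. Qed.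

(** With [n = |z|^2], the kernel is the derivative in [t] of [exp (- (1 - t^2) n / 2)], which rises
    from [exp (- n / 2)] to [1]. *)
Lemma RInt_ray_kernel n : RInt (ray_kernel n) 0 1 = (1 - exp (- n / 2))%coqR.
Proof.
apply: (@is_RInt_unique R_CompleteNormedModule).
have -> : (1 - exp (- n / 2) = minus (exp (- (1 - 1 * 1) * n / 2)) (exp (- (1 - 0 * 0) * n / 2)))%coqR.
  have -> : (- (1 - 1 * 1) * n / 2 = 0)%coqR by field.
  have -> : (- (1 - 0 * 0) * n / 2 = - n / 2)%coqR by field.
  by rewrite exp_0.
apply: (@is_RInt_derive R_CompleteNormedModule (fun t => exp (- (1 - t * t) * n / 2))%coqR).
- by move=> x _; rewrite /ray_kernel; auto_derive => //; rewrite /Rminus /Rdiv; ring_simplify; field.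
- by move=> x _; exact: ray_kernel_cont.
Qed.

Lemma Rcont_ex_RInt (u : R -> R) a b : (forall t, Rcont u t) -> ex_RInt u a b.
Proof. by move=> H; apply: (@ex_RInt_continuous R_CompleteNormedModule) => t _; exact: H. Qed.

Lemma Rcont_mult (u v : R -> R) t : Rcont u t -> Rcont v t -> Rcont (fun s => u s * v s)%coqR t.
Proof. exact: (@continuous_mult R_UniformSpace R_AbsRing). Qed.

Lemma gmod_ray_cont f z t : ccont f -> Rcont (fun t : R => gmod f (t * z)%C) t.
Proof.
move=> Hf; apply: (@continuous_comp R_UniformSpace C_UniformSpace R_UniformSpace (fun t : R => t * z) (gmod f)).
  exact: (@rcont_ray (fun w => w) z t ccont_id).
exact: gmod_ccontR.
Qed.

(** The weight at [z] splits as [exp (- t^2 |z|^2 / 2)], which is the weight of [f] at [t z], times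
    [exp (- (1 - t^2) |z|^2 / 2)], which goes into the kernel. *)
Lemma gmod_sq_int_le f z : ccont f ->
  (gmod (sq_int f) z <= RInt (fun t : R => gmod f (t * z)%C * ray_kernel ((Cmod z) ^ 2) t) 0 1)%coqR.
Proof.
move=> Hf.
pose v (t : R) := (Cmod (f (t * z)%C) * (t * (Cmod z) ^ 2))%coqR.
have cv t : Rcont v t.
  apply: Rcont_mult.
    apply: (@continuous_comp R_UniformSpace C_UniformSpace R_UniformSpace (fun t : R => t * z) (fun w => Cmod (f w))).
      exact: (@rcont_ray (fun w => w) z t ccont_id).
    exact: ccontR_Cmod.
  by apply: (@ex_derive_continuous R_AbsRing R_NormedModule); auto_derive.
have H1 : Cmod (sq_int f z) <= RInt v 0 1.
  apply: CInt_le; first by move=> t; exact: sq_int_rcont.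
  - lra.
  - exact: Rcont_ex_RInt.
  move=> t Ht; rewrite !Cmod_mult Cmod_R (Rabs_pos_eq t); last lra.
  by apply: Req_le; rewrite /v; ring.
have e0 := exp_pos (- (Cmod z) ^ 2 / 2).
apply: (Rle_trans _ (exp (- (Cmod z) ^ 2 / 2) * RInt v 0 1))%coqR.
  by rewrite /gmod Rmult_comm; apply: Rmult_le_compat_l => //; lra.
rewrite -(RInt_scal _ _ _ (exp (- (Cmod z) ^ 2 / 2)) (@Rcont_ex_RInt v _ _ cv) : _ = (_ * _)%coqR).
apply: Req_le; apply: RInt_ext => t _.
rewrite /v /gmod /ray_kernel Cmod_mult Cmod_R /scal /= /mult /=.
have -> : (exp (- (1 - t * t) * (Cmod z * (Cmod z * 1)) / 2) =
   exp (- (Cmod z * (Cmod z * 1)) / 2) * exp (t * t * (Cmod z * (Cmod z * 1)) / 2))%coqR.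
  by rewrite -exp_plus; congr exp; field.
have E : (exp (- (Rabs t * Cmod z * (Rabs t * Cmod z * 1)) / 2) * exp (t * t * (Cmod z * (Cmod z * 1)) / 2) = 1)%coqR.
  rewrite -exp_plus -exp_0; congr exp.
  have -> : (t * t = Rabs t * Rabs t)%coqR by rewrite -Rabs_mult Rabs_pos_eq //; exact: Rle_0_sqr.
  by field.
move: E; set a := exp (- (Cmod z * (Cmod z * 1)) / 2).
set b := exp (_ / 2); set c := exp (_ / 2) => E.
rewrite [RHS](_ : _ = b * c * (a * (Cmod (f (t * z)%C) * (t * (Cmod z * (Cmod z * 1))))))%coqR; last by ring.
by rewrite E; ring.
Qed.

(* Real powers, extended by [0] to negative bases so as to be continuous on the line. *)
Definition pw (p x : R) : R := if Rle_dec x 0 then 0%coqR else exp (p * ln x).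

Lemma pw_ge0 p x : (0 <= pw p x)%coqR.
Proof. by rewrite /pw; case: Rle_dec => ?; [exact: Rle_refl|exact/Rlt_le/exp_pos]. Qed.

Lemma pw_pos p x : (0 < x)%coqR -> pw p x = exp (p * ln x).
Proof. by move=> x0; rewrite /pw; case: Rle_dec => // ?; lra. Qed.

Lemma pw_neg p x : (x <= 0)%coqR -> pw p x = 0%coqR.
Proof. by move=> x0; rewrite /pw; case: Rle_dec => // ?; lra. Qed.

Lemma exp_le (x y : R) : (x <= y)%coqR -> (exp x <= exp y)%coqR.
Proof. by case=> [/exp_increasing/Rlt_le //|->]; exact: Rle_refl. Qed.

Lemma pw_cont p x : (1 <= p)%coqR -> Rcont (pw p) x.
Proof.
move=> p1; case: (Rtotal_order x 0) => [x0|[->|x0]].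
- apply: (continuous_ext_loc _ (fun _ => 0%coqR)); last exact: continuous_const.
  have e0 : (0 < - x)%coqR by lra.
  exists (mkposreal _ e0) => y Hy; have {}Hy : (Rabs (y - x) < - x)%coqR by exact: Hy.
  by rewrite pw_neg //; move/Rabs_lt_between: Hy; lra.
(* Continuity at [0] from the right: [y^p <= y] for [0 < y <= 1] because [p >= 1]. *)
- apply/continuity_pt_filterlim => e e0; exists (Rmin 1 e); split; first by apply: Rmin_pos; lra.
  move=> y [_ Hy]; have {}Hy : (Rabs (y - 0) < Rmin 1 e)%coqR by exact: Hy.
  rewrite Rminus_0_r in Hy.
  have h1 := Rlt_le_trans _ _ _ Hy (Rmin_l _ _); have h2 := Rlt_le_trans _ _ _ Hy (Rmin_r _ _).
  change (Rabs (pw p y - pw p 0) < e)%coqR.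
  rewrite (pw_neg _ (Rle_refl 0)) Rminus_0_r Rabs_pos_eq; last exact: pw_ge0.
  case: (Rle_lt_dec y 0) => y0; first by rewrite pw_neg.
  rewrite pw_pos // Rabs_pos_eq in h1 h2 *; last lra.
  apply: Rle_lt_trans h2; rewrite -[X in (_ <= X)%coqR]exp_ln //; apply: exp_le.
  have : (ln y <= 0)%coqR by rewrite -ln_1; apply: ln_le; lra.
  nra.
- apply: (continuous_ext_loc _ (fun y => exp (p * ln y))).
    exists (mkposreal _ x0) => y Hy; have {}Hy : (Rabs (y - x) < x)%coqR by exact: Hy.
    by rewrite pw_pos //; move/Rabs_lt_between: Hy; lra.
  by apply: (@ex_derive_continuous R_AbsRing R_NormedModule); auto_derive.
Qed.

(** The convex function [x^p] lies above its tangent at [c], here multiplied by [c] to avoid a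
    division. With [y = ln (x / c)] this reads [p exp y <= exp (p y) + p - 1], which follows from
    [1 + s <= exp s] at [s = (p - 1) y] and at [s = - y]. *)
Lemma pw_young p x c : (1 <= p)%coqR -> (0 <= x)%coqR -> (0 < c)%coqR ->
  (p * (x * pw p c) <= c * pw p x + (p - 1) * (c * pw p c))%coqR.
Proof.
move=> p1 x0 c0; have P0 := exp_pos (p * ln c).
case: (Req_dec x 0) => [->|xn0].
  rewrite Rmult_0_l Rmult_0_r (pw_neg p (Rle_refl 0)) (pw_pos p c0).
  have : (0 < c * exp (p * ln c))%coqR by apply: Rmult_lt_0_compat.
  by nra.
have {xn0 x0} x0 : (0 < x)%coqR by lra.
rewrite !pw_pos //; set y := (ln x - ln c)%coqR.
have Ex : (x = c * exp y)%coqR.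
  by rewrite /y /Rminus exp_plus exp_Ropp !exp_ln //; field; lra.
have -> : (exp (p * ln x) = exp (p * ln c) * exp (p * y))%coqR.
  by rewrite -exp_plus; congr exp; rewrite /y; ring.
have key : (p * exp y <= exp (p * y) + (p - 1))%coqR.
  have -> : (exp (p * y) = exp y * exp ((p - 1) * y))%coqR by rewrite -exp_plus; congr exp; ring.
  have h1 := exp_ineq1_le ((p - 1) * y); have h2 := exp_ineq1_le (- y).
  have ey := exp_pos y.
  have h3 : (exp y * exp (- y) = 1)%coqR by rewrite -exp_plus Rplus_opp_r exp_0.
  have : (exp y * (1 + (p - 1) * y) <= exp y * exp ((p - 1) * y))%coqR by apply: Rmult_le_compat_l; lra.
  have : (exp y * (1 + - y) <= 1)%coqR by rewrite -h3; apply: Rmult_le_compat_l; lra.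
  nra.
rewrite {1}Ex; set P := exp (p * ln c) in P0 *.
have cP : (0 < c * P)%coqR by apply: Rmult_lt_0_compat.
have := Rmult_le_compat_l _ _ _ (Rlt_le _ _ cP) key; lra.
Qed.

(** The tangent inequality at the weighted mean [A], integrated against [k]. A mass of at most [1]
    is enough because the term carrying the mass of [k] has the non-negative coefficient
    [(p - 1) A A^p]. The case [A <= 0] is separate, as the tangent is taken at a positive point. *)
Lemma jensen p (u k : R -> R) : (1 <= p)%coqR ->
  (forall t, Rcont u t) -> (forall t, Rcont k t) ->
  (forall t, 0 <= u t)%coqR -> (forall t, (0 <= t <= 1)%coqR -> 0 <= k t)%coqR -> (RInt k 0 1 <= 1)%coqR ->
  (pw p (RInt (fun t => u t * k t) 0 1) <= RInt (fun t => pw p (u t) * k t) 0 1)%coqR.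
Proof.
move=> p1 cu ck u0 k0 k1.
have cpu t : Rcont (fun t => pw p (u t)) t.
  apply: (@continuous_comp R_UniformSpace R_UniformSpace R_UniformSpace u (pw p)) => //.
  exact: pw_cont.
have cuk t : Rcont (fun t => u t * k t)%coqR t by exact: Rcont_mult.
have cpk t : Rcont (fun t => pw p (u t) * k t)%coqR t by exact: Rcont_mult.
set A := RInt (fun t => u t * k t)%coqR 0 1; set B := RInt (fun t => pw p (u t) * k t)%coqR 0 1.
case: (Rle_lt_dec A 0) => A0.
  rewrite pw_neg //; apply: RInt_ge_0; first lra; first exact: Rcont_ex_RInt.
  by move=> x Hx; apply: Rmult_le_pos; [exact: pw_ge0|apply: k0; lra].
set P := pw p A.
have P0 : (0 <= P)%coqR by exact: pw_ge0.
have I (v : R -> R) : (forall t, Rcont v t) -> is_RInt v 0 1 (RInt v 0 1).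
  by move=> Hv; apply: (@RInt_correct R_CompleteNormedModule); exact: Rcont_ex_RInt.
have H1 : is_RInt (fun t => (p * P) * (u t * k t))%coqR 0 1 ((p * P) * A)%coqR.
  by apply: (@is_RInt_scal R_NormedModule); exact: I.
have H2 : is_RInt (fun t => A * (pw p (u t) * k t) + ((p - 1) * (A * P)) * k t)%coqR 0 1
   (A * B + ((p - 1) * (A * P)) * RInt k 0 1)%coqR.
  by apply: (@is_RInt_plus R_NormedModule); apply: (@is_RInt_scal R_NormedModule); exact: I.
have H : (p * P * A <= A * B + ((p - 1) * (A * P)) * RInt k 0 1)%coqR.
  apply: (is_RInt_le _ _ _ _ _ _ _ H1 H2); first lra.
  move=> t Ht; have kt := k0 t ltac:(lra).
  have := Rmult_le_compat_r _ _ _ kt (pw_young p1 (u0 t) A0); rewrite -/P; lra.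
have : ((p - 1) * (A * P) * RInt k 0 1 <= (p - 1) * (A * P) * 1)%coqR.
  by apply: Rmult_le_compat_l => //; apply: Rmult_le_pos; [lra|apply: Rmult_le_pos; lra].
by move=> H3; apply: (Rmult_le_reg_l A) => //; lra.
Qed.

Lemma ray_kernel_ge0 n t : (0 <= n)%coqR -> (0 <= t)%coqR -> (0 <= ray_kernel n t)%coqR.
Proof.
move=> n0 t0; apply: Rmult_le_pos; last exact/Rlt_le/exp_pos.
exact: Rmult_le_pos.
Qed.

Lemma RInt_ray_kernel_le1 n : (RInt (ray_kernel n) 0 1 <= 1)%coqR.
Proof. by rewrite RInt_ray_kernel; have := exp_pos (- n / 2); lra. Qed.

Lemma pw_le p x y : (0 <= p)%coqR -> (x <= y)%coqR -> (pw p x <= pw p y)%coqR.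
Proof.
move=> p0 xy; case: (Rle_lt_dec x 0) => x0; first by rewrite pw_neg //; exact: pw_ge0.
rewrite !pw_pos //; last lra.
by apply: exp_le; apply: Rmult_le_compat_l => //; apply: ln_le.
Qed.

Lemma pw_gmod_sq_int_le p f z : (1 <= p)%coqR -> ccont f ->
  (pw p (gmod (sq_int f) z)
   <= RInt (fun t : R => pw p (gmod f (t * z)%C) * ray_kernel ((Cmod z) ^ 2) t) 0 1)%coqR.
Proof.
move=> p1 Hf; apply: Rle_trans (pw_le (_ : 0 <= p)%coqR (gmod_sq_int_le z Hf)) _; first lra.
apply: jensen => //.
- by move=> t; exact: gmod_ray_cont.
- exact: ray_kernel_cont.
- by move=> t; exact: gmod_ge0.
- by move=> t Ht; apply: ray_kernel_ge0; [exact: pow2_ge_0|lra].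
- exact: RInt_ray_kernel_le1.
Qed.

Lemma gmod_sq_int_sup f M : ccont f -> (forall z, gmod f z <= M)%coqR ->
  forall z, (gmod (sq_int f) z <= M)%coqR.
Proof.
move=> Hf HM z; apply: Rle_trans (gmod_sq_int_le z Hf) _.
have M0 : (0 <= M)%coqR := Rle_trans _ _ _ (gmod_ge0 f 0) (HM 0).
set k := ray_kernel _.
apply: (Rle_trans _ (M * RInt k 0 1))%coqR; last first.
  by have := RInt_ray_kernel_le1 (Cmod z ^ 2); rewrite -/k; nra.
rewrite -(RInt_scal _ _ _ M (@Rcont_ex_RInt k 0 1 (@ray_kernel_cont _)) : _ = (_ * _)%coqR).
apply: RInt_le; first lra.
- by apply: Rcont_ex_RInt => t; apply: Rcont_mult; [exact: gmod_ray_cont|exact: ray_kernel_cont].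
- by apply: (@ex_RInt_scal R_NormedModule); apply: Rcont_ex_RInt => t; exact: ray_kernel_cont.
- move=> t Ht; apply: Rmult_le_compat_r => //.
  by apply: ray_kernel_ge0; [exact: pow2_ge_0|lra].
Qed.

End ComplexAnalysis.

Section FockSpaces.
Set Implicit Arguments.
Unset Strict Implicit.
Unset Printing Implicit Defensive.
Import mathcomp.order.order.Order.TTheory GRing.Theory Num.Theory.
Import numFieldNormedType.Exports mathcomp.analysis.measurable_realfun.
Local Open Scope classical_set_scope.
Local Open Scope ring_scope.
Notation ccontR := (@Continuity.continuous C_UniformSpace R_UniformSpace).
Notation Rcont := (@Continuity.continuous R_UniformSpace R_UniformSpace).
Notation leb := (@lebesgue_measure R).
Notation plane := (measurableTypeR R * measurableTypeR R)%type.
Notation rT := (Real.sort (R : realType)).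
Notation line := (measurableTypeR R).

(** * Integration over the plane *)

(** A superlevel set is open, hence the union of the countably many boxes with rational corners that
    it contains; boxes are measurable in the product of two lines. *)
Lemma measurable_ccontR (f : C -> R) : (forall w, ccontR f w) ->
  measurable_fun [set: plane] (f : plane -> rT).
Proof.
move=> Hf; apply: (measurability _ (RGenOInfty.measurableE R)) => _ [_ [a ->] <-].
rewrite setTI.
pose oo (a b : R) := Interval (BRight a) (BLeft b).
pose box (q : (rat * rat) * (rat * rat)) : set plane :=
  [set` oo (ratr q.1.1) (ratr q.1.2)] `*` [set` oo (ratr q.2.1) (ratr q.2.2)].
pose A : set plane := f @^-1` `]a, +oo[.
have -> : f @^-1` `]a, +oo[ = \bigcup_q (if `[< box q `<=` A >] then box q else set0).
  apply/seteqP; split => [w|w [q _]]; last by case: asboolP => // + ?; apply.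
  rewrite /= in_itv/= andbT => /RltP aw.
  have [d [d0 Hd]] : exists d : R, (d > 0)%coqR /\
      forall v, (Cmod (Cminus v w) < d)%coqR -> (a < f v)%coqR.
    apply/locally_Cmod; apply: (Hf w (fun y => (a < y)%coqR)).
    have e0 : (0 < f w - a)%coqR by lra.
    exists (mkposreal _ e0) => y Hy.
    have {}Hy : (Rabs (y - f w) < f w - a)%coqR by exact: Hy.
    by move/Rabs_lt_between: Hy; lra.
  have rat_near (x : R) : exists q1 q2 : rat,
     [/\ (x - d / 2 < ratr q1)%coqR, (ratr q1 < x)%coqR, (x < ratr q2)%coqR & (ratr q2 < x + d / 2)%coqR].
    have /rat_in_itvoo[q1] : (x - d / 2)%coqR < x by apply/RltP; lra.
    have /rat_in_itvoo[q2] : x < (x + d / 2)%coqR by apply/RltP; lra.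
    rewrite !in_itv/= => /andP[/RltP ? /RltP ?] /andP[/RltP ? /RltP ?].
    by exists q1, q2.
  have [q1 [q2 [h1 h2 h3 h4]]] := rat_near w.1.
  have [r1 [r2 [k1 k2 k3 k4]]] := rat_near w.2.
  exists ((q1, q2), (r1, r2)) => //; case: asboolP => [_|]; last first.
    case; move=> v /= []; rewrite /= !in_itv/= => /andP[/RltP b1 /RltP b2] /andP[/RltP c1 /RltP c2].
    rewrite /A /= in_itv/= andbT; apply/RltP; apply: Hd.
    apply: Rle_lt_trans (Cmod_le_sum _) _.
    have : (Rabs (v.1 - w.1) < d / 2)%coqR by apply: Rabs_def1; lra.
    have : (Rabs (v.2 - w.2) < d / 2)%coqR by apply: Rabs_def1; lra.
    rewrite /= /Rminus; lra.
  by split; rewrite /= in_itv/=; apply/andP; split; apply/RltP.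
apply: countable_bigcupT_measurable; first exact: countableP.
by move=> q; case: asboolP => _ //; apply: measurableX; exact: measurable_itv.
Qed.

Lemma Rcont_continuous (f : rT -> rT) (x : rT) : Rcont (f : R -> R) (x : R) -> {for x, continuous f}.
Proof. by move=> H; apply/continuity_pt_cvg; exact/continuity_pt_filterlim. Qed.

Lemma is_derive_cvg (F : rT -> rT) (x l : rT) :
  Derive.is_derive (F : R -> R) (x : R) (l : R) ->
  h^-1 *: (F (h *: 1 + x) - F x) @[h --> 0^'] --> l.
Proof.
move=> H; apply/cvgrPdist_le => e /RltP e0.
have [d [/RltP d0 Hd]] := is_derive_eps H e0.
near=> h.
have h0 : h != 0 by near: h; exact: nbhs_dnbhs_neq.
have hd : `|h| < d by near: h; apply: dnbhs0_lt.
have := Hd h; rewrite RabsE => /(_ (RltP hd)) /RleP.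
rewrite !RabsE !RealsE => Hh.
rewrite -[l](mulKf h0) -mulrBr normrM normfV mulrC ler_pdivrMr ?normr_gt0//.
rewrite distrC; apply: le_trans Hh; rewrite le_eqVlt; apply/orP; left; apply/eqP.
by congr `| _ |; rewrite /GRing.scale/= mulr1 [h + x]addrC [h * l]mulrC.
Unshelve. all: by end_near. Qed.

Lemma is_derive_derivable (F : rT -> rT) (x l : rT) :
  Derive.is_derive (F : R -> R) (x : R) (l : R) ->
  derivable F x 1 /\ derive1 F x = l.
Proof.
move=> /is_derive_cvg H; split; first exact: (cvgP l).
by rewrite derive1E; exact: (cvg_lim _ H).
Qed.

Lemma integral_FTC (F f : rT -> rT) (a b : rT) : (a < b)%coqR ->
  (forall x, (a <= x <= b)%coqR -> Derive.is_derive (F : R -> R) (x : R) (f x : R)) ->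
  (forall x, (a <= x <= b)%coqR -> Rcont f x) ->
  (\int[leb]_(x in `[a, b]) (f x)%:E = (F b)%:E - (F a)%:E)%E.
Proof.
move=> ab HF Hf.
have cF x : (a <= x <= b)%coqR -> F y @[y --> x] --> F x.
  move=> Hx; apply: Rcont_continuous.
  by apply: (@Derive.ex_derive_continuous R_AbsRing R_NormedModule); exists (f x); exact: HF.
apply: continuous_FTC2; first exact/RltP.
- apply: continuous_in_subspaceT => x /[!inE] /=; rewrite in_itv/= => /andP[/RleP ? /RleP ?].
  by apply: Rcont_continuous; apply: Hf.
- split.
  + move=> x; rewrite in_itv/= => /andP[/RltP ? /RltP ?].
    have Hx : (a <= x <= b)%coqR by lra.
    by have [] := is_derive_derivable (HF x Hx).
  + by apply: cvg_at_right_filter; apply: cF; lra.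
  + by apply: cvg_at_left_filter; apply: cF; lra.
- move=> x; rewrite in_itv/= => /andP[/RltP ? /RltP ?].
  have Hx : (a <= x <= b)%coqR by lra.
    by have [] := is_derive_derivable (HF x Hx).
Qed.

(** The Riemann integral with variable upper bound is a primitive of [u], and the Lebesgue integral
    is the increment of any primitive. *)
Lemma integral_RInt (u : rT -> rT) (a b : rT) : (a < b)%coqR -> (forall x, Rcont u x) ->
  (\int[leb]_(x in `[a, b]) (u x)%:E = (RInt u a b)%:E)%E.
Proof.
move=> ab Hu; rewrite (@integral_FTC (fun x => RInt u a x) u) //.
- have -> : RInt u a a = 0 by exact: (@RInt_point R_CompleteNormedModule).
  by rewrite sube0.
- move=> x _; apply: (@is_derive_RInt R_NormedModule u _ a); last exact: Hu.
  exists (mkposreal _ Rlt_0_1) => y _; apply: (@RInt_correct R_CompleteNormedModule).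
  exact: Rcont_ex_RInt.
Qed.

Lemma scale_lebesgue (t : rT) (G : rT -> rT) : (0 < t)%coqR -> (forall x, Rcont G x) ->
  (forall x, (0 <= G x)%coqR) ->
  (\int[leb]_x (G x)%:E = \int[leb]_x (G (t * x) * t)%:E)%E.
Proof.
move=> t0 cG G0.
have D x : Derive.is_derive (fun x => t * x)%coqR x t by auto_derive => //; lra.
have dE : derive1 (fun x : rT => t * x) = (fun _ : rT => t).
  by apply/funext => x; have [_] := is_derive_derivable (D x).
rewrite (@increasing_ge0_integration_by_substitutionT R (fun x => t * x) G).
- by rewrite dE.
- by move=> x y /RltP xy; apply/RltP; apply: Rmult_lt_compat_l.
- by rewrite dE; exact: cst_continuous.
- by rewrite dE; exact: is_cvg_cst.
- by rewrite dE; exact: is_cvg_cst.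
- by move=> x; have [] := is_derive_derivable (D x).
- by apply: gt0_cvgMrNy; [exact/RltP|exact: cvg_id].
- by apply: gt0_cvgMry; [exact/RltP|exact: cvg_id].
- by move=> x; exact: Rcont_continuous.
- by move=> x; exact/RleP.
Qed.

Lemma measurable_Rcont (u : rT -> rT) : (forall x, Rcont (u : R -> R) x) -> measurable_fun setT u.
Proof. by move=> H; apply: continuous_measurable_fun => x; exact: Rcont_continuous. Qed.

Lemma ccontR_coord (G : C -> R) (u v : R -> R) w : (forall z, ccontR G z) ->
  Rcont u w.1 -> Rcont v w.2 -> ccontR (fun z : C => G (u z.1, v z.2)) w.
Proof.
move=> HG Hu Hv.
apply: (@Continuity.continuous_comp C_UniformSpace C_UniformSpace R_UniformSpace (fun z : C => (u z.1, v z.2)) G) => //.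
apply: continuous_pair.
- by apply: (@ccontR_comp u fst) => //; exact: ccontR_fst.
- by apply: (@ccontR_comp v snd) => //; exact: ccontR_snd.
Qed.

Lemma Rcont_scale (t x : R) : Rcont (fun y => t * y)%coqR x.
Proof. by apply: (@Derive.ex_derive_continuous R_AbsRing R_NormedModule); auto_derive. Qed.

Lemma Rcont_slice_x (G : C -> R) y x : (forall z, ccontR G z) -> Rcont (fun x => G (x, y)) x.
Proof.
move=> HG; apply: (@Continuity.continuous_comp R_UniformSpace C_UniformSpace R_UniformSpace (fun x => (x, y)) G) => //.
apply: continuous_pair; first exact: (@Continuity.continuous_id R_UniformSpace).
exact: (@Continuity.continuous_const R_UniformSpace R_UniformSpace).
Qed.

Lemma Rcont_slice_y (G : C -> R) x y : (forall z, ccontR G z) -> Rcont (fun y => G (x, y)) y.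
Proof.
move=> HG; apply: (@Continuity.continuous_comp R_UniformSpace C_UniformSpace R_UniformSpace (fun y => (x, y)) G) => //.
apply: continuous_pair; last exact: (@Continuity.continuous_id R_UniformSpace).
exact: (@Continuity.continuous_const R_UniformSpace R_UniformSpace).
Qed.

Lemma measurable_EFin_ccontR (G : C -> R) : (forall z, ccontR G z) ->
  measurable_fun [set: plane] (fun z : plane => (G z)%:E).
Proof. by move=> HG; apply/measurable_EFinP; exact: measurable_ccontR. Qed.

Lemma integral_areaA (G : C -> R) : (forall z, ccontR G z) -> (forall z, (0 <= G z)%coqR) ->
  (\int[areaA]_z (G z)%:E = \int[leb]_x \int[leb]_y (G (x, y))%:E)%E /\
  (\int[areaA]_z (G z)%:E = \int[leb]_y \int[leb]_x (G (x, y))%:E)%E.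
Proof.
move=> HG G0; have mG := measurable_EFin_ccontR HG.
have G0' (z : plane) : (0%R <= (G z)%:E)%E by rewrite lee_fin; exact/RleP.
split.
- by rewrite /areaA (@fubini_tonelli1 _ _ _ _ (R : realType) leb leb (fun z : plane => (G z)%:E) mG G0').
- by rewrite /areaA (@fubini_tonelli2 _ _ _ _ (R : realType) leb leb (fun z : plane => (G z)%:E) mG G0').
Qed.

(** One coordinate at a time: the two orders of Tonelli's theorem bring the variable to be rescaled
    innermost. *)
Lemma scale_areaA (t : rT) (G : C -> R) : (0 < t)%coqR -> (forall z, ccontR G z) ->
  (forall z, (0 <= G z)%coqR) ->
  (\int[areaA]_z (G z)%:E = \int[areaA]_z (G ((t * z.1)%coqR, (t * z.2)%coqR) * t * t)%:E)%E.
Proof.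
move=> t0 HG G0.
have Hc k w : ccontR (fun _ : C => k) w by exact: ccontR_const.
have H1 w : ccontR (fun z => G (z.1, (t * z.2)%coqR) * t)%coqR w.
  apply: ccontR_mult => //; apply: (@ccontR_coord G (fun x => x) (fun y => t * y)%coqR w HG).
    exact: (@Continuity.continuous_id R_UniformSpace).
  exact: Rcont_scale.
have H2 w : ccontR (fun z => G ((t * z.1)%coqR, (t * z.2)%coqR) * t * t)%coqR w.
  apply: ccontR_mult => //; apply: ccontR_mult => //.
  by apply: (@ccontR_coord G (fun x => t * x)%coqR (fun y => t * y)%coqR w HG); exact: Rcont_scale.
have p1 z : (0 <= G (z.1, (t * z.2)%coqR) * t)%coqR by apply: Rmult_le_pos => //; lra.
have p2 z : (0 <= G ((t * z.1)%coqR, (t * z.2)%coqR) * t * t)%coqR.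
  by apply: Rmult_le_pos; [apply: Rmult_le_pos => //|]; lra.
have [-> _] := integral_areaA HG G0.
have [_ ->] := integral_areaA H2 p2.
have [E1 E2] := integral_areaA H1 p1.
transitivity (\int[areaA]_z (G (z.1, (t * z.2)%coqR) * t)%:E)%E.
- rewrite E1; apply: eq_integral => x _.
  by apply: (@scale_lebesgue t (fun y => G (x, y))) => // y; exact: Rcont_slice_y.
- rewrite E2; apply: eq_integral => y _.
  rewrite (@scale_lebesgue t (fun x => G (x, (t * y)%coqR) * t)) //.
  + by move=> x; have H := @Rcont_slice_x _ y x H1; exact: H.
  + by move=> x; exact: (p1 (x, y)).
Qed.

(** The kernel seen from [w = t z], with [n = |w|^2]: [|z|^2] becomes [n / t^2] and the area element
    contributes another [1 / t^2]. For [t > 0] it is the derivative in [t] of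
    [exp (- (t^-2 - 1) n / 2)]. *)
Definition scaled_kernel (n t : R) : R := (ray_kernel (n * (/ t * / t)) t * (/ t * / t))%coqR.

Lemma scaled_kernel_derive (n t : R) : (0 < t)%coqR ->
  Derive.is_derive (fun t => exp (- (1 - t * t) * (n * (/ t * / t)) / 2))%coqR t (scaled_kernel n t).
Proof.
move=> t0; have tn : t <> 0%coqR by lra.
rewrite /scaled_kernel /ray_kernel; auto_derive; first by do !split.
by set e := exp _; field.
Qed.

Lemma scaled_kernel_cont (n t : R) : (0 < t)%coqR -> Rcont (scaled_kernel n) t.
Proof.
move=> t0; have tn : t <> 0%coqR by lra.
apply: (@Derive.ex_derive_continuous R_AbsRing R_NormedModule).
by rewrite /scaled_kernel /ray_kernel; auto_derive.
Qed.

Lemma scaled_kernel_ge0 (n t : R) : (0 <= n)%coqR -> (0 < t)%coqR -> (0 <= scaled_kernel n t)%coqR.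
Proof.
move=> n0 t0; have i0 := Rinv_0_lt_compat _ t0.
apply: Rmult_le_pos; last by apply: Rmult_le_pos; lra.
apply: ray_kernel_ge0; last lra.
by apply: Rmult_le_pos => //; apply: Rmult_le_pos; lra.
Qed.

(** The parameter [t = 0] is left out because the dilation [w = t z] degenerates there. *)
Definition unit_oc : set rT := [set` Interval (BRight 0) (BRight 1)].

Lemma unit_ocP (t : rT) : unit_oc t <-> (0 < t <= 1)%coqR.
Proof.
rewrite /unit_oc /= in_itv/=; split; first by move=> /andP[/RltP ? /RleP ?].
by case=> /RltP -> /RleP ->.
Qed.

Lemma measurable_scaled_kernel d (T : measurableType d) (n t : T -> rT) :
  measurable_fun setT n -> measurable_fun setT t ->
  measurable_fun setT (fun x => scaled_kernel (n x) (t x) * \1_unit_oc (t x) : rT).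
Proof.
move=> mn mt.
(* The inverse of [t] written as a power: measurable on the whole line, and equal to the inverse
   wherever the indicator is nonzero. *)
pose q (x : T) : rT := powR (t x) (-1).
have mq : measurable_fun setT q.
  exact: (measurableT_comp (measurable_powR (-1))).
have mexp : measurable_fun setT (exp : rT -> rT).
  apply: measurable_Rcont => x.
  by apply: (@Derive.ex_derive_continuous R_AbsRing R_NormedModule); auto_derive.
have m1 : measurable_fun setT (\1_unit_oc : rT -> rT).
  by apply: measurable_indic; exact: measurable_itv.
have mc (c : rT) : measurable_fun setT (fun _ : T => c) by exact: measurable_cst.
have mnq : measurable_fun setT (fun x => n x * (q x * q x)).
  by apply: measurable_funM => //; apply: measurable_funM.
rewrite (_ : (fun x => _) = (fun x => (t x * (n x * (q x * q x)) *
   exp ((- (1 - t x * t x)) * (n x * (q x * q x)) * (/ 2)%coqR)) * (q x * q x) * \1_unit_oc (t x))); last first.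
  apply/funext => x; rewrite indicE; case: (boolP (t x \in unit_oc)) => [|_]; last by rewrite !mulr0.
  rewrite inE => /unit_ocP[t0 _]; rewrite !mulr1.
  have -> : q x = (/ t x)%coqR by rewrite /q powR_inv1 //; exact/ltW/RltP.
  by [].
apply: measurable_funM; last exact: (measurableT_comp m1).
apply: measurable_funM; last exact: measurable_funM.
apply: measurable_funM; first exact: measurable_funM.
apply: (measurableT_comp mexp); apply: measurable_funM => //; apply: measurable_funM => //.
apply: measurable_funN.
by apply: measurable_funB => //; apply: measurable_funM.
Qed.

Lemma integral_indicM (D : set rT) (u : rT -> rT) :
  (\int[leb]_t (u t * \1_D t)%:E = \int[leb]_(t in D) (u t)%:E)%E.
Proof.
rewrite [RHS]integral_mkcond; apply: eq_integral => t _.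
by rewrite patchE indicE; case: ifPn => _; rewrite ?mulr1 ?mulr0.
Qed.

(** On [[eps, 1]] the integral is [1] minus an exponential, by the explicit primitive; monotone
    convergence lets [eps] tend to [0], where the kernel is singular. *)
Lemma integral_scaled_kernel (n : R) : (0 <= n)%coqR ->
  (\int[leb]_t (scaled_kernel n t * \1_unit_oc t)%:E <= 1)%E.
Proof.
move=> n0.
(* Starting at [1 / 2] keeps every interval [[eps m, 1]] nondegenerate. *)
pose eps (m : nat) : R := (/ INR m.+2)%coqR.
have eps0 m : (0 < eps m)%coqR by apply: Rinv_0_lt_compat; apply: lt_0_INR; exact: Nat.lt_0_succ.
have eps1 m : (eps m < 1)%coqR.
  rewrite /eps -[X in (_ < X)%coqR]Rinv_1; apply: Rinv_lt_contravar.
    by rewrite Rmult_1_l; apply: lt_0_INR; exact: Nat.lt_0_succ.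
  by apply: (lt_INR 1); apply/ssrnat.ltP.
pose F (m : nat) : set rT := [set` Interval (BLeft (eps m : rT)) (BRight (1 : rT))].
have FP m t : F m t <-> (eps m <= t <= 1)%coqR.
  rewrite /F /= in_itv/=; split; first by move=> /andP[/RleP ? /RleP ?].
  by case=> /RleP -> /RleP ->.
have FU m : F m `<=` unit_oc.
  by move=> t /FP [? ?]; apply/unit_ocP; have := eps0 m; lra.
have UF : \bigcup_m F m = unit_oc.
  apply/seteqP; split => [t [m _ /FU //]|t /unit_ocP[t0 t1]].
  have [m Hm] := archimed_cor1 t t0.
  case: Hm => Hm m0; exists m => //; apply/FP; split=> //.
  apply: Rle_trans (Rlt_le _ _ Hm); apply: Rinv_le_contravar; first exact: lt_0_INR.
  by apply: le_INR; apply/ssrnat.leP; rewrite -addn2 leq_addr.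
pose u (t : rT) : rT := scaled_kernel n t * \1_unit_oc t.
have mu : measurable_fun setT (fun t => (u t)%:E).
  by apply/measurable_EFinP; apply: measurable_scaled_kernel; [exact: measurable_cst|exact: measurable_id].
have u0 t : (0%R <= (u t)%:E)%E.
  rewrite lee_fin /u indicE; case: (boolP (t \in unit_oc)) => [|_]; last by rewrite mulr0.
  by rewrite inE mulr1 => /unit_ocP[t0 _]; apply/RleP; exact: scaled_kernel_ge0.
have uF m t : F m t -> u t = scaled_kernel n t.
  by move=> /FU Ft; rewrite /u indicE mem_set// mulr1.
have IF m : (\int[leb]_(t in F m) (u t)%:E <= 1)%E.
  have -> : (\int[leb]_(t in F m) (u t)%:E = \int[leb]_(t in F m) (scaled_kernel n t : rT)%:E)%E.
    by apply: eq_integral => t; rewrite inE => /uF ->.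
  have := @integral_FTC (fun t => exp (- (1 - t * t) * (n * (/ t * / t)) / 2))%coqR (scaled_kernel n) (eps m) 1 (eps1 m).
  rewrite /F => ->.
  - rewrite -EFinB lee_fin; apply/RleP.
    have := exp_pos (- (1 - eps m * eps m) * (n * (/ eps m * / eps m)) / 2).
    have E1 : exp (- (1 - 1 * 1) * (n * (/ 1 * / 1)) / 2) = 1%coqR.
      by transitivity (exp 0); [congr exp; field|exact: exp_0].
    set e := exp _ => e0.
    change (exp (- (1 - 1 * 1) * (n * (/ 1 * / 1)) / 2) - e <= 1)%coqR.
    by rewrite E1; lra.
  - by move=> x [Hx _]; apply: scaled_kernel_derive; have := eps0 m; lra.
  - by move=> x [Hx _]; apply: scaled_kernel_cont; have := eps0 m; lra.
have H := @ge0_nondecreasing_set_cvg_integral _ (measurableTypeR R) (R : realType) F (fun t : rT => (u t)%:E) leb.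
have -> : (\int[leb]_t (scaled_kernel n t * \1_unit_oc t)%:E = \int[leb]_(t in \bigcup_m F m) (u t)%:E)%E.
  rewrite UF integral_indicM; apply: eq_integral => t; rewrite inE => Dt.
  by rewrite /u indicE mem_set// mulr1.
apply: (cvge_le _ (H _ _ _ _)).
- by apply: nearW => m; exact: IF.
- move=> m k mk; apply/subsetPset => t /FP[? ?]; apply/FP; split=> //.
  apply: Rle_trans; last by eassumption.
  apply: Rinv_le_contravar; first by apply: lt_0_INR; exact: Nat.lt_0_succ.
  by apply: le_INR; apply/ssrnat.leP; rewrite !ltnS.
- by move=> m; exact: measurable_itv.
- by move=> m; exact: measurable_funS mu.
- by move=> m t _; exact: u0.
Qed.

(** Two exchanges of real variables: [t] first passes [y] with [x] fixed, then passes [x], the inner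
    integral over [y] being carried along. The function [k] regroups the variables so that this
    inner integral is measurable in [(x, t)]. *)
Lemma fubini_areaA (g : plane * line -> \bar rT) : measurable_fun setT g ->
  (forall x, 0%R <= g x)%E ->
  (\int[areaA]_z \int[leb]_t g (z, t) = \int[leb]_t \int[areaA]_z g (z, t))%E.
Proof.
move=> mg g0.
have mgt := @measurable_fun_fubini_tonelli_F _ _ plane line (R : realType) leb g mg g0.
have gt0 (z : plane) : (0%R <= \int[leb]_t g (z, t))%E by apply: integral_ge0 => t _; exact: g0.
rewrite /areaA (@fubini_tonelli1 _ _ line line (R : realType) leb leb (fun z : plane => \int[leb]_t g (z, t))%E mgt gt0) /fubini_F.
pose k (w : (line * line) * line) : \bar rT := g ((w.1.1, w.2), w.1.2).
have mk : measurable_fun setT k.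
  apply: (measurableT_comp mg); apply: measurable_fun_pair.
    apply: measurable_fun_pair; last exact: measurable_snd.
    by apply: (measurableT_comp measurable_fst); exact: measurable_fst.
  by apply: (measurableT_comp measurable_snd); exact: measurable_fst.
have k0 w : (0%R <= k w)%E by exact: g0.
have mky := @measurable_fun_fubini_tonelli_F _ _ (line * line)%type line (R : realType) leb k mk k0.
have ky0 (w : line * line) : (0%R <= \int[leb]_y k (w, y))%E.
  by apply: integral_ge0 => t _; exact: k0.
transitivity (\int[leb]_x \int[leb]_t \int[leb]_y g ((x, y), t))%E.
  apply: eq_integral => x _.
  pose h (w : line * line) : \bar rT := g ((x, w.1), w.2).
  have mh : measurable_fun setT h.
    apply: (measurableT_comp mg); apply: measurable_fun_pair; last exact: measurable_snd.
    by apply: measurable_fun_pair; [exact: measurable_cst|exact: measurable_fst].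
  exact: (@fubini_tonelli _ _ line line (R : realType) leb leb h mh (fun w => g0 _)).
rewrite (@fubini_tonelli _ _ line line (R : realType) leb leb (fun w : line * line => \int[leb]_y k (w, y))%E mky ky0).
apply: eq_integral => t _.
have mt : measurable_fun setT (fun z : plane => g (z, t)).
  apply: (measurableT_comp mg).
  by apply: measurable_fun_pair; [exact: measurable_id|exact: measurable_cst].
by rewrite (@fubini_tonelli1 _ _ line line (R : realType) leb leb (fun z : plane => g (z, t)) mt (fun z => g0 _)).
Qed.

Lemma Cmult_RtoC (t : R) (z : C) : Cmult (RtoC t) z = ((t * z.1)%coqR, (t * z.2)%coqR).
Proof. by apply: injective_projections => /=; ring. Qed.

Lemma pw_gmod_ccontR p f w : (1 <= p)%coqR -> ccont f -> ccontR (fun z => pw p (gmod f z)) w.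
Proof.
move=> p1 Hf; apply: (@ccontR_comp (pw p) (gmod f)); first exact: gmod_ccontR.
exact: pw_cont.
Qed.

Lemma integral_pw_sq_int (p : R) (f : C -> C) : (1 <= p)%coqR -> entire f ->
  (\int[areaA]_z (pw p (gmod (sq_int f) z))%:E <= \int[areaA]_z (pw p (gmod f z))%:E)%E.
Proof.
move=> p1 Hf; have cf := entire_ccont Hf; have cU := entire_ccont (sq_int_entire Hf).
pose psi (z : C) : R := pw p (gmod f z).
have cpsi z : ccontR psi z by exact: pw_gmod_ccontR.
have psi0 z : (0 <= psi z)%coqR by exact: pw_ge0.
pose nn (z : C) : R := ((Cmod z) ^ 2)%coqR.
have nn0 z : (0 <= nn z)%coqR by exact: pow2_ge_0.
have nnM (t : R) (z : C) : nn ((t * z.1)%coqR, (t * z.2)%coqR) = (t * t * nn z)%coqR.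
  by rewrite /nn !Cmod_sqr /=; ring.
have cnn z : ccontR nn z.
  apply: (Continuity.continuous_ext (fun w : C_UniformSpace => w.1 * w.1 + w.2 * w.2)%coqR) => [x|].
    by rewrite /nn Cmod_sqr.
  by apply: ccontR_plus; apply: ccontR_mult; (exact: ccontR_fst || exact: ccontR_snd).
(* [H] is the integrand of the Jensen bound, and [H'] is what it becomes at [w = t z], Jacobian
   included. The indicator extends both to all real [t], so that Tonelli's theorem applies on a full
   product. *)
pose H (x : plane * measurableTypeR R) : rT :=
  psi ((x.2 * x.1.1)%coqR, (x.2 * x.1.2)%coqR) * (ray_kernel (nn x.1) x.2 * \1_unit_oc x.2).
pose H' (x : plane * measurableTypeR R) : rT := psi x.1 * (scaled_kernel (nn x.1) x.2 * \1_unit_oc x.2).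
have m1 : measurable_fun setT (fun x : plane * measurableTypeR R => x.1) by exact: measurable_fst.
have m2 : measurable_fun setT (fun x : plane * measurableTypeR R => x.2) by exact: measurable_snd.
have mn : measurable_fun setT (fun x : plane * measurableTypeR R => nn x.1 : rT).
  exact: (measurableT_comp (measurable_ccontR cnn) m1).
have mind : measurable_fun setT (fun x : plane * measurableTypeR R => \1_unit_oc x.2 : rT).
  apply: (measurableT_comp _ m2); apply: measurable_indic; exact: measurable_itv.
have mexp : measurable_fun setT (exp : rT -> rT).
  apply: measurable_Rcont => x.
  by apply: (@Derive.ex_derive_continuous R_AbsRing R_NormedModule); auto_derive.
have mH : measurable_fun setT H.
  apply: measurable_funM.
    apply: (measurableT_comp (measurable_ccontR cpsi)).
    apply: measurable_fun_pair; apply: measurable_funM => //.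
    - by apply: (measurableT_comp _ m1); exact: measurable_fst.
    - by apply: (measurableT_comp _ m1); exact: measurable_snd.
  apply: measurable_funM => //; apply: measurable_funM; first exact: measurable_funM.
  apply: (measurableT_comp mexp); apply: measurable_funM; last exact: measurable_cst.
  apply: measurable_funM => //; apply: measurable_funN; apply: measurable_funB; first exact: measurable_cst.
  exact: measurable_funM.
have mH' : measurable_fun setT H'.
  apply: measurable_funM; first exact: (measurableT_comp (measurable_ccontR cpsi) m1).
  exact: measurable_scaled_kernel.
have ind0 t : (0 <= (\1_unit_oc t : rT)) by rewrite indicE; case: (_ \in _).
have H0 x : (0%R <= (H x)%:E)%E.
  rewrite lee_fin /H indicE; case: (boolP (x.2 \in unit_oc)) => [|_]; last by rewrite !mulr0.
  rewrite inE mulr1 => /unit_ocP[t0 _]; apply/RleP; apply: Rmult_le_pos => //.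
  by apply: ray_kernel_ge0 => //; lra.
have H'0 x : (0%R <= (H' x)%:E)%E.
  rewrite lee_fin /H' indicE; case: (boolP (x.2 \in unit_oc)) => [|_]; last by rewrite !mulr0.
  rewrite inE mulr1 => /unit_ocP[t0 _]; apply/RleP; apply: Rmult_le_pos => //.
  exact: scaled_kernel_ge0.
have mEH : measurable_fun setT (fun x => (H x)%:E) by exact/measurable_EFinP.
have mEH' : measurable_fun setT (fun x => (H' x)%:E) by exact/measurable_EFinP.
have step1 : (\int[areaA]_z (pw p (gmod (sq_int f) z))%:E <= \int[areaA]_z \int[leb]_t (H (z, t))%:E)%E.
  apply: (@ge0_le_integral _ _ _ areaA) => //.
  - by move=> z _; rewrite lee_fin; apply/RleP; exact: pw_ge0.
  - by apply: measurable_EFin_ccontR => z; exact: pw_gmod_ccontR.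
  - exact: (@measurable_fun_fubini_tonelli_F _ _ _ _ (R : realType) leb (fun x => (H x)%:E) mEH H0).
  move=> z _.
  pose v (t : rT) : rT := (psi ((t * z.1)%coqR, (t * z.2)%coqR) * ray_kernel (nn z) t)%coqR.
  have vE (t : rT) : v t = (pw p (gmod f (Cmult (RtoC t) z)) * ray_kernel ((Cmod z) ^ 2) t)%coqR.
    by rewrite (Cmult_RtoC t z).
  have cv t : Rcont v t.
    apply: Rcont_mult; last exact: ray_kernel_cont.
    apply: (@Continuity.continuous_comp R_UniformSpace C_UniformSpace R_UniformSpace (fun t => ((t * z.1)%coqR, (t * z.2)%coqR)) psi) => //.
    by apply: continuous_pair; apply: (@Derive.ex_derive_continuous R_AbsRing R_NormedModule); auto_derive.
  have -> : (\int[leb]_t (H (z, t))%:E = \int[leb]_(t in unit_oc) (v t)%:E)%E.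
    by rewrite -(integral_indicM unit_oc v); apply: eq_integral => t _; rewrite /H /= mulrA.
  have mv : measurable_fun setT v by exact: measurable_Rcont.
  (* Adding the null point [0] gives the closed interval on which the Riemann integral is
     available. *)
  rewrite /unit_oc integral_itv_obnd_cbnd; last first.
    by apply/measurable_EFinP; exact: measurable_funS mv.
  rewrite integral_RInt //; last exact: Rlt_0_1.
  rewrite lee_fin; apply/RleP; apply: Rle_trans (pw_gmod_sq_int_le z p1 cf) _.
  by apply: Req_le; apply: RInt_ext => t _; rewrite vE.
apply: (le_trans step1).
have -> : (\int[areaA]_z \int[leb]_t (H (z, t))%:E = \int[leb]_t \int[areaA]_z (H (z, t))%:E)%E.
  exact: (@fubini_areaA (fun x => (H x)%:E) mEH H0).
have -> : (\int[leb]_t \int[areaA]_z (H (z, t))%:E = \int[leb]_t \int[areaA]_z (H' (z, t))%:E)%E.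
  apply: eq_integral => t _; rewrite /H /H' /= indicE.
  case: (boolP (t \in unit_oc)) => [|_]; last by apply: eq_integral => z _; rewrite !mulr0.
  rewrite inE => /unit_ocP[t0 t1].
  rewrite (@scale_areaA t (fun z => psi z * (scaled_kernel (nn z) t * true%:R)%R)%coqR) //.
  - apply: eq_integral => z _; congr EFin; rewrite !mulr1.
    rewrite (nnM t z) /scaled_kernel.
    have -> : (t * t * nn z * (/ t * / t) = nn z)%coqR by field; lra.
    set a := psi _; set b := ray_kernel _ _.
    change (a * b = a * (b * (/ t * / t)) * t * t)%coqR; field; lra.
  - move=> w; apply: ccontR_mult => //.
    apply: (@Continuity.continuous_ext C_UniformSpace R_UniformSpace (fun z => scaled_kernel (nn z) t)) => [z|].
      by rewrite mulr1.
    apply: (@ccontR_comp (fun n => scaled_kernel n t) nn) => //.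
    by apply: (@Derive.ex_derive_continuous R_AbsRing R_NormedModule); rewrite /scaled_kernel /ray_kernel; auto_derive.
  - move=> z; rewrite mulr1; apply: Rmult_le_pos => //; exact: scaled_kernel_ge0.
have -> : (\int[leb]_t \int[areaA]_z (H' (z, t))%:E = \int[areaA]_z \int[leb]_t (H' (z, t))%:E)%E.
  apply/esym; exact: (@fubini_areaA (fun x => (H' x)%:E) mEH' H'0).
apply: (@ge0_le_integral _ _ _ areaA) => //.
- by move=> z _; apply: integral_ge0 => t _; exact: H'0.
- exact: (@measurable_fun_fubini_tonelli_F _ _ _ _ (R : realType) leb (fun x => (H' x)%:E) mEH' H'0).
- by apply: measurable_EFin_ccontR => z; exact: cpsi.
move=> z _.
have -> : (\int[leb]_t (H' (z, t))%:E = (psi z)%:E * \int[leb]_t (scaled_kernel (nn z) t * \1_unit_oc t)%:E)%E.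
  rewrite -ge0_integralZl_EFin //.
  - move=> t _; rewrite lee_fin indicE; case: (boolP (t \in unit_oc)) => [|_]; last by rewrite mulr0.
    by rewrite inE mulr1 => /unit_ocP[t0 _]; apply/RleP; exact: scaled_kernel_ge0.
  - by apply/measurable_EFinP; apply: measurable_scaled_kernel; [exact: measurable_cst|exact: measurable_id].
  - exact/RleP.
rewrite -[X in (_ <= X)%E]mule1; apply: lee_pmul => //.
- by rewrite lee_fin; exact/RleP.
- apply: integral_ge0 => t _; rewrite lee_fin indicE; case: (boolP (t \in unit_oc)) => [|_]; last by rewrite mulr0.
  by rewrite inE mulr1 => /unit_ocP[t0 _]; apply/RleP; exact: scaled_kernel_ge0.
- exact: integral_scaled_kernel.
Qed.

(** * Translations, reflection and averaging over squares *)

Lemma shift_lebesgue (a : rT) (G : rT -> rT) : (forall x, Rcont G x) ->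
  (forall x, (0 <= G x)%coqR) ->
  (\int[leb]_x (G x)%:E = \int[leb]_x (G (x + a)%coqR)%:E)%E.
Proof.
move=> cG G0.
have D x : Derive.is_derive (fun x => x + a)%coqR x (1 : rT) by auto_derive => //; lra.
have dE : derive1 (fun x : rT => x + a) = (fun _ : rT => 1).
  by apply/funext => x; have [_] := is_derive_derivable (D x).
rewrite (@increasing_ge0_integration_by_substitutionT R (fun x => x + a) G).
- by rewrite dE; apply: eq_integral => x _ /=; rewrite mulr1.
- by move=> x y /RltP xy; apply/RltP; apply: Rplus_lt_compat_r.
- by rewrite dE; exact: cst_continuous.
- by rewrite dE; exact: is_cvg_cst.
- by rewrite dE; exact: is_cvg_cst.
- by move=> x; have [] := is_derive_derivable (D x).
- by apply: cvg_addrr_Ny.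
- by apply: cvg_addrr.
- by move=> x; exact: Rcont_continuous.
- by move=> x; exact/RleP.
Qed.

Lemma Rcont_shift (a x : R) : Rcont (fun y => y + a)%coqR x.
Proof. by apply: (@Derive.ex_derive_continuous R_AbsRing R_NormedModule); auto_derive. Qed.

Lemma shift_ccontR (G : C -> R) (a b : R) w : (forall z, ccontR G z) ->
  ccontR (fun z => G ((z.1 + a)%coqR, (z.2 + b)%coqR)) w.
Proof.
move=> HG; apply: (@ccontR_coord G (fun x => x + a)%coqR (fun y => y + b)%coqR w HG); exact: Rcont_shift.
Qed.

Lemma shift_areaA (a b : rT) (G : C -> R) : (forall z, ccontR G z) ->
  (forall z, (0 <= G z)%coqR) ->
  (\int[areaA]_z (G z)%:E = \int[areaA]_z (G ((z.1 + a)%coqR, (z.2 + b)%coqR))%:E)%E.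
Proof.
move=> HG G0.
have H2 w : ccontR (fun z => G ((z.1 + a)%coqR, (z.2 + b)%coqR)) w by exact: shift_ccontR.
have H1 w : ccontR (fun z => G (z.1, (z.2 + b)%coqR)) w.
  apply: (@ccontR_coord G (fun x => x) (fun y => y + b)%coqR w HG); last exact: Rcont_shift.
  exact: (@Continuity.continuous_id R_UniformSpace).
have [-> _] := integral_areaA HG G0.
have [_ ->] := integral_areaA H2 (fun z => G0 _).
have [E1 E2] := integral_areaA H1 (fun z => G0 _).
transitivity (\int[areaA]_z (G (z.1, (z.2 + b)%coqR))%:E)%E.
- rewrite E1; apply: eq_integral => x _.
  by apply: (@shift_lebesgue b (fun y => G (x, y))) => // y; exact: Rcont_slice_y.
- rewrite E2; apply: eq_integral => y _.
  apply: (@shift_lebesgue a (fun x => G (x, (y + b)%coqR))) => // x.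
  by have H := @Rcont_slice_x _ y x H1; exact: H.
Qed.

Lemma reflect_lebesgue (f : line -> \bar rT) : measurable_fun setT f -> (forall r, 0%R <= f r)%E ->
  (\int[leb]_r f r = \int[leb]_r f (- r)%R)%E.
Proof.
move=> mf f0.
rewrite -[RHS](@ge0_integral_pushforward _ _ line line (R : realType) (-%R : rT -> rT) _ leb setT f) //.
by apply: eq_measure_integral => //= A mA AS; exact/esym/lebesgue_measureN.
Qed.

Definition side : set line := [set` Interval (BLeft (- 2%:R : rT)) (BRight (2%:R : rT))].
(** The half-sides of the averaged squares; the interval has length [1], so the average needs no
    normalisation. *)
Definition ring_radii : set line := [set` Interval (BLeft (1 : rT)) (BRight (2%:R : rT))].

Lemma sideP (t : R) : side t <-> (-2 <= t <= 2)%coqR.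
Proof.
have E2 : (2%:R : rT) = 2%coqR by rewrite -INRE /=; lra.
rewrite /side E2 /= in_itv/=; split; first by move=> /andP[/RleP ? /RleP ?]; split=> //; change (- 2 <= t)%coqR.
by case=> h1 h2; apply/andP; split; apply/RleP => //; exact: h1.
Qed.

Lemma ring_radiiP (t : R) : ring_radii t <-> (1 <= t <= 2)%coqR.
Proof.
have E2 : (2%:R : rT) = 2%coqR by rewrite -INRE /=; lra.
rewrite /ring_radii E2 /= in_itv/=; split; first by move=> /andP[/RleP ? /RleP ?].
by case=> h1 h2; apply/andP; split; apply/RleP => //; exact: h1.
Qed.

Lemma lebesgue_ring_radii : leb ring_radii = 1%E.
Proof.
rewrite /ring_radii lebesgue_measure_itv /= lte_fin.
have -> : ((1 : rT) < 2%:R) by rewrite ltr1n.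
by rewrite -EFinB; congr EFin; rewrite mulr2n addrK.
Qed.

Lemma lebesgue_side : leb side = 4%:R%:E.
Proof.
rewrite /side lebesgue_measure_itv /= lte_fin.
have -> : (- (2%:R : rT) < 2%:R) by apply/RltP; rewrite mulr2n; change (- (1 + 1) < 1 + 1)%coqR; lra.
by rewrite -EFinB; congr EFin; rewrite opprK -natrD.
Qed.

Lemma integral_side (u : rT -> rT) : (forall x, Rcont u x) ->
  (\int[leb]_(x in side) (u x)%:E = (RInt u (-2) 2)%:E)%E.
Proof.
have E2 : (2%:R : rT) = 2%coqR by rewrite -INRE /=; lra.
by move=> Hu; rewrite /side E2 integral_RInt //; change (- (2) < 2)%coqR; lra.
Qed.

(* Averaging the bound over squares of half-side [s] in [[1, 2]] turns boundary
   integrals into an area integral. *)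
Lemma square_average (G : C -> R) (c : R) : (forall z, ccontR G z) -> (forall z, (0 <= G z)%coqR) ->
  (0 <= c)%coqR ->
  (forall s, (1 <= s <= 2)%coqR -> (c <=
     RInt (fun x => G (x, - s)%coqR) (-2) 2 + RInt (fun x => G (x, s)) (-2) 2
   + RInt (fun y => G (- s, y)%coqR) (-2) 2 + RInt (fun y => G (s, y)) (-2) 2)%coqR) ->
  forall J, J = (\int[areaA]_(z in side `*` side) (G z)%:E)%E -> (c%:E <= J + J + J + J)%E.
Proof.
move=> HG G0 c0 Hc J HJ.
have mside : measurable side by exact: measurable_itv.
have mring : measurable ring_radii by exact: measurable_itv.
have mQ : measurable (side `*` side) by exact: measurableX.
pose g (z : plane) : rT := G z * \1_(side `*` side) z.
have mg : measurable_fun setT g.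
  apply: measurable_funM; first exact: measurable_ccontR.
  exact: measurable_indic.
have g0 z : (0%R <= (g z)%:E)%E.
  rewrite lee_fin /g indicE; case: (_ \in _); rewrite ?mulr1 ?mulr0 //; exact/RleP.
have mEg : measurable_fun setT (fun z => (g z)%:E) by exact/measurable_EFinP.
have EJ : J = (\int[areaA]_z (g z)%:E)%E.
  rewrite HJ integral_mkcond; apply: eq_integral => z _.
  by rewrite patchE /g indicE; case: ifPn => _; rewrite ?mulr1 ?mulr0.
pose Hx (y : line) := (\int[leb]_x (g (x, y))%:E)%E.
pose Hy (x : line) := (\int[leb]_y (g (x, y))%:E)%E.
have mHx : measurable_fun setT Hx := @measurable_fun_fubini_tonelli_G _ _ line line (R : realType) leb _ mEg g0.
have mHy : measurable_fun setT Hy := @measurable_fun_fubini_tonelli_F _ _ line line (R : realType) leb _ mEg g0.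
have Hx0 y : (0%R <= Hx y)%E by apply: integral_ge0 => x _; exact: g0.
have Hy0 x : (0%R <= Hy x)%E by apply: integral_ge0 => y _; exact: g0.
have IHx : (\int[leb]_y Hx y = J)%E.
  by rewrite EJ /areaA (@fubini_tonelli2 _ _ line line (R : realType) leb leb _ mEg g0).
have IHy : (\int[leb]_x Hy x = J)%E.
  by rewrite EJ /areaA (@fubini_tonelli1 _ _ line line (R : realType) leb leb _ mEg g0).
have HxE y : side y -> Hx y = (RInt (fun x => G (x, y)) (-2) 2)%:E.
  move=> sy; rewrite -(integral_side (u := fun x => G (x, y))); last by move=> x; exact: Rcont_slice_x.
  rewrite -integral_indicM; apply: eq_integral => x _; rewrite /g !indicE in_setX.
  by rewrite (mem_set sy) andbT.
have HyE x : side x -> Hy x = (RInt (fun y => G (x, y)) (-2) 2)%:E.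
  move=> sx; rewrite -(integral_side (u := fun y => G (x, y))); last by move=> y; exact: Rcont_slice_y.
  rewrite -integral_indicM; apply: eq_integral => y _; rewrite /g !indicE in_setX.
  by rewrite (mem_set sx).
have mN : measurable_fun setT (-%R : line -> line) by exact: oppr_measurable.
have mHxN : measurable_fun setT (fun s : line => Hx (- s)%R) by exact: (measurableT_comp mHx mN).
have mHyN : measurable_fun setT (fun s : line => Hy (- s)%R) by exact: (measurableT_comp mHy mN).
(* As [s] runs over [[1, 2]], each of the four widened sides sweeps only a part of the square, so
   its contribution is at most [J]; the sides at [- s] are brought to this form by reflection. *)
have le_J (h : line -> \bar rT) : measurable_fun setT h -> (forall y, 0%R <= h y)%E ->
    (\int[leb]_y h y = J)%E -> (\int[leb]_(y in ring_radii) h y <= J)%E.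
  by move=> mh h0 <-; apply: ge0_subset_integral.
have -> : (c%:E = \int[leb]_(s in ring_radii) c%:E)%E.
  rewrite integral_cst //; transitivity (c%:E * 1)%E; first by rewrite mule1.
  by congr (_ * _)%E; exact/esym/lebesgue_ring_radii.
apply: (@le_trans _ _ (\int[leb]_(s in ring_radii) (Hx (- s)%R + Hx s + Hy (- s)%R + Hy s))%E).
  apply: ge0_le_integral => //.
  - by move=> s _; rewrite lee_fin; exact/RleP.
  - apply: (@measurable_funS _ _ _ _ setT) => //.
    by apply: emeasurable_funD => //; apply: emeasurable_funD => //; apply: emeasurable_funD.
  - move=> s /ring_radiiP Hs.
    have sN : side (- s)%R by apply/sideP; change (-2 <= - s <= 2)%coqR; lra.
    have sP : side s by apply/sideP; lra.
    rewrite !HxE // !HyE // -!EFinD lee_fin; apply/RleP; exact: Hc.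
have mr (h : line -> \bar rT) : measurable_fun setT h -> measurable_fun ring_radii h.
  by move=> mh; apply: (@measurable_funS _ _ _ _ setT).
rewrite ge0_integralD //; last 3 first.
- by move=> s _; do 2!apply: adde_ge0 => //.
- by apply: mr; do 2!apply: emeasurable_funD => //.
- exact: mr.
rewrite ge0_integralD //; last 3 first.
- by move=> s _; apply: adde_ge0.
- by apply: mr; apply: emeasurable_funD.
- exact: mr.
rewrite ge0_integralD //; last 2 first.
- exact: mr.
- exact: mr.
apply: leeD; [apply: leeD; [apply: leeD|]|].
- exact: (le_J (fun s : line => Hx (- s)%R) mHxN (fun y => Hx0 _) (etrans (esym (reflect_lebesgue mHx Hx0)) IHx)).
- exact: (le_J Hx mHx Hx0 IHx).
- exact: (le_J (fun s : line => Hy (- s)%R) mHyN (fun y => Hy0 _) (etrans (esym (reflect_lebesgue mHy Hy0)) IHy)).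
- exact: (le_J Hy mHy Hy0 IHy).
Qed.

(** * Fock norms *)

Lemma pw_mult p a b : (0 < a)%coqR -> pw p (a * b)%coqR = (pw p a * pw p b)%coqR.
Proof.
move=> a0; case: (Rle_lt_dec b 0) => b0.
  by rewrite (pw_neg p b0) pw_neg ?Rmult_0_r //; nra.
rewrite !pw_pos //; last exact: Rmult_lt_0_compat.
by rewrite ln_mult // -exp_plus; congr (Rtrigo_def.exp _); ring.
Qed.

(** Takes the place of Hölder's inequality: if the integral of [a^p] is at most [N^p], then the
    second term integrates to at most [N]. *)
Lemma le_add_pw p a N : (1 <= p)%coqR -> (0 <= a)%coqR -> (0 < N)%coqR ->
  (a <= N + N / pw p N * pw p a)%coqR.
Proof.
move=> p1 a0 N0; have := pw_young p1 a0 N0.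
have P0 : (0 < pw p N)%coqR by rewrite pw_pos //; exact: exp_pos.
set P := pw p N in P0 *; set A := pw p a => H.
have A0 : (0 <= A)%coqR by exact: pw_ge0.
have E : (N / P * A * P = N * A)%coqR by field; lra.
apply: (Rmult_le_reg_r P) => //.
have NA : (0 <= N * A)%coqR by apply: Rmult_le_pos; lra.
have NP : (0 < N * P)%coqR by apply: Rmult_lt_0_compat.
apply: (Rmult_le_reg_l p); first lra.
rewrite Rmult_plus_distr_r E; nra.
Qed.

Lemma areaA_square : areaA (side `*` side) = (16%:R)%:E.
Proof.
rewrite /areaA product_measure1E; try exact: measurable_itv.
transitivity (4%:R%:E * 4%:R%:E : \bar rT)%E; last by rewrite -EFinM -natrM.
by congr (_ * _)%E; exact: lebesgue_side.
Qed.

Definition weighted_integral (p : R) (f : C -> C) : \bar rT := (\int[areaA]_z (pw p (gmod f z))%:E)%E.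

(** Over the square of area [16] around [z], the bound [phi <= N + N^(1 - p) phi^p] integrates to at
    most [16 N + N], whence the [17]. The four sides of the averaged Cauchy inequality cancel its
    factor [4]. *)
Lemma gmod_sup_bound p f N z : (1 <= p)%coqR -> entire f -> (0 < N)%coqR ->
  (weighted_integral p f <= (pw p N)%:E)%E -> (gmod f z <= 17 * Rtrigo_def.exp 4 * N)%coqR.
Proof.
move=> p1 Hf N0 HI; have cf := entire_ccont Hf.
have cg w : ccontR (gmod f) w by exact: gmod_ccontR.
pose G (w : C) : R := gmod f ((w.1 + z.1)%coqR, (w.2 + z.2)%coqR).
have cG w : ccontR G w by exact: (@shift_ccontR (gmod f) z.1 z.2).
have G0 w : (0 <= G w)%coqR by exact: gmod_ge0.
have P0 : (0 < pw p N)%coqR by rewrite pw_pos //; exact: exp_pos.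
have e0 := exp_pos 4.
set J := (\int[areaA]_(w in side `*` side) (G w)%:E)%E.
have mQ : measurable (side `*` side) by apply: measurableX; exact: measurable_itv.
have JN : (J <= (17 * N)%coqR%:E)%E.
  pose k := (N / pw p N)%coqR.
  have k0 : (0 <= k)%coqR by apply: Rlt_le; exact: Rdiv_lt_0_compat.
  have cpG w : ccontR (fun w => pw p (G w)) w.
    by apply: (@ccontR_comp (pw p) G) => //; exact: pw_cont.
  have mpG := measurable_EFin_ccontR cpG.
  have mkpG : measurable_fun setT (fun w : plane => (k%:E * (pw p (G w))%:E)%E).
    by apply: emeasurable_funM => //; exact: measurable_cst.
  apply: (@le_trans _ _ (\int[areaA]_(w in side `*` side) (N%:E + k%:E * (pw p (G w))%:E))%E).
    apply: ge0_le_integral => //.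
    - by move=> w _; rewrite lee_fin; exact/RleP.
    - by apply: (@measurable_funS _ _ _ _ setT) => //; exact: measurable_EFin_ccontR.
    - apply: (@measurable_funS _ _ _ _ setT) => //.
      by apply: emeasurable_funD => //; exact: measurable_cst.
    - move=> w _; rewrite -EFinM -EFinD lee_fin; apply/RleP; exact: le_add_pw.
  have kG0 (w : plane) : (0%R <= k%:E * (pw p (G w))%:E)%E.
    by rewrite -EFinM lee_fin; apply/RleP; apply: Rmult_le_pos => //; exact: pw_ge0.
  rewrite ge0_integralD //; last 2 first.
  - by move=> w _; rewrite lee_fin; exact/RleP/Rlt_le.
  - by apply: (@measurable_funS _ _ _ _ setT).
  have -> : ((17 * N)%coqR%:E = N%:E * (16%:R)%:E + N%:E)%E.
    rewrite -EFinM -EFinD; congr EFin; rewrite -INRE.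
    change (17 * N = N * INR 16 + N)%coqR; rewrite /=; ring.
  apply: leeD.
    by rewrite integral_cst // -areaA_square.
  apply: (@le_trans _ _ (\int[areaA]_w (k%:E * (pw p (G w))%:E))%E).
    by apply: ge0_subset_integral.
  rewrite ge0_integralZl_EFin //; last 2 first.
  - by move=> w _; rewrite lee_fin; apply/RleP; exact: pw_ge0.
  - exact/RleP.
  have cpg w : ccontR (fun w => pw p (gmod f w)) w by exact: pw_gmod_ccontR.
  rewrite -(@shift_areaA z.1 z.2 (fun w => pw p (gmod f w)) cpg (fun w => pw_ge0 _ _)).
  apply: (@le_trans _ _ (k%:E * (pw p N)%:E)%E).
    by apply: lee_wpmul2l => //; rewrite lee_fin; exact/RleP.
  rewrite -EFinM lee_fin; apply/RleP; apply: Req_le.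
  by rewrite /k; change (N / pw p N * pw p N = N)%coqR; field; lra.
pose c := (4 * gmod f z / Rtrigo_def.exp 4)%coqR.
have c0 : (0 <= c)%coqR.
  by apply: Rmult_le_pos; [have := gmod_ge0 f z; lra|apply: Rlt_le; exact: Rinv_0_lt_compat].
have : (c%:E <= J + J + J + J)%E.
  apply: (@square_average G c) => // s Hs.
  have := gmod_cauchy z Hf Hs.
  have rex (u : R -> R) a b : (forall t, Rcont u t) -> ex_RInt u a b by exact: Rcont_ex_RInt.
  have sh (u : R -> R) a : (forall t, Rcont u t) ->
      RInt u (a - 2) (a + 2) = RInt (fun x => u (x + a))%coqR (-2) 2.
    move=> Hu; have E := @RInt_comp_lin R_CompleteNormedModule u 1%coqR a (-2)%coqR 2%coqR (rex u (1 * -2 + a)%coqR (1 * 2 + a)%coqR Hu).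
    rewrite (_ : a - 2 = 1 * -2 + a)%coqR; last ring.
    rewrite (_ : a + 2 = 1 * 2 + a)%coqR; last ring.
    rewrite -E; apply: RInt_ext => t _; rewrite Rmult_1_l.
    exact: (@scal_one R_Ring R_ModuleSpace).
  rewrite (sh (fun x => gmod f (x, z.2 - s)%coqR)); last by move=> t; exact: Rcont_slice_x.
  rewrite (sh (fun x => gmod f (x, z.2 + s)%coqR)); last by move=> t; exact: Rcont_slice_x.
  rewrite (sh (fun y => gmod f (z.1 - s, y)%coqR)); last by move=> t; exact: Rcont_slice_y.
  rewrite (sh (fun y => gmod f (z.1 + s, y)%coqR)); last by move=> t; exact: Rcont_slice_y.
  rewrite /G /=.
  rewrite (_ : z.2 - s = - s + z.2)%coqR; last ring.
  rewrite (_ : z.1 - s = - s + z.1)%coqR; last ring.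
  rewrite (_ : z.2 + s = s + z.2)%coqR; last ring.
  rewrite (_ : z.1 + s = s + z.1)%coqR; last ring.
  set S := (_ + _ + _ + _)%coqR => H.
  apply: (Rmult_le_reg_l (Rtrigo_def.exp 4)) => //.
  by rewrite /c (_ : Rtrigo_def.exp 4 * (4 * gmod f z / Rtrigo_def.exp 4) = 4 * gmod f z)%coqR; [|field; lra].
move=> Hc.
have : (c%:E <= (17 * N + 17 * N + 17 * N + 17 * N)%coqR%:E)%E.
  by apply: (le_trans Hc); rewrite !EFinD; apply: leeD => //; apply: leeD => //; apply: leeD.
rewrite lee_fin => /RleP Hc2.
have Ec : (4 * gmod f z = c * Rtrigo_def.exp 4)%coqR by rewrite /c; field; lra.
have := Rmult_le_compat_r _ _ _ (Rlt_le _ _ e0) Hc2; lra.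
Qed.

Lemma powR_expln (x a : rT) : (0 < x)%coqR -> powR x a = Rtrigo_def.exp (a * Rpower.ln x)%coqR.
Proof.
move=> x0; rewrite /powR (negbTE (_ : x != 0)); last by apply/eqP => E; rewrite E in x0; exact: Rlt_irrefl x0.
by rewrite RexpE RlnE.
Qed.

Lemma fock_weightE (p : R) f z : (1 <= p)%coqR ->
  (@powR R (Cmod (f z)) p * Rtrigo_def.exp (- (p / 2) * (Cmod z) ^ 2)%coqR)%R = pw p (gmod f z).
Proof.
move=> p1; case: (Req_dec (Cmod (f z)) 0) => [E|n0].
  rewrite /gmod E Rmult_0_l pw_neg; last exact: Rle_refl.
  rewrite powR0 ?mul0r //; apply/eqP => E'; rewrite E' in p1.
  by change (1 <= 0)%coqR in p1; lra.
have c0 : (0 < Cmod (f z))%coqR by have := Cmod_ge_0 (f z); lra.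
rewrite powR_expln // pw_pos; last by apply: Rmult_lt_0_compat => //; exact: exp_pos.
rewrite /gmod ln_mult //; last exact: exp_pos.
rewrite ln_exp; change (Rtrigo_def.exp (p * Rpower.ln (Cmod (f z))) * Rtrigo_def.exp (- (p / 2) * Cmod z ^ 2) = Rtrigo_def.exp (p * (Rpower.ln (Cmod (f z)) + - Cmod z ^ 2 / 2)))%coqR.
by rewrite -exp_plus; congr (Rtrigo_def.exp _); field.
Qed.

Definition fock_const (p : rT) : rT := p / (2 * PI).

Lemma fock_const_gt0 (p : R) : (1 <= p)%coqR -> (0 < fock_const p)%coqR.
Proof.
move=> p1; apply/RltP; apply: divr_gt0; first by apply/RltP; change (0 < p)%coqR; lra.
by apply: mulr_gt0; [rewrite ltr0n|apply/RltP; exact: PI_RGT_0].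
Qed.

Lemma fock_normE (p : R) f : (1 <= p)%coqR ->
  fock_norm (Rbar.Finite p) f = (((fock_const p)%:E * weighted_integral p f) `^ (/ p)%coqR)%E.
Proof.
move=> p1; rewrite /fock_norm /weighted_integral; congr ((_ * _) `^ _)%E.
by apply: eq_integral => z _; rewrite fock_weightE.
Qed.

Lemma weighted_integral_ge0 p f : (0%R <= weighted_integral p f)%E.
Proof. by apply: integral_ge0 => z _; rewrite lee_fin; apply/RleP; exact: pw_ge0. Qed.

(** This is [(p / (2 pi))^(1 / p)], the ratio of the Fock norm to the unnormalised [L^p] norm of
    [phi]. *)
Definition fock_radius (p : R) : R := Rtrigo_def.exp (/ p * Rpower.ln (fock_const p))%coqR.

Lemma pw_radius (p n : R) : (1 <= p)%coqR -> (0 < n)%coqR ->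
  (fock_const p * pw p (n / fock_radius p) = pw p n)%coqR.
Proof.
move=> p1 n0; have c0 := fock_const_gt0 p1.
have r0 : (0 < fock_radius p)%coqR by exact: exp_pos.
rewrite !pw_pos //; last exact: Rdiv_lt_0_compat.
have -> : (Rpower.ln (n / fock_radius p) = Rpower.ln n - / p * Rpower.ln (fock_const p))%coqR.
  rewrite /Rdiv Rpower.ln_mult //; last exact: Rinv_0_lt_compat.
  by rewrite Rpower.ln_Rinv // /fock_radius ln_exp.
rewrite -{1}(exp_ln (fock_const p)) // -exp_plus.
by congr (Rtrigo_def.exp _); field; lra.
Qed.

(** The gateway for all estimates with finite exponents. Stating bounds by a positive real [n],
    instead of computing norms, makes powers exponentials of logarithms and excludes infinite
    values. *)
Lemma fock_norm_le (p n : R) f : (1 <= p)%coqR -> (0 < n)%coqR ->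
  (fock_norm (Rbar.Finite p) f <= n%:E)%E <->
  (weighted_integral p f <= (pw p (n / fock_radius p)%coqR)%:E)%E.
Proof.
move=> p1 n0; rewrite fock_normE //; have c0 := fock_const_gt0 p1.
have := weighted_integral_ge0 p f; have HE := pw_radius p1 n0.
have ip : (0 < / p)%coqR by apply: Rinv_0_lt_compat; lra.
have ipn : ((/ p)%coqR : rT) != 0 by apply/eqP => E; rewrite E in ip; exact: Rlt_irrefl ip.
set X := pw p (n / _)%coqR in HE *.
have X0 : (0 <= X)%coqR by exact: pw_ge0.
case: (weighted_integral p f) => [r| |] //; last first.
  move=> _; rewrite gt0_muley ?lte_fin; last exact/RltP.
  by rewrite poweRyr.
rewrite lee_fin => /RleP r0.
rewrite -EFinM poweR_EFin !lee_fin.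
case: (Req_dec r 0) => [->|rn0].
  rewrite mulr0 powR0 //; split=> _; apply/RleP => //; exact: Rlt_le.
have rp : (0 < r)%coqR by change (0 <= r)%coqR in r0; lra.
have crp : (0 < fock_const p * r)%coqR by apply: Rmult_lt_0_compat.
rewrite powR_expln //.
have Hn : pw p n = Rtrigo_def.exp (p * Rpower.ln n) by rewrite pw_pos.
have Hcr : (fock_const p * r = Rtrigo_def.exp (p * (/ p * Rpower.ln (fock_const p * r))))%coqR.
  by rewrite -[LHS]exp_ln //; congr (Rtrigo_def.exp _); field; lra.
split=> /RleP H; apply/RleP.
- apply: (Rmult_le_reg_l (fock_const p)) => //; rewrite HE Hn Hcr; apply: exp_le.
  apply: Rmult_le_compat_l; first lra.
  by rewrite -[X in (X <= _)%coqR]ln_exp; apply: ln_le => //; exact: exp_pos.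
- rewrite -[X in (_ <= X)%coqR](exp_ln n) //; apply: exp_le.
  have := Rmult_le_compat_l _ _ _ (Rlt_le _ _ c0) H; rewrite HE Hn Hcr => /ln_le.
  rewrite !ln_exp => /(_ (exp_pos _)) H2.
  by apply: (Rmult_le_reg_l p) => //; lra.
Qed.

Lemma fock_norm_infty_le (n : R) f :
  (fock_norm p_infty f <= n%:E)%E <-> (forall z, (gmod f z <= n)%coqR).
Proof.
split=> [H z|H].
  have : ((gmod f z : rT)%:E <= n%:E)%E.
    by apply: le_trans H; apply: ereal_sup_ubound; exists z.
  by rewrite lee_fin => /RleP.
by apply: ge_ereal_sup => _ [z _ <-]; rewrite lee_fin; apply/RleP; exact: H.
Qed.

Lemma fock_norm_ge0 p f : (0%R <= fock_norm p f)%E.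
Proof.
case: p => [p| |] //=; first exact: poweR_ge0.
apply: (@le_trans _ _ (gmod f (RtoC 0) : rT)%:E).
  by rewrite lee_fin; apply/RleP; exact: gmod_ge0.
by apply: ereal_sup_ubound; exists (RtoC 0).
Qed.

Lemma pw_interp p q a m : (1 <= p)%coqR -> (p <= q)%coqR -> (0 < m)%coqR -> (a <= m)%coqR ->
  (pw q a <= Rtrigo_def.exp ((q - p) * Rpower.ln m) * pw p a)%coqR.
Proof.
move=> p1 pq m0 am; case: (Rle_lt_dec a 0) => a0.
  by rewrite !pw_neg // Rmult_0_r; exact: Rle_refl.
rewrite !pw_pos // -exp_plus; apply: exp_le.
have := ln_le _ _ a0 am; have : (0 <= q - p)%coqR by lra.
by move=> h1 h2; have := Rmult_le_compat_l _ _ _ h1 h2; lra.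
Qed.

(** When [phi <= m], [phi^q <= m^(q - p) phi^p], and [m^(q - p) m^p = m^q]. Combined with the
    pointwise bound, this embeds [F_p] in [F_q]. *)
Lemma weighted_integral_interp p q m f : (1 <= p)%coqR -> (p <= q)%coqR -> (0 < m)%coqR -> ccont f ->
  (forall z, (gmod f z <= m)%coqR) -> (weighted_integral p f <= (pw p m)%:E)%E ->
  (weighted_integral q f <= (pw q m)%:E)%E.
Proof.
move=> p1 pq m0 cf Hm HI; pose k := Rtrigo_def.exp ((q - p) * Rpower.ln m)%coqR.
have k0 : (0 < k)%coqR by exact: exp_pos.
have mp : measurable_fun setT (fun z : plane => (pw p (gmod f z))%:E).
  by apply: measurable_EFin_ccontR => z; exact: pw_gmod_ccontR.
have p0 (z : plane) : (0%R <= (pw p (gmod f z))%:E)%E by rewrite lee_fin; apply/RleP; exact: pw_ge0.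
apply: (@le_trans _ _ (\int[areaA]_z (k%:E * (pw p (gmod f z))%:E))%E).
  apply: ge0_le_integral => //.
  - by move=> z _; rewrite lee_fin; apply/RleP; exact: pw_ge0.
  - by apply: measurable_EFin_ccontR => z; apply: pw_gmod_ccontR => //; lra.
  - by apply: emeasurable_funM => //; exact: measurable_cst.
  - by move=> z _; rewrite -EFinM lee_fin; apply/RleP; exact: pw_interp.
rewrite ge0_integralZl_EFin //; last exact/RleP/Rlt_le.
apply: (@le_trans _ _ (k%:E * (pw p m)%:E)%E).
  by apply: lee_wpmul2l => //; rewrite lee_fin; exact/RleP/Rlt_le.
rewrite -EFinM lee_fin; apply/RleP; apply: Req_le.
change (k * pw p m = pw q m)%coqR; rewrite !pw_pos // /k -exp_plus; congr (Rtrigo_def.exp _); ring.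
Qed.

Lemma weighted_integral_le_pw p m m' f : (1 <= p)%coqR -> (m <= m')%coqR ->
  (weighted_integral p f <= (pw p m)%:E)%E -> (weighted_integral p f <= (pw p m')%:E)%E.
Proof.
move=> p1 mm H; apply: (le_trans H); rewrite lee_fin; apply/RleP; apply: pw_le => //; lra.
Qed.

(** * Operator bounds and the essential norm *)

Definition op_bounded_by (p q : Rbar) (M : R) (T : op) : Prop :=
  forall f, fock p f -> forall n, (0 < n)%coqR -> (fock_norm p f <= n%:E)%E ->
    (fock_norm q (T f) <= (M * n)%coqR%:E)%E.

Lemma sq_int_bounded_by (p q : Rbar) : Rbar_le (Rbar.Finite 1%coqR) p -> Rbar_le p q ->
  exists M, (0 < M)%coqR /\ op_bounded_by p q M sq_int.
Proof.
have e4 : (1 < Rtrigo_def.exp 4)%coqR by rewrite -exp_0; apply: exp_increasing; lra.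
(* The pointwise constant. Being at least [1], it allows the same number [K N] to bound both [phi]
   and its [L^p] norm, as the interpolation requires. *)
set K := (17 * Rtrigo_def.exp 4)%coqR; have K1 : (1 <= K)%coqR by rewrite /K; lra.
have fin p' : (1 <= p')%coqR -> forall f, entire f -> forall n, (0 < n)%coqR ->
    (fock_norm (Rbar.Finite p') f <= n%:E)%E ->
    (0 < n / fock_radius p')%coqR /\
    (weighted_integral p' (sq_int f) <= (pw p' (n / fock_radius p')%coqR)%:E)%E /\
    forall z, (gmod (sq_int f) z <= K * (n / fock_radius p'))%coqR.
  move=> p1 f Hf n n0 /fock_norm_le => /(_ p1 n0) HI.
  have N0 : (0 < n / fock_radius p')%coqR by apply: Rdiv_lt_0_compat => //; exact: exp_pos.
  have HU := le_trans (integral_pw_sq_int p1 Hf) HI.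
  split=> //; split=> // z.
  by apply: (gmod_sup_bound z p1 (sq_int_entire Hf) N0 HU).
case: p => [p| |] //= p1; case: q => [q| |] //= pq.
- have rp : (0 < fock_radius p)%coqR by exact: exp_pos.
  have rq : (0 < fock_radius q)%coqR by exact: exp_pos.
  exists (fock_radius q * K / fock_radius p)%coqR; split.
    by apply: Rdiv_lt_0_compat => //; apply: Rmult_lt_0_compat => //; lra.
  move=> f [Hf _] n n0 /(fin p p1 f Hf n n0) [N0 [HI Hs]].
  set N := (n / fock_radius p)%coqR in N0 HI Hs.
  have KN0 : (0 < K * N)%coqR by apply: Rmult_lt_0_compat => //; lra.
  apply/fock_norm_le; first lra.
    apply: Rmult_lt_0_compat => //; apply: Rdiv_lt_0_compat => //; apply: Rmult_lt_0_compat => //; lra.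
  rewrite (_ : fock_radius q * K / fock_radius p * n / fock_radius q = K * N)%coqR; last first.
    by rewrite /N; field; lra.
  apply: (@weighted_integral_interp p) => //.
    exact: entire_ccont (sq_int_entire Hf).
  by apply: weighted_integral_le_pw HI => //; nra.
- have rp : (0 < fock_radius p)%coqR by exact: exp_pos.
  exists (K / fock_radius p)%coqR; split; first by apply: Rdiv_lt_0_compat => //; lra.
  move=> f [Hf _] n n0 /(fin p p1 f Hf n n0) [N0 [HI Hs]].
  apply/fock_norm_infty_le => z; apply: Rle_trans (Hs z) _; apply: Req_le; field; lra.
- exists 1%coqR; split; first lra.
  move=> f [Hf _] n n0 /fock_norm_infty_le Hs; apply/fock_norm_infty_le => z.
  rewrite Rmult_1_l; apply: gmod_sq_int_sup => //; exact: entire_ccont.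
Qed.

Lemma gmod_scal c f z : gmod (fun w => Cmult c (f w)) z = (Cmod c * gmod f z)%coqR.
Proof. by rewrite /gmod Cmod_mult Rmult_assoc. Qed.

Lemma fock_norm_scal q c f n : Rbar_le (Rbar.Finite 1%coqR) q -> c <> RtoC 0 -> ccont f ->
  (0 < n)%coqR -> (fock_norm q f <= n%:E)%E ->
  (fock_norm q (fun z => Cmult c (f z)) <= (Cmod c * n)%coqR%:E)%E.
Proof.
move=> q1 c0 cf n0; have mc : (0 < Cmod c)%coqR by apply/Cmod_gt_0.
have cn : (0 < Cmod c * n)%coqR by exact: Rmult_lt_0_compat.
case: q q1 => [q| |] //= q1; last first.
  move=> /fock_norm_infty_le H; apply/fock_norm_infty_le => z.
  by rewrite gmod_scal; apply: Rmult_le_compat_l; [lra|exact: H].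
move=> /(fock_norm_le f q1 n0) H; apply/(fock_norm_le _ q1 cn).
have rq : (0 < fock_radius q)%coqR by exact: exp_pos.
rewrite (_ : Cmod c * n / fock_radius q = Cmod c * (n / fock_radius q))%coqR; last by field; lra.
rewrite pw_mult //.
have -> : weighted_integral q (fun z => Cmult c (f z)) = ((pw q (Cmod c))%:E * weighted_integral q f)%E.
  rewrite /weighted_integral -ge0_integralZl_EFin //.
  - by apply: eq_integral => z _; rewrite gmod_scal pw_mult.
  - by move=> z _; rewrite lee_fin; apply/RleP; exact: pw_ge0.
  - by apply: measurable_EFin_ccontR => z; exact: pw_gmod_ccontR.
  - by apply/RleP; exact: pw_ge0.
rewrite (EFinM (pw q (Cmod c)) _); apply: lee_wpmul2l => //.
by rewrite lee_fin; apply/RleP; exact: pw_ge0.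
Qed.

Lemma fock_norm_real p f : fock p f -> exists2 x : R, (0 <= x)%coqR & fock_norm p f = x%:E.
Proof.
case=> _; have := fock_norm_ge0 p f; case: (fock_norm p f) => [x| |] //.
by rewrite lee_fin => /RleP x0 _; exists x.
Qed.

(** [op_bounded_by] speaks of positive bounds only, while the norm of [f] may be zero; a slack
    [e / M] is added to the norm and then sent to zero. *)
Lemma op_bounded_by_le p q M T f : (0 < M)%coqR -> op_bounded_by p q M T -> fock p f ->
  (fock_norm q (T f) <= M%:E * fock_norm p f)%E.
Proof.
move=> M0 HT Hf; have [x x0 Ex] := fock_norm_real Hf.
rewrite Ex -EFinM; apply/lee_addgt0Pr => e /RltP e0.
have d0 : (0 < e / M)%coqR by exact: Rdiv_lt_0_compat.
have := HT f Hf (x + e / M)%coqR.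
rewrite Ex => /(_ _ _) H; apply: le_trans (H _ _) _; first lra.
  by rewrite lee_fin; apply/RleP; change (x <= x + e / M)%coqR; lra.
rewrite -EFinD lee_fin; apply/RleP; apply: Req_le.
by change (M * (x + e / M) = M * x + e)%coqR; field; lra.
Qed.

Lemma le_op_bounded_by p q M T : (0 <= M)%coqR ->
  (forall f, fock p f -> (fock_norm q (T f) <= M%:E * fock_norm p f)%E) -> op_bounded_by p q M T.
Proof.
move=> M0 H f Hf n n0 Hn; apply: le_trans (H f Hf) _.
rewrite (EFinM M n); apply: lee_wpmul2l => //; rewrite lee_fin; exact/RleP.
Qed.

Lemma op_bounded_by_fin p q M T f : op_bounded_by p q M T -> fock p f -> (fock_norm q (T f) < +oo)%E.
Proof.
move=> HT Hf; have [x x0 Ex] := fock_norm_real Hf.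
have := HT f Hf (x + 1)%coqR; rewrite Ex => /(_ _ _) H.
apply: le_lt_trans (H _ _) (ltry _); first lra.
by rewrite lee_fin; apply/RleP; change (x <= x + 1)%coqR; lra.
Qed.

Lemma op_bounded_by_scal p q M T c : Rbar_le (Rbar.Finite 1%coqR) q -> c <> RtoC 0 -> (0 < M)%coqR ->
  (forall f, fock p f -> entire (T f)) ->
  op_bounded_by p q M T -> op_bounded_by p q (Cmod c * M) (fun f z => Cmult c (T f z)).
Proof.
move=> q1 c0 M0 HE HT f Hf n n0 Hn.
rewrite (_ : Cmod c * M * n = Cmod c * (M * n))%coqR; last ring.
apply: fock_norm_scal => //; first exact: entire_ccont (HE f Hf).
- exact: Rmult_lt_0_compat.
- exact: HT.
Qed.

Lemma fock_norm_zero q : Rbar_le (Rbar.Finite 1%coqR) q -> fock_norm q (fun _ => RtoC 0) = 0%E.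
Proof.
have g0 z : gmod (fun _ => RtoC 0) z = 0%coqR by rewrite /gmod Cmod_0 Rmult_0_l.
case: q => [q| |] // q1.
  have iq : ((/ q)%coqR : rT) != 0.
    have ip : (0 < / q)%coqR by apply: Rinv_0_lt_compat; change (1 <= q)%coqR in q1; lra.
    by apply/eqP => E; rewrite E in ip; exact: Rlt_irrefl ip.
  rewrite fock_normE // /weighted_integral (_ : (\int[areaA]_z _)%E = 0%E); last first.
    by apply: integral0_eq => z _; rewrite g0 pw_neg //; exact: Rle_refl.
  by rewrite mule0 poweR0r.
apply/eqP; rewrite eq_le fock_norm_ge0 andbT; apply/fock_norm_infty_le => z.
by rewrite g0; exact: Rle_refl.
Qed.

Lemma zero_compact p q : Rbar_le (Rbar.Finite 1%coqR) q -> compact_op p q (fun _ _ => RtoC 0).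
Proof.
move=> q1; have E0 : entire (fun _ => RtoC 0).
  by move=> z; eexists; apply/is_derive_cdiff; exact: cdiff_const.
have F0 : fock q (fun _ => RtoC 0) by split=> //; rewrite fock_norm_zero.
split.
  split; first by move=> f h a b _ _; apply/funext => z; rewrite !Cmult_0_r Cplus_0_l.
  split=> //; exists 0%R => f _; by rewrite fock_norm_zero // mul0e.
move=> u _; exists id, (fun _ => RtoC 0); split=> //; split=> //.
rewrite (_ : (fun n => _) = (fun _ => 0%E)); first exact: cvg_cst.
apply/funext => n; rewrite -[RHS](fock_norm_zero q1); congr fock_norm.
by apply/funext => z; rewrite /Cminus Cplus_opp_r.
Qed.

(** The difference of [S1] and [S2] is identified on the Fock space only, since operators are
    defined on all functions and nothing controls them elsewhere. *)
Lemma ess_norm_lt p q T c M r : Rbar_le (Rbar.Finite 1%coqR) q -> (0 < r)%coqR ->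
  op_bounded_by p q M (fun f z => Cmult c (T f z)) -> (M < r)%coqR ->
  forall S1 S2, (forall f, fock p f -> op_sub S1 S2 f = fun z => Cmult c (T f z)) ->
  (ess_norm p q (op_sub S1 S2) < r%:E)%E.
Proof.
move=> q1 r0 HT Mr S1 S2 HS; apply: (@le_lt_trans _ _ M%:E); last by rewrite lte_fin; exact/RltP.
apply: le_trans (ereal_inf_lbound _) _.
  by exists (fun _ _ => RtoC 0) => //; exact: zero_compact.
apply: ge_ereal_sup => _ [f [Hf Hn] <-].
have -> : op_sub (op_sub S1 S2) (fun _ _ => RtoC 0) f = fun z => Cmult c (T f z).
  by rewrite -(HS f Hf); apply/funext => z; rewrite {1}/op_sub /Cminus Copp_0 Cplus_0_r.
by have := HT f Hf 1%coqR Rlt_0_1 Hn; rewrite Rmult_1_r.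
Qed.

(** * Constants belong to the Fock spaces *)

Definition gauss (x : R) : R := Rtrigo_def.exp (- (x * x) / 2)%coqR.

Lemma gauss_cont x : Rcont gauss x.
Proof. by apply: (@Derive.ex_derive_continuous R_AbsRing R_NormedModule); rewrite /gauss; auto_derive. Qed.

Lemma gauss_ge0 x : (0 <= gauss x)%coqR.
Proof. exact/Rlt_le/exp_pos. Qed.

(** The normal density is a positive multiple of the Gaussian and has integral [1], which an
    infinite integral would contradict. *)
Lemma integral_gauss_lty : (\int[leb]_x (gauss x : rT)%:E < +oo)%E.
Proof.
have E := @integral_normal_pdf (R : realType) 0 1.
have k0 : (0 < normal_peak (1 : rT)) by apply: normal_peak_gt0; exact: oner_neq0.
have N x : normal_pdf (0 : rT) 1 x = normal_peak (1 : rT) * gauss x.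
  rewrite normal_pdfE ?oner_neq0 //; congr (_ * _).
  rewrite /normal_fun subr0 /gauss RexpE; congr expR.
  by rewrite expr1n expr2.
have : (\int[leb]_x ((normal_peak (1 : rT))%:E * (gauss x : rT)%:E) = 1)%E.
  by rewrite -E; apply: eq_integral => x _; rewrite N EFinM.
rewrite ge0_integralZl_EFin //; last 3 first.
- by move=> x _; rewrite lee_fin; apply/RleP; exact: gauss_ge0.
- by apply/measurable_EFinP; apply: measurable_Rcont; exact: gauss_cont.
- exact: ltW.
have : (0%R <= \int[leb]_x (gauss x : rT)%:E)%E.
  by apply: integral_ge0 => x _; rewrite lee_fin; apply/RleP; exact: gauss_ge0.
case: (\int[leb]_x _)%E => [y| |] //=; first by rewrite ltry.
by move=> _; rewrite gt0_muley ?lte_fin.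
Qed.

(** For [f = 1], [phi] is a product of two Gaussians with values in [(0, 1]]. Hence [phi^p <= phi],
    and the integral of [phi] is the square of the one-dimensional one. *)
Lemma fock_one p : Rbar_le (Rbar.Finite 1%coqR) p -> fock p (fun _ => RtoC 1).
Proof.
have g1 z : (gmod (fun _ => RtoC 1) z = gauss z.1 * gauss z.2)%coqR.
  rewrite /gmod Cmod_1 Rmult_1_l Cmod_sqr /gauss -exp_plus; congr (Rtrigo_def.exp _); field.
have gle1 x : (gauss x <= 1)%coqR.
  by rewrite /gauss -[X in (_ <= X)%coqR]exp_0; apply: exp_le; have := Rle_0_sqr x; rewrite /Rsqr; lra.
have le1 z : (gmod (fun _ => RtoC 1) z <= 1)%coqR.
  have := gle1 z.1; have := gle1 z.2; have := gauss_ge0 z.1; have := gauss_ge0 z.2.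
  by rewrite g1; nra.
have cont1 := @ccont_const (RtoC 1).
move=> p1; split; first by move=> z; eexists; apply/is_derive_cdiff; exact: cdiff_const.
case: p p1 => [p| |] // p1; last first.
  by apply: (@le_lt_trans _ _ (1 : rT)%:E); [apply/fock_norm_infty_le|exact: ltry].
change (1 <= p)%coqR in p1.
rewrite fock_normE //; apply: poweR_lty.
have fin : (weighted_integral p (fun _ => RtoC 1) < +oo)%E.
  apply: (@le_lt_trans _ _ (\int[areaA]_z (gmod (fun _ => RtoC 1) z : rT)%:E)%E).
    apply: ge0_le_integral => //.
    - by move=> z _; rewrite lee_fin; apply/RleP; exact: pw_ge0.
    - by apply: measurable_EFin_ccontR => z; exact: pw_gmod_ccontR.
    - by apply: measurable_EFin_ccontR => z; exact: gmod_ccontR.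
    - move=> z _; rewrite lee_fin; apply/RleP.
      have a0 : (0 < gmod (fun _ => RtoC 1) z)%coqR.
        by rewrite g1; apply: Rmult_lt_0_compat; exact: exp_pos.
      rewrite pw_pos // -[X in (_ <= X)%coqR]exp_ln //; apply: exp_le.
      have : (Rpower.ln (gmod (fun _ => RtoC 1) z) <= 0)%coqR.
        by rewrite -Rpower.ln_1; apply: ln_le.
      by nra.
  have cg z : ccontR (gmod (fun _ => RtoC 1)) z by exact: gmod_ccontR.
  have [-> _] := integral_areaA cg (fun z => gmod_ge0 _ z).
  have mg : measurable_fun setT (fun x : line => (gauss x : rT)%:E).
    by apply/measurable_EFinP; apply: measurable_Rcont; exact: gauss_cont.
  have gp (x : line) : (0%R <= (gauss x : rT)%:E)%E by rewrite lee_fin; apply/RleP; exact: gauss_ge0.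
  have := integral_gauss_lty.
  have : (0%R <= \int[leb]_x (gauss x : rT)%:E)%E by apply: integral_ge0 => x _; exact: gp.
  set I := (\int[leb]_x (gauss x : rT)%:E)%E => I0 IF.
  rewrite (_ : (\int[leb]_x _)%E = (I * I)%E); last first.
    transitivity (\int[leb]_x (I * (gauss x : rT)%:E))%E; last first.
      by rewrite ge0_integralZl.
    apply: eq_integral => x _.
    transitivity (\int[leb]_y ((gauss x : rT)%:E * (gauss y : rT)%:E))%E.
      by apply: eq_integral => y _; rewrite g1 EFinM.
    rewrite ge0_integralZl_EFin //; first by rewrite muleC.
    by apply/RleP; exact: gauss_ge0.
  move: IF I0; case: (I) => [y| |] // _ _; exact: ltry.
move: fin (weighted_integral_ge0 p (fun _ => RtoC 1)).
by case: (weighted_integral _ _) => [y| |] // _ _; exact: ltry.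
Qed.

(** * Scaling the symbol and the two cases *)

Lemma cderiv_scal c g z : entire g -> cderiv (fun w => Cmult c (g w)) z = Cmult c (cderiv g z).
Proof.
move=> Hg; have [l Hl] := entire_cdiff Hg z.
rewrite (cderivE Hl); apply: cderivE.
have := cdiff_mult (@cdiff_const c z) Hl.
by rewrite (_ : Cplus (Cmult (RtoC 0) (g z)) (Cmult c l) = Cmult c l) //; ring.
Qed.

(** [RInt] selects a value from the predicate [is_RInt]. If neither integral exists, both predicates
    are empty, hence equal by extensionality, and so are the default values selected. *)
Lemma RInt_junk (V : Hierarchy.CompleteNormedModule.type R_AbsRing) (u v : R -> V) a b :
  ~ ex_RInt u a b -> ~ ex_RInt v a b -> RInt u a b = RInt v a b.
Proof.
move=> Hu Hv.
have E : is_RInt u a b = is_RInt v a b.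
  apply/funext => l; apply/propext.
  by split=> H; exfalso; [apply: Hu|apply: Hv]; exists l.
exact: (f_equal (fun P : V -> Prop => Hierarchy.iota P) E).
Qed.

Lemma ex_CInt_scal (u : R -> C) a b c : c <> RtoC 0 ->
  ~ @ex_RInt C_R_NormedModule u a b -> ~ @ex_RInt C_R_NormedModule (fun t => Cmult c (u t)) a b.
Proof.
move=> c0 Hu [l Hl]; apply: Hu; exists (Cmult (Cinv c) l).
apply: (@is_RInt_ext C_R_NormedModule (fun t => Cmult (Cinv c) (Cmult c (u t)))) => [t _|].
  by rewrite Cmult_assoc Cinv_l // Cmult_1_l.
exact: is_CInt_Cmult.
Qed.

(* No continuity of [g'] is available here, so the integrand may fail to be integrable;
   by additivity the junk value [J] that [RInt] then takes satisfies [J = 2 J], hence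
   vanishes. *)
Lemma Volterra_scal g c F : entire g -> c <> RtoC 0 ->
  Volterra g (fun z => Cmult (RtoC 2) (F z)) = (fun z => Cmult (RtoC 2) (Volterra g F z)) ->
  Volterra (fun z => Cmult c (g z)) F = fun z => Cmult c (Volterra g F z).
Proof.
move=> Hg c0 H2; apply/funext => z; rewrite /Volterra.
pose u (t : R) : C := Cmult (Cmult (F (Cmult (RtoC t) z)) (cderiv g (Cmult (RtoC t) z))) z.
have -> : (fun t : R => Cmult (Cmult (F (Cmult (RtoC t) z)) (cderiv (fun w => Cmult c (g w)) (Cmult (RtoC t) z))) z)
   = (fun t => Cmult c (u t)).
  by apply/funext => t; rewrite cderiv_scal // /u; ring.
rewrite -/u.
case: (Classical_Prop.classic (@ex_RInt C_R_NormedModule u 0%coqR 1%coqR)) => [[l Hl]|Hu].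
  by rewrite (CInt_unique Hl); apply: CInt_unique; exact: is_CInt_Cmult.
have two0 : RtoC 2 <> RtoC 0 by move=> [] E; lra.
rewrite (@RInt_junk C_R_CompleteNormedModule _ _ _ _ (ex_CInt_scal c0 Hu) Hu).
have := f_equal (fun h => h z) H2; rewrite /Volterra -/u.
have -> : (fun t : R => Cmult (Cmult (Cmult (RtoC 2) (F (Cmult (RtoC t) z))) (cderiv g (Cmult (RtoC t) z))) z)
   = (fun t => Cmult (RtoC 2) (u t)).
  by apply/funext => t; rewrite /u; ring.
rewrite (@RInt_junk C_R_CompleteNormedModule _ _ _ _ (ex_CInt_scal two0 Hu) Hu).
have E2 : RtoC 2 = Cplus (RtoC 1) (RtoC 1) by rewrite -RtoC_plus; congr RtoC; lra.
have zero (K : C) : K = Cmult (RtoC 2) K -> K = RtoC 0.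
  move=> E; transitivity (Cminus (Cmult (RtoC 2) K) K); first by rewrite E2; ring.
  by rewrite -E; ring.
by move=> /zero ->; rewrite Cmult_0_r.
Qed.

Lemma in_V_of_bounded_by (p q : Rbar) (g : C -> C) (M : R) : entire g ->
  linear_on p (Volterra g) -> (forall f, fock p f -> entire (Volterra g f)) -> (0 < M)%coqR ->
  op_bounded_by p q M (Volterra g) -> in_V p q g.
Proof.
move=> Hg HL HE M0 HM; split=> //; split=> //; split.
- by move=> f Hf; split; [exact: HE|exact: (op_bounded_by_fin HM)].
- by exists M => f Hf; exact: op_bounded_by_le.
Qed.

Lemma entire_lincomb f h a b : entire f -> entire h ->
  entire (fun z => Cplus (Cmult a (f z)) (Cmult b (h z))).
Proof.
move=> Hf Hh z; have [l Hl] := entire_cdiff Hf z; have [m Hm] := entire_cdiff Hh z.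
eexists; apply/is_derive_cdiff.
by apply: cdiff_plus; apply: cdiff_mult; eauto; exact: cdiff_const.
Qed.

Lemma nearby_of_nonzero p q g r f0 z0 : Rbar_le (Rbar.Finite 1%coqR) q -> in_V p q g -> (0 < r)%coqR ->
  fock p f0 -> Volterra g f0 z0 <> RtoC 0 ->
  exists g1 : C -> C,
    in_V p q g1 /\
    (exists f : C -> C, fock p f /\ Volterra g1 f <> Volterra g f) /\
    (ess_norm p q (op_sub (Volterra g) (Volterra g1)) < r%:E)%E.
Proof.
move=> q1 [Hg [HL [HF [M0 HM0]]]] r0 Hf0 Hz0.
(* [M0] may be zero or negative; the maximum with [1] can be divided by. *)
set M := Rmax M0 1.
have M1 : (1 <= M)%coqR by exact: Rmax_r.
have HM : op_bounded_by p q M (Volterra g).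
  apply: le_op_bounded_by; first lra.
  move=> f Hf; apply: le_trans (HM0 f Hf) _; apply: lee_wpmul2r; first exact: fock_norm_ge0.
  by rewrite lee_fin; apply/RleP; exact: Rmax_l.
have HE f : fock p f -> entire (Volterra g f) by move=> /HF [].
(* The difference of the two operators is [e] times [V_g] up to sign, of norm at most
   [e M = r / 2]. *)
pose e := (r / (2 * M))%coqR.
have e0 : (0 < e)%coqR by apply: Rdiv_lt_0_compat; lra.
pose c := RtoC (1 + e).
have c0 : c <> RtoC 0 by move=> /RtoC_inj; lra.
have HV F : Volterra g (fun z => Cmult (RtoC 2) (F z)) = (fun z => Cmult (RtoC 2) (Volterra g F z)) ->
    Volterra (fun z => Cmult c (g z)) F = fun z => Cmult c (Volterra g F z).
  exact: Volterra_scal.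
(* A linear combination is treated without knowing that it lies in the Fock space: its homogeneity
   under the factor [2] is read off from linearity with the coefficients [2 a] and [2 b]. *)
have comb f h a b : fock p f -> fock p h ->
    Volterra (fun z => Cmult c (g z)) (fun z => Cplus (Cmult a (f z)) (Cmult b (h z)))
    = fun z => Cmult c (Cplus (Cmult a (Volterra g f z)) (Cmult b (Volterra g h z))).
  move=> Hf Hh; rewrite HV; first by rewrite HL.
  rewrite HL //.
  have -> : (fun z => Cmult (RtoC 2) (Cplus (Cmult a (f z)) (Cmult b (h z))))
     = (fun z => Cplus (Cmult (Cmult (RtoC 2) a) (f z)) (Cmult (Cmult (RtoC 2) b) (h z))).
    by apply/funext => z; ring.
  by rewrite HL //; apply/funext => z; ring.
have HVf f : fock p f -> Volterra (fun z => Cmult c (g z)) f = fun z => Cmult c (Volterra g f z).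
  move=> Hf; have E : (fun z => Cplus (Cmult (RtoC 1) (f z)) (Cmult (RtoC 0) (f z))) = f.
    by apply/funext => z; ring.
  by have := comb f f (RtoC 1) (RtoC 0) Hf Hf; rewrite E => ->; apply/funext => z; ring.
have Hsc k : k <> RtoC 0 -> op_bounded_by p q (Cmod k * M) (fun f z => Cmult k (Volterra g f z)).
  by move=> k0; apply: op_bounded_by_scal => //; lra.
have mc : (0 < Cmod c)%coqR by apply/Cmod_gt_0.
exists (fun z => Cmult c (g z)); split; [|split].
- apply: (@in_V_of_bounded_by p q _ (Cmod c * M)%coqR).
  + by apply: entire_mult => // z; eexists; apply/is_derive_cdiff; exact: cdiff_const.
  + move=> f h a b Hf Hh; rewrite comb // HVf // HVf //; apply/funext => z; ring.
  + move=> f Hf; rewrite HVf //; apply: entire_mult; last exact: HE.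
    by move=> z; eexists; apply/is_derive_cdiff; exact: cdiff_const.
  + by apply: Rmult_lt_0_compat; lra.
  + by move=> f Hf; rewrite HVf //; exact: Hsc.
- exists f0; split=> //; rewrite HVf // => /(f_equal (fun h => h z0)) E.
  apply: Hz0; apply: Cmod_eq_0.
  have : Cmult (RtoC e) (Volterra g f0 z0) = RtoC 0.
    have -> : RtoC e = Cminus c (RtoC 1) by rewrite /c RtoC_plus; ring.
    transitivity (Cminus (Cmult c (Volterra g f0 z0)) (Volterra g f0 z0)); first by ring.
    by rewrite E; ring.
  move=> /(f_equal Cmod); rewrite Cmod_mult Cmod_0 Cmod_R Rabs_pos_eq; last lra.
  by case/Rmult_integral => //; lra.
- have ce : RtoC (- e) <> RtoC 0 by move=> /RtoC_inj; lra.
  apply: (ess_norm_lt q1 r0 (Hsc _ ce)).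
    rewrite Cmod_R Rabs_Ropp Rabs_pos_eq; last lra.
    by rewrite /e (_ : r / (2 * M) * M = r / 2)%coqR; [lra|field; lra].
  move=> f Hf; rewrite /op_sub HVf //; apply/funext => z.
  rewrite /c RtoC_plus RtoC_opp; ring.
Qed.

Lemma nearby_of_zero p q g r : Rbar_le (Rbar.Finite 1%coqR) p -> Rbar_le p q -> (0 < r)%coqR ->
  (forall f, fock p f -> forall z, Volterra g f z = RtoC 0) ->
  exists g1 : C -> C,
    in_V p q g1 /\
    (exists f : C -> C, fock p f /\ Volterra g1 f <> Volterra g f) /\
    (ess_norm p q (op_sub (Volterra g) (Volterra g1)) < r%:E)%E.
Proof.
move=> p1 pq r0 H0; have q1 := Rbar_le_trans _ _ _ p1 pq.
have [M [M0 HM]] := sq_int_bounded_by p1 pq.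
pose e := (r / (2 * M))%coqR.
have e0 : (0 < e)%coqR by apply: Rdiv_lt_0_compat; lra.
pose c := RtoC e.
have c0 : c <> RtoC 0 by move=> /RtoC_inj; lra.
have HV f : entire f -> Volterra (fun w => Cmult (Cmult c (RtoC (/ 2)%coqR)) (Cmult w w)) f
   = fun z => Cmult c (sq_int f z).
  by move=> Hf; rewrite Volterra_sq_poly //; exact: entire_ccont.
have Hsc k : k <> RtoC 0 -> op_bounded_by p q (Cmod k * M) (fun f z => Cmult k (sq_int f z)).
  move=> k0; apply: op_bounded_by_scal => // f [Hf _]; exact: sq_int_entire.
have mc : (0 < Cmod c)%coqR by apply/Cmod_gt_0.
exists (fun w => Cmult (Cmult c (RtoC (/ 2)%coqR)) (Cmult w w)); split; [|split].
- apply: (@in_V_of_bounded_by p q _ (Cmod c * M)%coqR).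
  + exact: entire_sq_poly.
  + move=> f h a b [Hf _] [Hh _]; rewrite HV; last exact: entire_lincomb.
    rewrite HV // HV // sq_int_linear; [|exact: entire_ccont|exact: entire_ccont].
    by apply/funext => z; ring.
  + move=> f [Hf _]; rewrite HV //; apply: entire_mult; last exact: sq_int_entire.
    by move=> z; eexists; apply/is_derive_cdiff; exact: cdiff_const.
  + by apply: Rmult_lt_0_compat; lra.
  + by move=> f Hf; rewrite HV; [exact: Hsc|case: Hf].
(* The constant [1] is sent to a function with value [c / 2] at [1], which is not zero. *)
- have F1 := fock_one p1; exists (fun _ => RtoC 1); split=> //.
  rewrite HV; last by case: F1.
  move=> /(f_equal (fun h => h (RtoC 1))); rewrite H0 // sq_int_const => /(f_equal Cmod).
  rewrite !Cmod_mult Cmod_0 !Cmod_R Rabs_R1 !Rabs_pos_eq; lra.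
- have ce : RtoC (- e) <> RtoC 0 by move=> /RtoC_inj; lra.
  apply: (ess_norm_lt q1 r0 (Hsc _ ce)).
    rewrite Cmod_R Rabs_Ropp Rabs_pos_eq; last lra.
    by rewrite /e (_ : r / (2 * M) * M = r / 2)%coqR; [lra|field; lra].
  move=> f Hf; rewrite /op_sub HV; last by case: Hf.
  apply/funext => z; rewrite H0 // /c RtoC_opp; ring.
Qed.

End FockSpaces.

Theorem theorem2p5 (p q : Rbar) :
  Rbar_le (Rbar.Finite 1%R) p -> Rbar_le p q ->
  forall g : C -> C, in_V p q g ->
  forall r : R, (0 < r)%R ->
  exists g1 : C -> C,
    in_V p q g1 /\
    (exists f : C -> C, fock p f /\ Volterra g1 f <> Volterra g f) /\
    (ess_norm p q (op_sub (Volterra g) (Volterra g1)) < r%:E)%E.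
Proof.
move=> p1 pq g Hg r /RltP r0.
case: (Classical_Prop.classic (exists f, fock p f /\ exists z, Volterra g f z <> RtoC 0)) => [[f [Hf [z Hz]]]|H].
  exact: (nearby_of_nonzero (Rbar_le_trans _ _ _ p1 pq) Hg r0 Hf Hz).
apply: nearby_of_zero => // f Hf z; apply: NNPP => Hz.
by apply: H; exists f; split=> //; exists z.
Qed.
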